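(* For every $A>0$ there is a constant $C_A>0$, depending only on $A$, such that the following holds. Let $(\nu_0,\nu_1,\nu_2)\in(i\mathbb{R}_{\geq0})^3$ satisfy $\nu_0=\nu_1+\nu_2$, and put $T_0:=\max(2,|\nu_0|,|\nu_1|,|\nu_2|)=\max(2,|\nu_0|)$. Then for any $y_1,y_2>0$, $$|\tilde{W}_{\nu_1,\nu_2}(y_1,y_2)|\leq C_A\,(\log T_0)\,\sqrt{y_1y_2}\left(1+\frac{y_1}{T_0}\right)^{-A}\left(1+\frac{y_2}{T_0}\right)^{-A}.$$
   Context: Here $i\mathbb{R}_{\geq0}=\{it:\ t\in\mathbb{R},\ t\geq0\}$, $K_\nu$ denotes the $K$-Bessel function, and for $y_1,y_2>0$, $$\tilde{W}_{\nu_1,\nu_2}(y_1,y_2):=4\pi^{\frac32}\prod_{j=0}^2\left|\Gamma\left(\tfrac12+\tfrac32\nu_j\right)\right|^{-1}y_1y_2\left(\frac{y_1}{y_2}\right)^{\frac{\nu_1-\nu_2}{2}}\int_0^\infty K_{\frac32\nu_0}(2\pi y_1\sqrt{1+u})\,K_{\frac32\nu_0}(2\pi y_2\sqrt{1+u^{-1}})\,u^{\frac34(\nu_1-\nu_2)}\,\frac{du}{u}.$$ (Up to a factor of absolute value $1$, this is the standard $\mathrm{GL}_3$ Jacquet--Whittaker function with spectral parameters $\nu_1,\nu_2$ evaluated at $\mathrm{diag}(y_1y_2,y_1,1)$.) *)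

(* Defs.v *)
From mathcomp Require Export all_boot all_order all_algebra.
From mathcomp Require Export all_classical all_reals all_analysis.
From mathcomp Require Export complex.

Set Implicit Arguments.
Unset Strict Implicit.
Unset Printing Implicit Defensive.

Import Order.TTheory GRing.Theory Num.Theory.
Import numFieldNormedType.Exports.

Local Open Scope classical_set_scope.
Local Open Scope ring_scope.
Local Open Scope complex_scope.

Definition iRge0 (R : realType) : set R[i] :=
  [set z | exists2 t : R, 0 <= t & z = 0 +i* t].

(* The library's norm on [R[i]] is [R[i]]-valued; this is the modulus in [R]. *)
Definition cabs (R : realType) (z : R[i]) : R := ComplexField.Normc.normc z.

(* [x ^ s = exp (s log x)], meaningful for [0 < x]. *)
Definition cpow (R : realType) (x : R) (s : R[i]) : R[i] :=
  (expR (complex.Re s * ln x))%:C *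
  (cos (complex.Im s * ln x) +i* sin (complex.Im s * ln x)).

(* Like [Rintegral], this is meaningful only for [f] integrable on [D]; every
   integrand below is absolutely integrable for positive real arguments. *)
Definition Cintegral (R : realType) (D : set R) (f : R -> R[i]) : R[i] :=
  (\int[@lebesgue_measure R]_(x in D) complex.Re (f x)) +i*
  (\int[@lebesgue_measure R]_(x in D) complex.Im (f x)).

(* Euler's integral, meaningful for [0 < Re s]; only [Re s = 1/2] is used. *)
Definition Gamma (R : realType) (s : R[i]) : R[i] :=
  Cintegral `]0, +oo[ (fun t : R => (expR (- t))%:C * cpow t (s - 1)).

(* The standard integral formula for the K-Bessel function, for [0 < x] and any
   complex [nu]; the measure is [dt / t]. *)
Definition besselK (R : realType) (nu : R[i]) (x : R) : R[i] :=
  2^-1 * Cintegral `]0, +oo[ (fun t : R =>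
    (expR (- (x / 2) * (t + t^-1)))%:C * cpow t nu / t%:C).

(* Only [nu1] and [nu2] are free: the third parameter is always [nu1 + nu2]. *)
Definition Wtilde (R : realType) (nu1 nu2 : R[i]) (y1 y2 : R) : R[i] :=
  let nu0 := nu1 + nu2 in
  (4 * pi `^ (3 / 2)
   * (\prod_(nu <- [:: nu0; nu1; nu2]) (cabs (Gamma (1 / 2 + 3 / 2 * nu)))^-1)
   * y1 * y2)%:C
  * cpow (y1 / y2) ((nu1 - nu2) / 2)
  * Cintegral `]0, +oo[ (fun u : R =>
      besselK (3 / 2 * nu0) (2 * pi * y1 * Num.sqrt (1 + u))
      * besselK (3 / 2 * nu0) (2 * pi * y2 * Num.sqrt (1 + u^-1))
      * cpow u (3 / 4 * (nu1 - nu2)) / u%:C).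

(* Main.v *)
(* Write nu_j = i t_j and r = 3 t_0 / 2, so that K_(3 nu_0 / 2) = K_(ir) is real.
   Since t_0 = t_1 + t_2, the Gamma factors contribute exactly e^(pi r), which is
   what is needed to replace both Bessel functions by k = e^(pi r / 2) |K_(ir)|.

   The exponential rates come from Euler products: Gamma (1/2 + is) and
   Gamma (1 + is) are transported by the functional equation to large real part,
   and the products of the (1 + s^2 / (a + n)^2) are compared with
   int log (1 + s^2 / x^2) dx by the midpoint and trapezoid rules.

   As x -> 0, (x K')^2 + r^2 K^2 tends to |Gamma (1 + ir)|^2.  Energy estimates for
   the Bessel equation propagate this through the turning point x = r and give
   k(x)^2 << min (|x^2 - r^2|^(-1/2), r^(-2/3)); for small r and for x >> T_0 the
   trivial bound by K_0 suffices.

   In the u-integral with x = a sqrt (1 + u) and z = b sqrt (1 + 1/u), AM-GM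
   separates the two factors, and (ab)^(1/2) k(x) k(z) du / u is at most
   |1 - u_1 / u|^(-1/2) du / u plus the same expression in 1/u; over
   T_0^(-8) <= u <= T_0^8 this integrates to O(log T_0).  Outside this range the
   bound k(x)^2 << T_0 / x is enough. *)

Require Import Defs.
From mathcomp Require Import measurable_realfun.
From mathcomp Require Import ring lra.

Set Implicit Arguments.
Unset Strict Implicit.
Unset Printing Implicit Defensive.

Import Order.TTheory GRing.Theory Num.Theory.
Import numFieldNormedType.Exports.

Local Open Scope classical_set_scope.
Local Open Scope ring_scope.

(** Estimating [K_(ir)] by absolute values loses the factor [e^(pi r / 2)] in the oscillatory range
    [x < r]. The true size has to be carried in from the singular point [x = 0], where the energy is
    a Gamma modulus. The WKB energy degenerates at the turning point, so it is used only up to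
    distance about [r^(1/3)]; a cruder monotone energy crosses the gap, and beyond [r] the decay at
    infinity fixes the signs. The singularity in the u-integral has a bounded primitive, so it
    produces no logarithm by itself. The factor [log T_0] comes only from error terms [1 / u] over a
    range whose ends are powers of [T_0]. All oscillatory integrals are split into real ones with
    [cos (r ln t)] and [sin (r ln t)]; under [t = e^w], the inversion of [t] is the reflection of
    [w]. *)

(** * Derivatives and integrals over the half-line *)

(* [is_derive] is a type class: as a premise of a lemma, it would trigger an
   expensive instance search each time the lemma is applied. *)
Definition has_der {R : realType} (f : R -> R) (x d : R) : Prop :=
  is_derive x 1 f d.

Section DerivativeRules.
Context {R : realType}.
Implicit Types (f g : R -> R) (x c df dg dh : R).

Lemma has_der_cst c x : has_der (fun _ : R => c) x (0 : R).
Proof. exact: is_derive_cst. Qed.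

Lemma has_der_id x : has_der (fun y : R => y) x (1 : R).
Proof. exact: is_derive_id. Qed.

Lemma has_derD f g x df dg : has_der f x df -> has_der g x dg ->
  has_der (fun y => f y + g y) x (df + dg : R).
Proof. exact: is_deriveD. Qed.

Lemma has_derN f x df : has_der f x df ->
  has_der (fun y => - f y) x (- df : R).
Proof. exact: is_deriveN. Qed.

Lemma has_derM f g x df dg : has_der f x df -> has_der g x dg ->
  has_der (fun y => f y * g y) x (f x * dg + g x * df : R).
Proof. exact: is_deriveM. Qed.

Lemma has_derX f n x df : has_der f x df ->
  has_der (fun y => f y ^+ n) x (n%:R * f x ^+ n.-1 * df : R).
Proof.
move=> H; have := is_deriveX n H.
suff -> : f ^+ n = (fun y => f y ^+ n) by [].
by apply/funext => y; elim: n => [|n IH]; rewrite ?expr0// !exprS -IH.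
Qed.

Lemma has_derV f x df : f x != 0 -> has_der f x df ->
  has_der (fun y => (f y)^-1) x (- (f x) ^- 2 * df : R).
Proof. by move=> fx H; exact: is_deriveV. Qed.

Lemma has_der_comp (h : R -> R) f x dh df :
  has_der h (f x) dh -> has_der f x df ->
  has_der (fun y => h (f y)) x (dh * df : R).
Proof. exact: is_derive1_comp. Qed.

Lemma has_der_expR f x df : has_der f x df ->
  has_der (fun y => expR (f y)) x (expR (f x) * df : R).
Proof. by move=> fx; apply: has_der_comp fx; exact: is_derive_expR. Qed.

Lemma has_der_cos f x df : has_der f x df ->
  has_der (fun y => cos (f y)) x (- sin (f x) * df : R).
Proof. by move=> fx; apply: has_der_comp fx; exact: is_derive_cos. Qed.

Lemma has_der_sin f x df : has_der f x df ->
  has_der (fun y => sin (f y)) x (cos (f x) * df : R).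
Proof. by move=> fx; apply: has_der_comp fx; exact: is_derive_sin. Qed.

Lemma has_der_atan f x df : has_der f x df ->
  has_der (fun y => atan (f y)) x ((1 + f x ^+ 2)^-1 * df : R).
Proof. by move=> fx; apply: has_der_comp fx; exact: is_derive1_atan. Qed.

Lemma has_der_ln f x df : 0 < f x -> has_der f x df ->
  has_der (fun y => ln (f y)) x ((f x)^-1 * df : R).
Proof. by move=> f0 fx; apply: has_der_comp fx; exact: is_derive1_ln. Qed.

Lemma has_der_sqrt f x df : 0 < f x -> has_der f x df ->
  has_der (fun y => Num.sqrt (f y)) x ((2 * Num.sqrt (f x))^-1 * df : R).
Proof. by move=> f0 fx; apply: has_der_comp fx; exact: is_derive1_sqrt. Qed.

Lemma has_der_eq f x (df df' : R) : has_der f x df -> df = df' ->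
  has_der f x df'.
Proof. by move=> + <-. Qed.

End DerivativeRules.

Ltac der1 :=
  lazymatch goal with
  | |- has_der (fun _ => ?c) _ _ => notypeclasses refine (has_der_cst _ _)
  | |- has_der (fun y => y) _ _ => notypeclasses refine (has_der_id _)
  | |- has_der (fun y => GRing.add _ _) _ _ => notypeclasses refine (has_derD _ _)
  | |- has_der (fun y => GRing.opp _) _ _ => notypeclasses refine (has_derN _)
  | |- has_der (fun y => GRing.mul _ _) _ _ => notypeclasses refine (has_derM _ _)
  | |- has_der (fun y => GRing.exp _ ?n) _ _ => notypeclasses refine (has_derX _ _)
  | |- has_der (fun y => GRing.inv _) _ _ => notypeclasses refine (has_derV _ _)
  | |- has_der (fun y => expR _) _ _ => notypeclasses refine (has_der_expR _)
  | |- has_der (fun y => cos _) _ _ => notypeclasses refine (has_der_cos _)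
  | |- has_der (fun y => sin _) _ _ => notypeclasses refine (has_der_sin _)
  | |- has_der (fun y => atan _) _ _ => notypeclasses refine (has_der_atan _)
  | |- has_der (@GRing.mul _ _) _ _ => notypeclasses refine (has_derM _ _)
  | |- has_der (@GRing.add _ _) _ _ => notypeclasses refine (has_derD _ _)
  | |- has_der (@GRing.opp _) _ _ => notypeclasses refine (has_derN _)
  | |- has_der (@GRing.inv _) _ _ => notypeclasses refine (has_derV _ _)
  | |- has_der expR _ _ => notypeclasses refine (is_derive_expR _)
  | |- has_der (@cos _) _ _ => notypeclasses refine (is_derive_cos _)
  | |- has_der (@sin _) _ _ => notypeclasses refine (is_derive_sin _)
  | |- has_der (@atan _) _ _ => notypeclasses refine (is_derive1_atan _)
  | |- has_der (@ln _) _ _ => notypeclasses refine (is_derive1_ln _)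
  | |- has_der Num.sqrt _ _ => notypeclasses refine (is_derive1_sqrt _)
  | |- has_der (fun y => ln _) _ _ => notypeclasses refine (has_der_ln _ _)
  | |- has_der (fun y => Num.sqrt _) _ _ => notypeclasses refine (has_der_sqrt _ _)
  end.
Ltac der := repeat first [eassumption | der1].
Ltac derE := notypeclasses refine (has_der_eq _ _); [der|]; cbv beta.

Section Monotone.
Context {R : realType}.
Implicit Types (f df : R -> R) (a b x y : R).

Lemma has_der_continuous f x d : has_der f x d -> {for x, continuous f}.
Proof.
by move=> [fx _]; apply: differentiable_continuous; exact/derivable1_diffP.
Qed.

Lemma has_der_derivable f x d : has_der f x d -> derivable f x 1.
Proof. by case. Qed.

Lemma has_der_derive1 f x d : has_der f x d -> derive1 f x = d.
Proof. by move=> H; rewrite derive1E; exact: (@derive_val _ _ _ _ _ _ _ H). Qed.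

Lemma has_der_within f df a b :
  (forall x, a <= x <= b -> has_der f x (df x)) ->
  {within `[a, b], continuous f}.
Proof.
move=> H; apply: continuous_in_subspaceT => x; rewrite inE/= in_itv/= => xab.
exact: has_der_continuous (H _ xab).
Qed.

Lemma has_der_MVT f df a b : a <= b ->
  (forall x, a <= x <= b -> has_der f x (df x)) ->
  exists2 c, a <= c <= b & f b - f a = df c * (b - a).
Proof.
move=> ab H.
have [x|c] := @MVT_segment R f df a b ab _ (has_der_within H).
  by rewrite in_itv/= => /andP[/ltW ? /ltW ?]; apply: H; apply/andP.
by rewrite in_itv/= => ? ?; exists c.
Qed.

Lemma has_der_ge0_le f df a b : a <= b ->
  (forall x, a <= x <= b -> has_der f x (df x)) ->
  (forall x, a <= x <= b -> 0 <= df x) -> f a <= f b.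
Proof.
move=> ab H df0; have [c cab E] := has_der_MVT ab H.
by rewrite -subr_ge0 E mulr_ge0 ?df0// subr_ge0.
Qed.

Lemma has_der_le0_le f df a b : a <= b ->
  (forall x, a <= x <= b -> has_der f x (df x)) ->
  (forall x, a <= x <= b -> df x <= 0) -> f b <= f a.
Proof.
move=> ab H df0; have [c cab E] := has_der_MVT ab H.
by rewrite -subr_le0 E mulr_le0_ge0 ?df0// subr_ge0.
Qed.

End Monotone.

Ltac derC := notypeclasses refine (has_der_continuous _); der.

Section HalfLine.
Context {R : realType}.
Local Notation mu := (@lebesgue_measure R).
Local Notation D := (`]0, +oo[%classic : set R).
Implicit Types (f g F : R -> R) (a b t : R).

Definition hcont f := forall t, 0 < t -> {for t, continuous f}.

Lemma hcont_measurable f : hcont f -> measurable_fun D f.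
Proof.
move=> H; apply: open_continuous_measurable_fun; first exact: interval_open.
by move=> t; rewrite inE/= in_itv/= andbT; exact: H.
Qed.

Lemma hintegrable_le f g : measurable_fun D f ->
  (forall t, 0 < t -> `|f t| <= g t) ->
  mu.-integrable D (EFin \o g) -> mu.-integrable D (EFin \o f).
Proof.
move=> mf fg; apply: le_integrable => //.
  exact/measurable_EFinP.
move=> t /=; rewrite in_itv/= andbT => t0; rewrite lee_fin.
exact: le_trans (fg _ t0) (ler_norm _).
Qed.

Lemma hitvS (a b : R) : 0 < a -> `[a, b]%classic `<=` D.
Proof.
move=> a0 t /=; rewrite !in_itv/= andbT => /andP[? _]; exact: lt_le_trans a0 _.
Qed.

(** Dominated convergence for the truncations of [f], with [|f|] itself as majorant. Through it the
    half-line inherits the fundamental theorem and the substitution rules from compact intervals. *)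
Lemma hintegral_cvg f (a b : nat -> R) : mu.-integrable D (EFin \o f) ->
  (forall n, 0 < a n) -> a @ \oo --> 0 -> b @ \oo --> +oo ->
  \int[mu]_(t in `[a n, b n]) f t @[n --> \oo] --> \int[mu]_(t in D) f t.
Proof.
move=> intf a0 a_0 b_oo.
have mD : measurable D by [].
have mf : measurable_fun D (EFin \o f) by have /integrableP[] := intf.
pose h n := (EFin \o f) \_ `[a n, b n].
have hE n : (\int[mu]_(t in D) h n t = \int[mu]_(t in `[a n, b n]) (f t)%:E)%E.
  rewrite -integral_mkcondr; congr integral.
  by apply/setIidPr/hitvS.
have [||||| _ _ c] := @dominated_convergence _ _ R mu D mD h (EFin \o f)
   (fun t => `|f t|%:E).
- move=> n; apply/(measurable_restrict _ (measurable_itv _) mD) => //.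
  by apply: measurable_funS mf => //; exact: subIsetl.
- by [].
- apply: aeW => t /=; rewrite in_itv/= andbT => t0.
  apply: cvg_near_cst.
  have [N1 _ HN1] : \forall n \near \oo, a n < t by apply: cvgr_lt a_0 _ t0.
  have [N2 _ HN2] : \forall n \near \oo, t <= b n.
    by move/cvgryPge: b_oo => /(_ t).
  exists (maxn N1 N2) => //= n /=; rewrite geq_max => /andP[n1 n2].
  rewrite /h patchE ifT// inE/= in_itv/= (ltW (HN1 _ n1))/=.
  exact: HN2.
- exact: integrable_abse intf.
- apply: aeW => t n tD; rewrite /h patchE; case: ifP => _ /=.
    by rewrite lee_fin.
  by rewrite normr0 lee_fin.
have fi : (\int[mu]_(t in D) (f t)%:E)%E \is a fin_num.
  exact: integrable_fin_num intf.
move: c; rewrite /= -(fineK fi) => /fine_cvg.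
rewrite (_ : fine \o _ = fun n => \int[mu]_(t in `[a n, b n]) f t)//.
by apply/funext => n /=; rewrite hE.
Qed.

Lemma has_der_FTC2 (F f : R -> R) a b : a < b ->
  (forall t, a <= t <= b -> {for t, continuous f}) ->
  (forall t, a <= t <= b -> has_der F t (f t)) ->
  (\int[mu]_(t in `[a, b]) (f t)%:E = (F b - F a)%:E)%E.
Proof.
move=> ab cf dF; rewrite EFinB; apply: continuous_FTC2 => //.
- apply: continuous_in_subspaceT => t; rewrite inE/= in_itv/=; exact: cf.
- have cF t : a <= t <= b -> {for t, continuous F}.
    by move=> /dF; apply: has_der_continuous.
  split.
  + move=> t; rewrite in_itv/= => /andP[/ltW at_ /ltW tb].
    by apply: has_der_derivable; apply: dF; rewrite at_.
  + by apply: cvg_at_right_filter; apply: cF; rewrite lexx ltW.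
  + by apply: cvg_at_left_filter; apply: cF; rewrite lexx ltW.
- move=> t; rewrite in_itv/= => /andP[/ltW at_ /ltW tb].
  by apply: has_der_derive1; apply: dF; rewrite at_.
Qed.

(** Monotone convergence over the intervals [[1/(n+1), n+1]]. Bounding only the increments of [F]
    avoids computing its limits at 0 and infinity; in every use [F] is a multiple of an
    arctangent. *)
Lemma ge0_has_der_integral (F f : R -> R) (M : R) : hcont f ->
  (forall t, 0 < t -> 0 <= f t) ->
  (forall t, 0 < t -> has_der F t (f t)) ->
  (forall s t : R, 0 < s -> s <= t -> F t - F s <= M) ->
  (\int[mu]_(t in D) (f t)%:E <= M%:E)%E.
Proof.
move=> cf f0 dF FM.
pose S (n : nat) : set R := `[n.+1%:R^-1, n.+1%:R]%classic.
have SD n : S n `<=` D by apply: hitvS; rewrite invr_gt0.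
have DE : D = \bigcup_n S n.
  apply/seteqP; split => [t|t [n _]]; last exact: SD.
  rewrite /= in_itv/= andbT => t0.
  have h : 0 <= Num.max t t^-1 by rewrite le_max ltW.
  have := archi_boundP h.
  set n := Num.bound _; rewrite gt_max => /andP[tn ti].
  exists n => //; rewrite /S/= in_itv/=; apply/andP; split.
    rewrite invf_ple ?posrE//; apply: ltW; apply: lt_le_trans ti _.
    by rewrite ler_nat.
  by apply: ltW; apply: lt_le_trans tn _; rewrite ler_nat.
have mf : measurable_fun D (EFin \o f).
  by apply/measurable_EFinP; exact: hcont_measurable.
have nd : nondecreasing_seq S.
  move=> m n mn; apply/subsetPset => t; rewrite /S/= !in_itv/= => /andP[t1 t2].
  rewrite (le_trans _ t1) ?lef_pV2 ?posrE ?ler_nat//=.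
  by rewrite (le_trans t2)// ler_nat.
have f0S n t : S n t -> (0 <= (EFin \o f) t)%E.
  by move=> /SD; rewrite /= in_itv/= andbT lee_fin; exact: f0.
have c := @ge0_nondecreasing_set_cvg_integral _ (measurableTypeR R) R S (EFin \o f)
   lebesgue_measure nd
   (fun n => measurable_itv _)
   (fun n => measurable_funS (measurable_itv _) (@SD n) mf)
   f0S.
rewrite DE; apply: (cvge_to_le c).
apply: nearW => n.
have S0 t : n.+1%:R^-1 <= t <= n.+1%:R -> 0 < t.
  by move=> /andP[+ _]; apply: lt_le_trans; rewrite invr_gt0.
(* For [n = 0] the interval is the single point 1, while [has_der_FTC2] asks for distinct
   endpoints. *)
case: n S0 => [|n] S0.
  rewrite /S invr1 set_itv1 integral_set1 lee_fin.
  by have := FM 1 1; rewrite subrr; apply.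
have lt1 : (n.+2%:R^-1 : R) < n.+2%:R.
  by rewrite (@lt_trans _ _ 1) ?invf_lt1 ?ltr1n.
rewrite (has_der_FTC2 lt1 (fun t h => cf _ (S0 _ h)) (fun t h => dF _ (S0 _ h))).
by rewrite lee_fin FM ?invr_gt0// ltW.
Qed.

Lemma ge0_has_der_integrable (F f : R -> R) (M : R) : hcont f ->
  (forall t, 0 < t -> 0 <= f t) ->
  (forall t, 0 < t -> has_der F t (f t)) ->
  (forall s t : R, 0 < s -> s <= t -> F t - F s <= M) ->
  mu.-integrable D (EFin \o f).
Proof.
move=> cf f0 dF FM; apply/integrableP; split.
  by apply/measurable_EFinP; exact: hcont_measurable.
apply: le_lt_trans (ltry M).
apply: le_trans (ge0_has_der_integral cf f0 dF FM).
rewrite le_eqVlt; apply/orP; left; apply/eqP; apply: eq_integral => t.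
 rewrite inE/= in_itv/= andbT => t0.
by rewrite ger0_norm// f0.
Qed.

Lemma hharmonic0 : (n.+1%:R^-1 : R) @[n --> \oo] --> 0.
Proof. exact: cvg_harmonic. Qed.

Lemma hnat_oo : (n.+1%:R : R) @[n --> \oo] --> +oo.
Proof.
apply/cvgryPge => A; near=> n.
  by rewrite (@le_trans _ _ n%:R) ?ler_nat//; near: n; exact: nbhs_infty_ger.
Unshelve. all: by end_near. Qed.

Lemma ltVnat n : (0 < n)%N -> (n.+1%:R^-1 : R) < n.+1%:R.
Proof. by move=> n0; rewrite (@lt_trans _ _ 1) ?invf_lt1 ?ltr1n. Qed.

(** Every integration by parts below takes this form: [f] collects all the terms, and the boundary
    values of [F] at [1/(n+1)] and [n+1] are both of order [1 / sqrt (n+1)]. *)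
Lemma has_der_hintegral0 (F f : R -> R) (C : R) : hcont f ->
  mu.-integrable D (EFin \o f) ->
  (forall t, 0 < t -> has_der F t (f t)) ->
  (forall t, 0 < t -> `|F t| <= C * Num.sqrt t) ->
  (forall t, 0 < t -> `|F t| <= C * (Num.sqrt t)^-1) ->
  \int[mu]_(t in D) f t = 0.
Proof.
move=> cf intf dF F0 Foo.
have c := hintegral_cvg intf (fun n => _) hharmonic0 hnat_oo.
have s0 : Num.sqrt (n.+1%:R^-1 : R) @[n --> \oo] --> 0.
  rewrite -[X in _ --> X](@sqrtr0 R).
  by apply: (continuous_cvg _ _ hharmonic0); exact: sqrt_continuous.
have h : F n.+1%:R - F n.+1%:R^-1 @[n --> \oo] --> 0.
  rewrite -[X in _ --> X](subr0 0); apply: cvgB.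
  - apply: norm_cvg0; apply: (@squeeze_cvgr _ _ _ _ (cst 0) (fun n => C * Num.sqrt (n.+1%:R^-1))).
    + apply: nearW => n; rewrite normr_ge0/=.
      by rewrite (le_trans (Foo _ _))// sqrtrV.
    + exact: cvg_cst.
    + by rewrite -[X in _ --> X](mulr0 C); apply: cvgMr.
  - apply: norm_cvg0; apply: (@squeeze_cvgr _ _ _ _ (cst 0) (fun n => C * Num.sqrt (n.+1%:R^-1))).
    + by apply: nearW => n; rewrite normr_ge0/= F0// invr_gt0.
    + exact: cvg_cst.
    + by rewrite -[X in _ --> X](mulr0 C); apply: cvgMr.
apply: (cvg_unique _ (c _)) => //.
apply: cvg_trans h; apply: near_eq_cvg; near=> n.
have lt1 : (n.+1%:R^-1 : R) < n.+1%:R.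
  by apply: ltVnat; near: n; exact: nbhs_infty_gt.
have S0 t : n.+1%:R^-1 <= t <= n.+1%:R -> 0 < t.
  by move=> /andP[+ _]; apply: lt_le_trans; rewrite invr_gt0.
by rewrite /Rintegral (has_der_FTC2 lt1 (fun t h => cf _ (S0 _ h)) (fun t h => dF _ (S0 _ h))).
Unshelve. all: by end_near. Qed.

Lemma derive1_hcont (F f : R -> R) : hcont f ->
  (forall t, 0 < t -> has_der F t (f t)) -> hcont (derive1 F).
Proof.
move=> cf dF t t0.
have E s : 0 < s -> derive1 F s = f s.
  by move=> s0; apply: has_der_derive1; exact: dF.
rewrite /prop_for /continuous_at E//; apply: cvg_trans (cf _ t0).
apply: near_eq_cvg; near=> s; rewrite E//.
by near: s; exact: lt_nbhsr.
Unshelve. all: by end_near. Qed.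

Lemma hderivable_oo (F f : R -> R) a b : 0 < a -> a < b ->
  (forall t, 0 < t -> has_der F t (f t)) ->
  derivable_oo_LRcontinuous F a b.
Proof.
move=> a0 ab dF; split.
- move=> t; rewrite in_itv/= => /andP[at_ _].
  by apply: has_der_derivable; apply: dF; exact: lt_trans at_.
- by apply: cvg_at_right_filter; exact: has_der_continuous (dF _ _).
- apply: cvg_at_left_filter; apply: has_der_continuous (dF _ _).
  exact: lt_trans ab.
Qed.

Lemma hintegral_scale f (c : R) : 0 < c -> hcont f ->
  mu.-integrable D (EFin \o f) ->
  mu.-integrable D (EFin \o (fun t => f (c * t) * c)) ->
  \int[mu]_(t in D) (f (c * t) * c) = \int[mu]_(t in D) f t.
Proof.
move=> c0 cf i1 i2.
have c1 := hintegral_cvg i2 (fun n => _) hharmonic0 hnat_oo.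
have c2 : \int[mu]_(t in `[c * n.+1%:R^-1, c * n.+1%:R]) f t @[n --> \oo] --> \int[mu]_(t in D) f t.
  apply: (hintegral_cvg i1) => [n||].
  - by rewrite mulr_gt0 ?invr_gt0.
  - by rewrite -[X in _ --> X](mulr0 c); apply: cvgMr; exact: hharmonic0.
  - apply/cvgryPge => A; have /cvgryPge/(_ (A / c)) := hnat_oo.
    by apply: filterS => n; rewrite ler_pdivrMr// mulrC.
apply: (cvg_unique _ (c1 _)) => //.
apply: cvg_trans c2; apply: near_eq_cvg; near=> n.
have lt1 : (n.+1%:R^-1 : R) < n.+1%:R.
  by apply: ltVnat; near: n; exact: nbhs_infty_gt.
have dF (t : R) : has_der (fun t => c * t) t c.
  by derE; rewrite mulr0 addr0 mulr1.
have E : derive1 (fun t => c * t) = cst c.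
  by apply/funext => t; exact: has_der_derive1.
congr fine; rewrite (@integration_by_substitution_increasing R (fun t => c * t) f _ _ (ltW lt1)).
- by apply: eq_integral => t _ /=; rewrite E.
- by move=> x y _ _ xy; rewrite ltr_pM2l.
- by move=> t _; rewrite E; exact: cst_continuous.
- by rewrite E; exact: is_cvg_cst.
- by rewrite E; exact: is_cvg_cst.
- by apply: (hderivable_oo _ lt1 (fun t _ => dF t)); rewrite invr_gt0.
- apply: continuous_in_subspaceT => t; rewrite inE/= in_itv/= => /andP[+ _].
  by move=> h; apply: cf; apply: lt_le_trans h; rewrite mulr_gt0 ?invr_gt0.
Unshelve. all: by end_near. Qed.

(** With [t = e^w] this is the reflection of [w]; it stands in for parity arguments over the real
    line. *)
Lemma hintegral_inv f : hcont f ->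
  mu.-integrable D (EFin \o f) ->
  mu.-integrable D (EFin \o (fun t => f t^-1 / t ^+ 2)) ->
  \int[mu]_(t in D) (f t^-1 / t ^+ 2) = \int[mu]_(t in D) f t.
Proof.
move=> cf i1 i2.
have c1 := hintegral_cvg i2 (fun n => _) hharmonic0 hnat_oo.
have c2 := hintegral_cvg i1 (fun n => _) hharmonic0 hnat_oo.
apply: (cvg_unique _ (c1 _)) => //.
apply: cvg_trans (c2 _) => //; apply: near_eq_cvg; near=> n.
have lt1 : (n.+1%:R^-1 : R) < n.+1%:R.
  by apply: ltVnat; near: n; exact: nbhs_infty_gt.
have i0 : 0 < (n.+1%:R^-1 : R) by rewrite invr_gt0.
have dF (t : R) : 0 < t -> has_der (fun t => t^-1) t (- t ^- 2).
  by move=> t0; derE; [rewrite gt_eqF|rewrite mulr1].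
have cF : hcont (fun t : R => - t ^- 2).
  by move=> t t0; derC; rewrite ?expf_neq0// gt_eqF.
have cF' := derive1_hcont cF dF.
have E (t : R) : 0 < t -> derive1 (fun t : R => t^-1) t = - t ^- 2.
  by move=> s0; apply: has_der_derive1; exact: dF.
have := @integration_by_substitution_decreasing R (fun t => t^-1) f _ _ (ltW lt1).
rewrite invrK => H; congr fine; rewrite H.
- apply: eq_integral => t; rewrite inE/= in_itv/= => /andP[t1 _].
  have t0 : 0 < t by exact: lt_le_trans t1.
  congr EFin; transitivity (f t^-1 * - derive1 (fun t : R => t^-1) t) => //.
  by rewrite E ?opprK.
- move=> x y; rewrite !in_itv/= => /andP[x1 _] /andP[y1 _] xy.
  by rewrite ltf_pV2// posrE; [exact: lt_le_trans x1|exact: lt_le_trans y1].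
- move=> t; rewrite in_itv/= => /andP[t1 _]; apply: cF'; exact: lt_trans t1.
- apply/cvg_ex; exists (derive1 (fun t : R => t^-1) n.+1%:R^-1).
  by apply: cvg_at_right_filter; exact: cF'.
- apply/cvg_ex; exists (derive1 (fun t : R => t^-1) n.+1%:R).
  by apply: cvg_at_left_filter; exact: cF'.
- exact: (hderivable_oo i0 lt1 dF).
- apply: continuous_in_subspaceT => t; rewrite inE/= in_itv/= => /andP[+ _].
  by move=> h; apply: cf; exact: lt_le_trans h.
Unshelve. all: by end_near. Qed.

End HalfLine.

(** * Bounds for the Gamma function on vertical lines *)

Section Elementary.
Context {R : realType}.
Implicit Types (x t a b s : R).

Lemma normr_cos_le1 x : `|cos x| <= 1.
Proof. by rewrite ler_norml cos_geN1 cos_le1. Qed.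

Lemma normr_sin_le1 x : `|sin x| <= 1.
Proof. by rewrite ler_norml sin_geN1 sin_le1. Qed.

Lemma cos_ge_quad x : 1 - x ^+ 2 / 2 <= cos x.
Proof.
wlog x0 : x / 0 <= x => [H|].
  have [/H//|/ltW xle0] := leP 0 x.
  by rewrite -cosN -sqrrN; apply: H; rewrite oppr_ge0.
have sinx (y : R) : 0 <= y -> sin y <= y.
  move=> y0; suff : 0 - sin 0 <= y - sin y by rewrite sin0 subr0 subr_ge0.
  apply: (@has_der_ge0_le _ (fun z => z - sin z) (fun z => 1 - cos z) 0 y) => //.
  - by move=> z _; derE.
suff : cos 0 + 0 ^+ 2 / 2 <= cos x + x ^+ 2 / 2.
  by rewrite cos0 expr0n/= mul0r addr0; lra.
apply: (@has_der_ge0_le _ (fun z => cos z + z ^+ 2 / 2) (fun z => z - sin z) 0 x) => //.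
- by move=> z _; derE; rewrite /=; field.
- by move=> z /andP[z0 _]; rewrite subr_ge0 sinx.
Qed.

Lemma ln_le_subr1 x : 0 < x -> ln x <= x - 1.
Proof.
move=> x0; have := @le_ln1Dx R (x - 1); rewrite [1 + _]addrC subrK; apply.
by rewrite ltrBDl addrN.
Qed.

(** With [v = sqrt t] the claim is [|ln v| <= |v - 1/v|], which follows from
    [1 - 1/v <= ln v <= v - 1]. It serves twice: it turns a phase error into a rational function
    with explicit Gamma moments, and for [t = e^w] it reads [w^2 <= 8 (cosh w - 1)]. *)
Lemma ln_sqr_le t : 0 < t -> ln t ^+ 2 <= 4 * ((t - 1) ^+ 2 / t).
Proof.
move=> t0; set v := Num.sqrt t.
have v0 : 0 < v by rewrite sqrtr_gt0.
have -> : t = v ^+ 2 by rewrite sqr_sqrtr// ltW.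
rewrite lnXn// -[ln v *+ 2]mulr_natl.
have h1 := ln_le_subr1 v0.
have h2 : 1 - v^-1 <= ln v.
  have := ln_le_subr1 (x := v^-1); rewrite invr_gt0 lnV ?posrE// => /(_ v0); lra.
have -> : 4 * ((v ^+ 2 - 1) ^+ 2 / v ^+ 2) = (2 * (v - v^-1)) ^+ 2.
  by field; rewrite gt_eqF.
have [v1|v1] := leP 1 v.
  have v1' : v^-1 <= 1 by rewrite invf_le1.
  have l0 : 0 <= ln v by rewrite ln_ge0.
  by rewrite lerXn2r ?nnegrE; lra.
have v1' : 1 <= v^-1 by rewrite invf_ge1 ?ltW.
by rewrite -[leLHS]sqrrN -[leRHS]sqrrN lerXn2r ?nnegrE; lra.
Qed.

Lemma sqrt_expR t : 0 < t -> Num.sqrt t = expR (2^-1 * ln t).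
Proof.
move=> t0; have e0 := expR_ge0 (2^-1 * ln t).
apply/eqP; rewrite -(@eqrXn2 _ 2)// ?sqrtr_ge0// sqr_sqrtr ?ltW//.
by rewrite -expRM_natl mulrA divff// mul1r lnK.
Qed.

End Elementary.

(** * Gamma integrals in real form, functional equation and concentration *)

Section GammaIntegral.
Context {R : realType}.
Local Notation mu := (@lebesgue_measure R).
Local Notation D := (`]0, +oo[%classic : set R).
Implicit Types (x t a b s : R).

(* [gC a s] and [gS a s] are the real and imaginary parts of
   [Gamma (a + i s)], and [gnorm a s] is its squared modulus. *)
Definition gker a t := expR (- t) * expR ((a - 1) * ln t).
Definition gC a s := \int[mu]_(t in D) (gker a t * cos (s * ln t)).
Definition gS a s := \int[mu]_(t in D) (gker a t * sin (s * ln t)).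
Definition gnorm a s := gC a s ^+ 2 + gS a s ^+ 2.

Lemma gker_ge0 a t : 0 <= gker a t.
Proof. by rewrite mulr_ge0 ?expR_ge0. Qed.

Lemma gker1 a t : 0 < t -> gker (a + 1) t = t * gker a t.
Proof.
move=> t0; rewrite /gker addrK (_ : a * ln t = (a - 1) * ln t + ln t).
  by rewrite expRD lnK// mulrA mulrC.
by ring.
Qed.

(* A common majorant [1 / (sqrt t (1 + t))] for the Gamma integrands with
   [1/2 <= a]: its primitive [2 atan (sqrt t)] is bounded. *)
Definition hdom t := (Num.sqrt t * (1 + t))^-1.

Lemma hdom_integrable : mu.-integrable D (EFin \o hdom).
Proof.
have p t : 0 < t -> 0 < Num.sqrt t * (1 + t).
  by move=> t0; rewrite mulr_gt0 ?sqrtr_gt0// addr_gt0.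
have d t : 0 < t -> has_der (fun t => 2 * atan (Num.sqrt t)) t (hdom t).
  move=> t0; have v0 : 0 < Num.sqrt t by rewrite sqrtr_gt0.
  derE => //; rewrite sqr_sqrtr ?ltW// /hdom mulr0 addr0.
  field; rewrite !gt_eqF//; lra.
apply: (ge0_has_der_integrable (M := pi) _ _ d).
- move=> t t0; rewrite /hdom; derC => //; last by rewrite gt_eqF// p.
- by move=> t t0; rewrite invr_ge0 ltW// p.
- move=> s t s0 st; have := atan_ltpi2 (Num.sqrt t).
  have : 0 <= atan (Num.sqrt s) by rewrite -(@atan0 R) le_atan.
  by have := pi_gt0 R; lra.
Qed.

(** Of the factor [e^(-t)], one half absorbs [t^(a - 1/2)] and the other half absorbs [1 + t]; what
    remains is [t^(-1/2)]. *)
Lemma gker_le a : 2^-1 <= a ->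
  exists2 K, 0 < K & forall t, 0 < t -> gker a t <= K * hdom t.
Proof.
move=> ha; set b := a - 2^-1.
have [K K0 HK] : exists2 K, 0 < K & forall t, 0 < t ->
    expR (b * ln t) <= K * expR (t / 2).
  have : 0 <= b by rewrite subr_ge0.
  rewrite le_eqVlt => /predU1P[<-|b0].
    by exists 1 => // t t0; rewrite mul0r expR0 mul1r; have := expR_ge1Dx (t / 2); lra.
  exists (expR (b * ln (2 * b))) => [|t t0]; first exact: expR_gt0.
  rewrite -expRD ler_expR.
  have := @ln_le_subr1 _ (t / (2 * b)).
  rewrite divr_gt0 ?mulr_gt0// => /(_ isT).
  rewrite ln_div ?posrE ?mulr_gt0// => h.
  have : b * (ln t - ln (2 * b)) <= b * (t / (2 * b) - 1) by rewrite ler_pM2l.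
  have -> : b * (t / (2 * b) - 1) = t / 2 - b by field; rewrite gt_eqF.
  by lra.
exists (2 * K) => [|t t0]; first by rewrite mulr_gt0.
have st : 0 < Num.sqrt t by rewrite sqrtr_gt0.
rewrite /hdom ler_pdivlMr ?mulr_gt0 ?addr_gt0//.
rewrite /gker (_ : (a - 1) * ln t = b * ln t - 2^-1 * ln t); last by rewrite /b; field.
rewrite expRD [expR (- (2^-1 * _))]expRN -sqrt_expR//.
rewrite [leLHS](_ : _ = expR (- t) * expR (b * ln t) * (1 + t)); last first.
  set e1 := expR _; set e2 := expR _; field; rewrite gt_eqF//.
have h1 : 1 + t <= 2 * expR (t / 2).
  by have := expR_ge1Dx (t / 2); lra.
apply: (@le_trans _ _ (expR (- t) * (K * expR (t / 2)) * (2 * expR (t / 2)))).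
  rewrite ler_pM ?mulr_ge0 ?expR_ge0//; first by lra.
  by rewrite ler_wpM2l ?expR_ge0// HK.
rewrite (_ : _ * _ * _ = 2 * K * (expR (- t) * (expR (t / 2) * expR (t / 2)))).
  by rewrite -!expRD -splitr addNr expR0 mulr1.
by ring.
Qed.

Lemma gker_hcont a : hcont (gker a).
Proof. by move=> t t0; rewrite /gker; derC. Qed.

Lemma gker_integrable a (f : R -> R) : 2^-1 <= a -> hcont f ->
  (forall t, 0 < t -> `|f t| <= 1) ->
  mu.-integrable D (EFin \o (fun t => gker a t * f t)).
Proof.
move=> ha cf f1; have [K K0 HK] := gker_le ha.
apply: (@hintegrable_le _ _ (fun t => K * hdom t)).
- by apply: hcont_measurable => t t0; apply: continuousM; [exact: gker_hcont|exact: cf].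
- move=> t t0; rewrite normrM ger0_norm ?gker_ge0//.
  rewrite -[leRHS]mulr1 ler_pM ?gker_ge0 ?HK ?f1//.
- rewrite (_ : _ \o _ = (fun t => K%:E * (hdom t)%:E)%E)//.
  by apply: integrableZl => //; exact: hdom_integrable.
Qed.

Lemma gC_integrable a s : 2^-1 <= a ->
  mu.-integrable D (EFin \o (fun t => gker a t * cos (s * ln t))).
Proof.
move=> ha; apply: gker_integrable => // [t t0|t _]; first by derC.
exact: normr_cos_le1.
Qed.

Lemma gS_integrable a s : 2^-1 <= a ->
  mu.-integrable D (EFin \o (fun t => gker a t * sin (s * ln t))).
Proof.
move=> ha; apply: gker_integrable => // [t t0|t _]; first by derC.
exact: normr_sin_le1.
Qed.

(** The integral of the derivative of [t^a e^(-t) f(t)] vanishes. With [f], [g] a cosine and a sine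
    of [s ln t] in either order, and [c] equal to [-s] or [s], this gives the real and imaginary
    parts of [Gamma (z + 1) = z Gamma z]. *)
Lemma gker_parts (a c : R) (f g : R -> R) : 2^-1 <= a ->
  (forall t, 0 < t -> has_der f t (c * g t / t)) ->
  (forall t, 0 < t -> `|f t| <= 1) ->
  hcont g -> (forall t, 0 < t -> `|g t| <= 1) ->
  \int[mu]_(t in D) (gker (a + 1) t * f t) =
  a * \int[mu]_(t in D) (gker a t * f t) + c * \int[mu]_(t in D) (gker a t * g t).
Proof.
move=> ha df f1 cg g1.
have ha1 : 2^-1 <= a + 1 by lra.
have cf : hcont f by move=> t t0; exact: has_der_continuous (df t t0).
have i1 := gker_integrable ha1 cf f1.
have i2 := gker_integrable ha cf f1.
have i3 := gker_integrable ha cg g1.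
have i2' : mu.-integrable D (EFin \o (fun t => a * (gker a t * f t))).
  by rewrite (_ : _ \o _ = (fun t => a%:E * (gker a t * f t)%:E)%E)//; exact: integrableZl.
have i3' : mu.-integrable D (EFin \o (fun t => c * (gker a t * g t))).
  by rewrite (_ : _ \o _ = (fun t => c%:E * (gker a t * g t)%:E)%E)//; exact: integrableZl.
have i23 : mu.-integrable D (EFin \o (fun t => a * (gker a t * f t) + c * (gker a t * g t))).
  rewrite (_ : _ \o _ = (fun t => (a * (gker a t * f t))%:E + (c * (gker a t * g t))%:E)%E)//.
  exact: integrableD.
apply/eqP; rewrite -!RintegralZl// -RintegralD// -subr_eq0 -opprB oppr_eq0 -RintegralB//.
apply/eqP.
have [K K0 HK] := gker_le ha.
pose F t := gker (a + 1) t * f t.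
have FK t : 0 < t -> `|F t| <= K * (t * hdom t).
  move=> t0; rewrite /F normrM ger0_norm ?gker_ge0// -[leRHS]mulr1.
  rewrite ler_pM ?gker_ge0 ?f1// gker1// [leRHS]mulrCA ler_pM2l// HK//.
apply: (has_der_hintegral0 (F := F) (C := K)).
- move=> t t0; apply: continuousB; first apply: continuousD.
  + by apply: continuousM; [exact: cst_continuous|apply: continuousM; [exact: gker_hcont|exact: cf]].
  + by apply: continuousM; [exact: cst_continuous|apply: continuousM; [exact: gker_hcont|exact: cg]].
  + by apply: continuousM; [exact: gker_hcont|exact: cf].
- rewrite (_ : _ \o _ = (fun t => (a * (gker a t * f t) + c * (gker a t * g t))%:E - (gker (a + 1) t * f t)%:E)%E)//.
  exact: integrableB.
- move=> t t0; have dft := df t t0; rewrite /F {1}/gker.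
  derE.
  rewrite gker1// {1}/gker (_ : (a + 1 - 1) * ln t = (a - 1) * ln t + ln t); last by ring.
  by rewrite expRD lnK// /gker; field; rewrite gt_eqF.
- move=> t t0; rewrite (le_trans (FK _ t0))// ler_pM2l// /hdom.
  have s0 : 0 < Num.sqrt t by rewrite sqrtr_gt0.
  rewrite ler_pdivrMr ?mulr_gt0 ?addr_gt0// mulrA -expr2 sqr_sqrtr ?(ltW t0)//.
  by rewrite ler_peMr ?(ltW t0)// lerDl ltW.
- move=> t t0; rewrite (le_trans (FK _ t0))// ler_pM2l// /hdom invfM mulrCA.
  rewrite -[leRHS]mulr1 ler_pM2l ?invr_gt0 ?sqrtr_gt0//.
  by rewrite ler_pdivrMr ?addr_gt0// mul1r lerDr.
Qed.

Lemma gC_rec a s : 2^-1 <= a -> gC (a + 1) s = a * gC a s - s * gS a s.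
Proof.
move=> ha; rewrite -mulNr; apply: gker_parts => //.
- by move=> t t0; derE => //; ring.
- by move=> t _; exact: normr_cos_le1.
- by move=> t t0; derC.
- by move=> t _; exact: normr_sin_le1.
Qed.

Lemma gS_rec a s : 2^-1 <= a -> gS (a + 1) s = a * gS a s + s * gC a s.
Proof.
move=> ha; apply: gker_parts => //.
- by move=> t t0; derE => //; ring.
- by move=> t _; exact: normr_sin_le1.
- by move=> t t0; derC.
- by move=> t _; exact: normr_cos_le1.
Qed.

Lemma gnorm_rec a s : 2^-1 <= a ->
  gnorm (a + 1) s = (a ^+ 2 + s ^+ 2) * gnorm a s.
Proof. by move=> ha; rewrite /gnorm gC_rec// gS_rec//; ring. Qed.

Lemma gC0_rec a : 2^-1 <= a -> gC (a + 1) 0 = a * gC a 0.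
Proof. by move=> ha; rewrite gC_rec// mul0r subr0. Qed.

Lemma gC0E a : gC a 0 = \int[mu]_(t in D) gker a t.
Proof. by apply: eq_Rintegral => t _; rewrite mul0r cos0 mulr1. Qed.

Lemma gC0_integrable a : 2^-1 <= a -> mu.-integrable D (EFin \o gker a).
Proof.
move=> ha; have := gker_integrable (f := cst 1) ha.
rewrite (_ : (fun t => gker a t * cst 1 t) = gker a); last first.
  by apply/funext => t; rewrite mulr1.
by apply => [t _|t _]; [exact: cst_continuous|rewrite normr1].
Qed.

Lemma gC0_gt0 a : 2^-1 <= a -> 0 < gC a 0.
Proof.
move=> ha; rewrite gC0E; pose c := expR (- 2) * expR (- `|a - 1| * ln 2).
have c0 : 0 < c by rewrite mulr_gt0 ?expR_gt0.
apply: (lt_le_trans c0); rewrite -lee_fin.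
have iR := gC0_integrable ha.
rewrite /Rintegral fineK; last exact: integrable_fin_num iR.
have mg : measurable_fun D (EFin \o gker a) by have /integrableP[] := iR.
have sD : `[1, 2]%classic `<=` D by exact: hitvS.
apply: (@le_trans _ _ (\int[mu]_(t in `[1%R, 2%R]) (gker a t)%:E)%E); last first.
  by apply: ge0_subset_integral => // t _; rewrite lee_fin gker_ge0.
have -> : c%:E = (\int[mu]_(t in `[1%R, 2%R]) c%:E)%E.
  rewrite integral_cst//= lebesgue_measure_itv/= lte_fin ltr1n/= -EFinB.
  by rewrite -EFinM; congr EFin; ring.
apply: ge0_le_integral => //.
- by move=> t _; rewrite lee_fin; exact: ltW.
- exact: measurable_funS mg.
- move=> t; rewrite /= in_itv/= => /andP[t1 t2]; rewrite lee_fin /gker.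
  have t0 : 0 < t by lra.
  apply: ler_pM; rewrite ?expR_ge0// ler_expR ?lerN2//.
  have l0 : 0 <= ln t by rewrite ln_ge0.
  have l2 : ln t <= ln 2 by rewrite ler_ln ?posrE.
  apply: (@le_trans _ _ (- `|a - 1| * ln t)).
    by rewrite !mulNr lerN2 ler_wpM2l.
  by rewrite ler_wpM2r// lerNnormlW.
Qed.

Lemma gnorm_le a s : 2^-1 <= a -> gnorm a s <= 2 * gC a 0 ^+ 2.
Proof.
move=> ha.
have h (f : R -> R) : hcont f -> (forall t, 0 < t -> `|f t| <= 1) ->
    (\int[mu]_(t in D) (gker a t * f t)) ^+ 2 <= gC a 0 ^+ 2.
  move=> cf f1; rewrite gC0E -[leLHS]real_normK ?num_real// lerXn2r ?nnegrE//.
    by apply: Rintegral_ge0 => t _; exact: gker_ge0.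
  have i := gker_integrable ha cf f1.
  apply: le_trans (le_normr_Rintegral _ i) _ => //.
  apply: le_Rintegral => //; [exact: integrable_abse i|exact: gC0_integrable|].
  move=> t; rewrite /= in_itv/= andbT => t0; rewrite normrM ger0_norm ?gker_ge0//.
  by rewrite ler_piMr ?gker_ge0 ?f1.
rewrite /gnorm mulr_natl mulr2n lerD// h//.
- by move=> t t0; derC.
- by move=> t _; exact: normr_cos_le1.
- by move=> t t0; derC.
- by move=> t _; exact: normr_sin_le1.
Qed.

(** Here [G] and [G1] are [Gamma (m + 1/2)] and [Gamma (m - 1/2)], and the bracket is the integral
    of the Gamma density times [1 - k (t - m)^2 / t]. The mean of [(t - m)^2 / t] is at most 3/2, so
    [k <= 1/3] loses at most half of [G]. *)
Lemma concentration_arith (m k G G1 : R) : 1 <= m -> 0 <= k -> k <= 3^-1 -> 0 < G ->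
  G = (m - 2^-1) * G1 ->
  G <= 2 * (- (k * m ^+ 2) * G1 + (1 + 2 * m * k) * G - k * ((m + 2^-1) * G)).
Proof.
move=> m1 k0 k3 G0 GE.
have p : 0 < m - 2^-1 by lra.
have -> : G1 = G / (m - 2^-1) by rewrite GE mulrAC divff ?mul1r// gt_eqF.
have h1 : m ^+ 2 / (m - 2^-1) <= m + 1 by rewrite ler_pdivrMr//; nra.
rewrite (_ : _ + _ - _ = G * (1 - k * (m ^+ 2 / (m - 2^-1) - m + 2^-1))); last first.
  by field; rewrite gt_eqF//; lra.
rewrite mulrCA -[leLHS]mulr1 ler_pM2l//.
have : k * (m ^+ 2 / (m - 2^-1) - m + 2^-1) <= 3^-1 * (1 + 2^-1).
  apply: (@le_trans _ _ (k * (1 + 2^-1))); last by rewrite ler_pM2r//; lra.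
  by rewrite ler_wpM2l//; lra.
lra.
Qed.

(* The Gamma density concentrates at [t = N] with relative variance [O(1/N)],
   so the phase [s ln t] is almost constant there. *)
Lemma gC0_ge_cos_shift (N : nat) s : 6 * s ^+ 2 <= N%:R -> (0 < N)%N ->
  gC (N%:R + 2^-1) 0 <=
  2 * \int[mu]_(t in D) (gker (N%:R + 2^-1) t * cos (s * ln t - s * ln N%:R)).
Proof.
set m : R := N%:R; move=> sm N0.
have m1 : 1 <= m by rewrite ler1n.
have m0 : 0 < m by lra.
have ha : 2^-1 <= m - 2^-1 by lra.
have ha1 : 2^-1 <= m + 2^-1 by lra.
have ha2 : 2^-1 <= m + 2^-1 + 1 by lra.
have mE : m + 2^-1 = m - 2^-1 + 1 by lra.
have h3s : 2 * s ^+ 2 <= 3^-1 * m by lra.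
set G := gC (m + 2^-1) 0.
have G0 : 0 < G by exact: gC0_gt0.
have GE1 : gC (m + 2^-1 + 1) 0 = (m + 2^-1) * G by rewrite gC0_rec.
have GE2 : G = (m - 2^-1) * gC (m - 2^-1) 0.
  by rewrite -(gC0_rec ha) -mE.
(* By [cos y >= 1 - y^2 / 2] and [ln_sqr_le], the cosine is at least [1 - k (t - m)^2 / t]; the
   hypothesis [6 s^2 <= N] is what makes [k <= 1/3]. *)
pose k := 2 * s ^+ 2 / m.
have k3 : k <= 3^-1 by rewrite /k ler_pdivrMr.
have k0 : 0 <= k by rewrite divr_ge0 ?(ltW m0)// mulr_ge0 ?sqr_ge0.
have i1 := gC0_integrable ha; have i2 := gC0_integrable ha1.
have i3 := gC0_integrable ha2.
have iZ f c : mu.-integrable D (EFin \o f) -> mu.-integrable D (EFin \o (fun t => c * f t)).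
  move=> i; rewrite (_ : _ \o _ = (fun t => c%:E * (f t)%:E)%E)//; exact: integrableZl.
have iD f g : mu.-integrable D (EFin \o f) -> mu.-integrable D (EFin \o g) ->
     mu.-integrable D (EFin \o (fun t => f t + g t)).
  move=> i j; rewrite (_ : _ \o _ = (fun t => (f t)%:E + (g t)%:E)%E)//; exact: integrableD.
have j1 := iZ _ (- (k * m ^+ 2)) i1; have j2 := iZ _ (1 + 2 * m * k) i2.
have j3 := iZ _ (- k) i3.
(* Expanding [(t - m)^2 / t] turns this minorant into a combination of three neighbouring Gamma
   densities, whose masses are related by the functional equation. *)
pose low t := - (k * m ^+ 2) * gker (m - 2^-1) t + (1 + 2 * m * k) * gker (m + 2^-1) t
    + - k * gker (m + 2^-1 + 1) t.
have ilow : mu.-integrable D (EFin \o low) by apply: (iD) => //; exact: iD.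
have intlow : \int[mu]_(t in D) low t =
   - (k * m ^+ 2) * gC (m - 2^-1) 0 + (1 + 2 * m * k) * G - k * gC (m + 2^-1 + 1) 0.
  rewrite /low RintegralD//; last exact: iD.
  by rewrite RintegralD// !RintegralZl// -!gC0E [- k * _]mulNr.
have low_le t : 0 < t -> low t <= gker (m + 2^-1) t * cos (s * ln t - s * ln m).
  move=> t0; have g0 := gker_ge0 (m - 2^-1) t.
  have E1 : gker (m + 2^-1) t = t * gker (m - 2^-1) t.
    by rewrite mE gker1.
  apply: (@le_trans _ _ (gker (m + 2^-1) t * (1 - k * ((t - m) ^+ 2 / t)))).
    rewrite /low gker1// E1 le_eqVlt; apply/orP; left; apply/eqP.
    by field; rewrite gt_eqF.
  rewrite ler_wpM2l ?gker_ge0//.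
  apply: le_trans (cos_ge_quad _); rewrite lerB// -mulrBr -ln_div ?posrE//.
  have h := ln_sqr_le (t := t / m); have := h (divr_gt0 t0 m0) => {}h.
  rewrite exprMn ler_pdivrMr//.
  apply: (@le_trans _ _ (s ^+ 2 * (4 * ((t / m - 1) ^+ 2 / (t / m))))).
    by rewrite ler_wpM2l ?sqr_ge0.
  rewrite /k le_eqVlt; apply/orP; left; apply/eqP.
  by field; rewrite !gt_eqF.
apply: (@le_trans _ _ (2 * \int[mu]_(t in D) low t)); last first.
  rewrite ler_pM2l//; apply: le_Rintegral => //.
    apply: gker_integrable => // [t t0|t _]; first by derC.
    exact: normr_cos_le1.
  by move=> t; rewrite /= in_itv/= andbT; exact: low_le.
rewrite intlow GE1; exact: concentration_arith.
Qed.

(** The integral in [gC0_ge_cos_shift] is the real part of the Gamma value rotated by a phase, hence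
    at most its modulus. *)
Lemma gnorm_lower N s : 6 * s ^+ 2 <= N%:R -> (0 < N)%N ->
  gC (N%:R + 2^-1) 0 ^+ 2 <= 4 * gnorm (N%:R + 2^-1) s.
Proof.
move=> sN N0; have h := gC0_ge_cos_shift sN N0.
have m1 : (1 : R) <= N%:R by rewrite ler1n.
have ha : (2^-1 : R) <= N%:R + 2^-1 by lra.
move: h; set a := N%:R + 2^-1; set psi := s * ln N%:R; set X := Rintegral _ _ _ => h.
have XE : X = cos psi * gC a s + sin psi * gS a s.
  rewrite -!RintegralZl//; [|exact: gS_integrable|exact: gC_integrable].
  rewrite -RintegralD//.
  - by apply: eq_Rintegral => t _; rewrite cosB; ring.
  - rewrite (_ : _ \o _ = (fun t => (cos psi)%:E * (gker a t * cos (s * ln t))%:E)%E)//.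
    by apply: integrableZl => //; exact: gC_integrable.
  - rewrite (_ : _ \o _ = (fun t => (sin psi)%:E * (gker a t * sin (s * ln t))%:E)%E)//.
    by apply: integrableZl => //; exact: gS_integrable.
have G0 : 0 < gC a 0 by exact: gC0_gt0.
have : gC a 0 ^+ 2 <= (2 * X) ^+ 2 by rewrite lerXn2r ?nnegrE//; lra.
move/le_trans; apply; rewrite exprMn (_ : 2 ^+ 2 = 4 :> R); last by ring.
rewrite ler_pM2l// XE /gnorm -subr_ge0.
have -> : gC a s ^+ 2 + gS a s ^+ 2 = (cos psi ^+ 2 + sin psi ^+ 2) * (gC a s ^+ 2 + gS a s ^+ 2).
  by rewrite cos2Dsin2 mul1r.
rewrite (_ : _ - _ = (sin psi * gC a s - cos psi * gS a s) ^+ 2); last by ring.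
exact: sqr_ge0.
Qed.

(** The functional equation is iterated at [s] and at 0 and the results compared, with denominators
    cleared. Once the ratio of [|Gamma (a + N + is)|] to [Gamma (a + N)] is controlled, the product
    alone determines the ratio at [a]. *)
Lemma gnorm_prod a s N : 2^-1 <= a ->
  gnorm (a + N%:R) s * gC a 0 ^+ 2 =
  gnorm a s * gC (a + N%:R) 0 ^+ 2 * \prod_(n < N) (1 + s ^+ 2 / (a + n%:R) ^+ 2).
Proof.
move=> ha; elim: N => [|N IH]; first by rewrite big_ord0 addr0 mulr1.
have hN : 2^-1 <= a + N%:R by rewrite (le_trans ha)// lerDl.
have p : 0 < a + N%:R by lra.
rewrite big_ord_recr/= -natr1 addrA gnorm_rec// gC0_rec// -[LHS]mulrA IH.
move: (gnorm a s) (gC _ 0) (\prod_(_ < _) _) => g c P.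
by field; rewrite gt_eqF.
Qed.

End GammaIntegral.

(** * Euler products against the integral of [log (1 + s^2 / x^2)] *)

Section ProductBounds.
Context {R : realType}.
Variable s : R.
Hypothesis s0 : 0 < s.
Implicit Types (x y h k m : R).

(** [Ell] is the primitive of [ell] that vanishes at 0. It tends to [pi s] at infinity, which is the
    source of the exponential rate. *)
Definition ell x := ln (1 + s ^+ 2 / x ^+ 2).
Definition Ell x := x * ell x + 2 * s * atan (x / s).

Let ell_arg x : 0 < x -> 0 < 1 + s ^+ 2 / x ^+ 2.
Proof. by move=> x0; rewrite addr_gt0// divr_gt0 ?exprn_gt0. Qed.

Lemma ell_ge0 x : 0 <= ell x.
Proof.
by rewrite ln_ge0// lerDl divr_ge0 ?sqr_ge0.
Qed.

Lemma has_der_ell x : 0 < x ->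
  has_der ell x (- (2 * s ^+ 2 / (x * (x ^+ 2 + s ^+ 2)))).
Proof.
move=> x0; rewrite /ell; derE; rewrite ?ell_arg ?expf_neq0 ?gt_eqF//=.
have := ell_arg x0; have : 0 < x ^+ 2 + s ^+ 2 by rewrite addr_gt0 ?exprn_gt0.
move=> p1 p2; field; rewrite !gt_eqF// ?addr_gt0 ?exprn_gt0//.
Qed.

Lemma has_der_Ell x : 0 < x -> has_der Ell x (ell x).
Proof.
move=> x0; have d := has_der_ell x0; rewrite /Ell; derE.
have p1 : 0 < x ^+ 2 + s ^+ 2 by rewrite addr_gt0 ?exprn_gt0.
by field; rewrite !gt_eqF// ?addr_gt0 ?exprn_gt0// addrC.
Qed.

Lemma Ell0 : Ell 0 = 0.
Proof. by rewrite /Ell !mul0r atan0 mulr0 addr0. Qed.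

Lemma Ell_ge0 x : 0 <= x -> 0 <= Ell x.
Proof.
move=> x0; rewrite addr_ge0 ?mulr_ge0 ?ell_ge0 ?(ltW s0)//.
by rewrite -(@atan0 R) le_atan// divr_ge0// ltW.
Qed.

Lemma Ell_le x y : 0 < x -> x <= y -> Ell x <= Ell y.
Proof.
move=> x0 xy; apply: (has_der_ge0_le (df := ell)) => // z /andP[xz _].
- by apply: has_der_Ell; exact: lt_le_trans xz.
- exact: ell_ge0.
Qed.

Lemma Ell_le_pi x : 0 < x -> Ell x <= s ^+ 2 / x + pi * s.
Proof.
move=> x0; rewrite /Ell lerD//.
  have h : ell x <= s ^+ 2 / x ^+ 2.
    by apply: le_ln1Dx; rewrite (lt_trans (ltrN10 _))// divr_gt0 ?exprn_gt0.
  rewrite (_ : s ^+ 2 / x = x * (s ^+ 2 / x ^+ 2)); last by field; rewrite gt_eqF.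
  by rewrite ler_pM2l.
have h : s * (2 * atan (x / s)) <= s * pi.
  by rewrite ler_pM2l//; have := atan_ltpi2 (x / s); lra.
lra.
Qed.

Let has_der_shift (f : R -> R) m k d : has_der f (m + k) d ->
  has_der (fun k => f (m + k)) k d.
Proof.
move=> fd; have h : has_der (fun k => m + k) k 1 by derE; rewrite add0r.
by rewrite -[d]mulr1; exact: (@has_der_comp R f (fun k => m + k) k d 1 fd h).
Qed.

Let has_der_reflect (f : R -> R) m k d : has_der f (m - k) d ->
  has_der (fun k => f (m - k)) k (- d).
Proof.
move=> fd; have h : has_der (fun k => m - k) k (- 1) by derE; rewrite add0r.
by rewrite -[d]mulr1 -mulrN; exact: (@has_der_comp R f (fun k => m - k) k d (- 1) fd h).
Qed.

(** Midpoint rule for the convex function [ell]. After differentiation in [h] it remains to compare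
    [ell (m + k) + ell (m - k)] with [2 ell m]; exponentiated, this is an inequality between the
    reciprocals of [m + k], [m - k] and [m], based on [w^2 <= u v]. *)
Lemma Ell_midpoint m h : 0 <= h -> h < m ->
  2 * h * ell m <= Ell (m + h) - Ell (m - h).
Proof.
move=> h0 hm; rewrite -subr_ge0.
pose g k := Ell (m + k) - Ell (m - k) - 2 * k * ell m.
suff : g 0 <= g h by rewrite /g addr0 subr0 subrr mulr0 mul0r subr0.
apply: (has_der_ge0_le (df := fun k => ell (m + k) + ell (m - k) - 2 * ell m)) => //.
  move=> k /andP[k0 kh].
  have d1 : has_der (fun k => Ell (m + k)) k (ell (m + k)).
    by apply: has_der_shift; apply: has_der_Ell; lra.
  have d2 : has_der (fun k => Ell (m - k)) k (- ell (m - k)).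
    by apply: has_der_reflect; apply: has_der_Ell; lra.
  by rewrite /g; derE; ring.
move=> k /andP[k0 kh]; rewrite /ell subr_ge0.
have mk1 : 0 < m + k by lra.
have mk2 : 0 < m - k by lra.
have m0 : 0 < m by lra.
rewrite -lnM ?posrE ?ell_arg// mulr_natl -lnXn ?ell_arg//.
rewrite ler_ln ?posrE ?exprn_gt0 ?mulr_gt0 ?ell_arg//.
have E (x : R) : (x ^+ 2)^-1 = x^-1 ^+ 2 by rewrite exprVn.
rewrite !E; set u := (m + k)^-1; set v := (m - k)^-1; set w := m^-1.
have u0 : 0 < u by rewrite invr_gt0.
have v0 : 0 < v by rewrite invr_gt0.
have w0 : 0 < w by rewrite invr_gt0.
have uvw : w ^+ 2 <= u * v.
  rewrite /u /v /w -E -invfM lef_pV2 ?posrE ?mulr_gt0 ?exprn_gt0//.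
  by have := sqr_ge0 k; lra.
have h1 : 2 * w ^+ 2 <= u ^+ 2 + v ^+ 2 by have := sqr_ge0 (u - v); lra.
have h2 : w ^+ 2 * w ^+ 2 <= u ^+ 2 * v ^+ 2.
  by rewrite -[u ^+ 2 * _]exprMn -[w ^+ 2 * _]expr2 lerXn2r ?nnegrE ?sqr_ge0 ?(mulr_ge0 (ltW u0) (ltW v0)).
have p : 0 < s ^+ 2 by rewrite exprn_gt0.
have h3 : s ^+ 2 * (2 * w ^+ 2) <= s ^+ 2 * (u ^+ 2 + v ^+ 2) by rewrite ler_pM2l.
have h4 : s ^+ 2 * s ^+ 2 * (w ^+ 2 * w ^+ 2) <= s ^+ 2 * s ^+ 2 * (u ^+ 2 * v ^+ 2).
  by rewrite ler_pM2l// mulr_gt0.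
lra.
Qed.

(** The difference of the two sides has derivative [k] times an increment of the increasing function
    [ell']. *)
Lemma Ell_trapezoid m h : 0 <= h -> h < m ->
  Ell (m + h) - Ell (m - h) <= h * (ell (m - h) + ell (m + h)).
Proof.
move=> h0 hm; rewrite -subr_ge0.
pose g k := k * (ell (m - k) + ell (m + k)) - (Ell (m + k) - Ell (m - k)).
suff : g 0 <= g h by rewrite /g addr0 subr0 subrr mul0r subr0.
pose dl x := 2 * s ^+ 2 / (x * (x ^+ 2 + s ^+ 2)).
apply: (has_der_ge0_le (df := fun k => k * (dl (m - k) - dl (m + k)))) => //.
  move=> k /andP[k0 kh].
  have d1 : has_der (fun k => Ell (m + k)) k (ell (m + k)).
    by apply: has_der_shift; apply: has_der_Ell; lra.
  have d2 : has_der (fun k => Ell (m - k)) k (- ell (m - k)).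
    by apply: has_der_reflect; apply: has_der_Ell; lra.
  have d3 : has_der (fun k => ell (m + k)) k (- dl (m + k)).
    by apply: has_der_shift; apply: has_der_ell; lra.
  have d4 : has_der (fun k => ell (m - k)) k (- - dl (m - k)).
    by apply: has_der_reflect; apply: has_der_ell; lra.
  by rewrite /g; derE; ring.
move=> k /andP[k0 kh]; apply: mulr_ge0 => //; rewrite subr_ge0 /dl.
have mk1 : 0 < m + k by lra.
have mk2 : 0 < m - k by lra.
have p : 0 < s ^+ 2 by rewrite exprn_gt0.
have q1 : 0 < (m + k) ^+ 2 + s ^+ 2 by rewrite addr_gt0 ?exprn_gt0.
have q2 : 0 < (m - k) ^+ 2 + s ^+ 2 by rewrite addr_gt0 ?exprn_gt0.
rewrite ler_pM2l ?mulr_gt0// lef_pV2 ?posrE; [|exact: mulr_gt0..].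
apply: ler_pM; [exact: ltW|by rewrite addr_ge0 ?sqr_ge0|lra|].
by rewrite lerD2r lerXn2r ?nnegrE; lra.
Qed.

(** This is the midpoint rule on [[0, 1]], excluded from [Ell_midpoint] because [ell] is singular at
    0. If it failed, the rule on a slightly shorter interval, of length the average of [q] and 1,
    would already be violated. *)
Lemma ell_half_le : ell 2^-1 <= Ell 1.
Proof.
have [//|lt] := leP (ell 2^-1) (Ell 1).
have L1 : 0 <= Ell 1 by exact: Ell_ge0.
have l0 : 0 < ell 2^-1 by lra.
set q := Ell 1 / ell 2^-1.
have q1 : q < 1 by rewrite /q ltr_pdivrMr// mul1r.
have q0 : 0 <= q by rewrite divr_ge0// ltW.
have qE : q * ell 2^-1 = Ell 1 by rewrite /q mulfVK// gt_eqF.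
have := @Ell_midpoint 2^-1 ((q + 1) / 4).
have h1 : 0 <= (q + 1) / 4 by lra.
have h2 : (q + 1) / 4 < 2^-1 by lra.
move=> /(_ h1 h2).
have : Ell (2^-1 + (q + 1) / 4) <= Ell 1 by apply: Ell_le; lra.
have : 0 <= Ell (2^-1 - (q + 1) / 4) by apply: Ell_ge0; lra.
have -> : 2 * ((q + 1) / 4) * ell 2^-1 = (Ell 1 + ell 2^-1) / 2 by rewrite -qE; field.
lra.
Qed.

(** The points [1/2 + n] are the midpoints of [[n, n+1]], so the logarithm of the product is at most
    [Ell N]; the term [s^2 / N] left over there is at most 1. *)
Lemma prod_half_le (N : nat) : s ^+ 2 <= N%:R ->
  \prod_(n < N) (1 + s ^+ 2 / (2^-1 + n%:R) ^+ 2) <= expR (1 + pi * s).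
Proof.
move=> sN; have N0 : 0 < N%:R :> R by apply: lt_le_trans sN; rewrite exprn_gt0.
apply: (@le_trans _ _ (expR (Ell N%:R))); last first.
  rewrite ler_expR (le_trans (Ell_le_pi N0))// lerD2r.
  by rewrite ler_pdivrMr// mul1r.
elim: N {sN N0} => [|N IH]; first by rewrite big_ord0 Ell0 expR0.
rewrite big_ord_recr/=.
have p : 0 < 2^-1 + N%:R :> R by rewrite ltr_wpDr.
rewrite -[X in _ * X]lnK ?posrE ?ell_arg//.
have -> : Ell N.+1%:R = Ell N%:R + (Ell N.+1%:R - Ell N%:R) by rewrite addrC subrK.
rewrite expRD ler_pM ?prodr_ge0 ?expR_ge0//.
  by move=> i _; rewrite addr_ge0// divr_ge0 ?sqr_ge0.
rewrite ler_expR -/(ell _).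
case: N {IH} p => [|N] p; first by rewrite Ell0 subr0 addr0 ell_half_le.
have := @Ell_midpoint (2^-1 + N.+1%:R) 2^-1.
have h2 : 2^-1 < 2^-1 + N.+1%:R :> R by rewrite ltrDl ltr0n.
have h1 : 0 <= 2^-1 :> R by [].
move=> /(_ h1 h2).
rewrite divff// mul1r.
have -> : 2^-1 + N.+1%:R + 2^-1 = N.+2%:R :> R by rewrite -[N.+2%:R]natr1; field.
by have -> : 2^-1 + N.+1%:R - 2^-1 = N.+1%:R :> R by ring.
Qed.

(** The trapezoid rule covers [[1, N+1]] only. The missing unit interval costs [Ell 1 <= ell 1 + 2]:
    one half of [ell 1] is the endpoint term of the rule, the other half is the factor
    [sqrt (1 + s^2)]. *)
Lemma prod_one_ge (N : nat) :
  expR (2 * s * atan (N.+1%:R / s) - 2) <=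
  Num.sqrt (1 + s ^+ 2) * \prod_(n < N.+1) (1 + s ^+ 2 / (1 + n%:R) ^+ 2).
Proof.
have st : expR (Ell N.+1%:R - Ell 1 + ell 1 / 2 + ell N.+1%:R / 2) <=
    \prod_(n < N.+1) (1 + s ^+ 2 / (1 + n%:R) ^+ 2).
  elim: N => [|N IH].
    rewrite big_ord_recr big_ord0/= addr0 mul1r subrr add0r -splitr.
    by rewrite /ell lnK ?posrE ?ell_arg.
  rewrite big_ord_recr/=.
  have p : 0 < 1 + N.+1%:R :> R by rewrite ltr_wpDr.
  rewrite -[X in _ <= _ * X]lnK ?posrE ?ell_arg//.
  have := @Ell_trapezoid (2^-1 + N.+1%:R) 2^-1.
  have h2 : 2^-1 < 2^-1 + N.+1%:R :> R by rewrite ltrDl ltr0n.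
  have h1 : 0 <= 2^-1 :> R by [].
  move=> /(_ h1 h2).
  have -> : 2^-1 + N.+1%:R + 2^-1 = N.+2%:R :> R by rewrite -[N.+2%:R]natr1; field.
  have -> : 2^-1 + N.+1%:R - 2^-1 = N.+1%:R :> R by ring.
  move=> h; apply: le_trans (ler_pM _ _ IH (lexx _)); rewrite ?expR_ge0//.
  rewrite -expRD ler_expR -/(ell _) nat1r; lra.
have eE : expR (ell 1 / 2) = Num.sqrt (1 + s ^+ 2).
  rewrite sqrt_expR; last by rewrite addr_gt0 ?exprn_gt0.
  by rewrite /ell expr1n divr1 mulrC.
rewrite -eE; apply: (le_trans _ (ler_pM _ _ (lexx _) st)); rewrite ?expR_ge0//.
rewrite -expRD ler_expR.
have l1 := ell_ge0 N.+1%:R.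
have : 2 * s * atan (N.+1%:R / s) <= Ell N.+1%:R.
  by rewrite /Ell lerDr mulr_ge0 ?ell_ge0.
have : Ell 1 <= ell 1 + 2.
  rewrite /Ell mul1r lerD2l.
  have at_le x : 0 <= x -> atan x <= x.
    move=> x0; rewrite -subr_ge0.
    suff : 0 - atan 0 <= x - atan x by rewrite atan0 subr0.
    apply: (@has_der_ge0_le R (fun y => y - atan y) (fun y => 1 - (1 + y ^+ 2)^-1) 0 x) => //.
      by move=> y _; derE.
    move=> y _; rewrite subr_ge0 invf_le1 ?lerDl ?sqr_ge0// ltr_wpDr ?sqr_ge0//.
  have i0 : 0 <= 1 / s by rewrite divr_ge0 ?ltW.
  have := at_le _ i0 => h.
  apply: (@le_trans _ _ (2 * s * (1 / s))); last by rewrite mul1r mulfK ?gt_eqF.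
  by rewrite ler_pM2l ?mulr_gt0.
lra.
Qed.

End ProductBounds.

Section GammaBounds.
Context {R : realType}.

Lemma half_ge_arith (g gN G GN P E : R) : 0 <= g -> 0 < GN ^+ 2 -> P <= E ->
  gN * G ^+ 2 = g * GN ^+ 2 * P -> GN ^+ 2 <= 4 * gN -> 4^-1 * G ^+ 2 <= g * E.
Proof.
move=> g0 GN0 PE pr lo; apply: (@le_trans _ _ (g * P)); last by rewrite ler_wpM2l.
rewrite -(ler_pM2r GN0) [leRHS](_ : _ = gN * G ^+ 2); last by rewrite pr; ring.
have : G ^+ 2 * GN ^+ 2 <= G ^+ 2 * (4 * gN) by rewrite ler_wpM2l ?sqr_ge0.
lra.
Qed.

Lemma one_le_arith (g gN G GN P E Q : R) : 0 <= g -> 0 <= Q -> 0 < GN ^+ 2 -> E <= Q * P ->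
  gN * G ^+ 2 = g * GN ^+ 2 * P -> gN <= 2 * GN ^+ 2 -> g * E <= 2 * G ^+ 2 * Q.
Proof.
move=> g0 Q0 GN0 EP pr up; apply: (@le_trans _ _ (g * (Q * P))); first by rewrite ler_wpM2l.
rewrite mulrCA [leRHS]mulrC ler_wpM2l//.
rewrite -(ler_pM2r GN0) [leLHS](_ : _ = gN * G ^+ 2); last by rewrite pr; ring.
have : gN * G ^+ 2 <= 2 * GN ^+ 2 * G ^+ 2 by rewrite ler_wpM2r ?sqr_ge0.
lra.
Qed.

Lemma gnorm_half_ge : exists2 c : R, 0 < c &
  forall s, 0 <= s -> c * expR (- (pi * s)) <= gnorm 2^-1 s.
Proof.
have h2 : (2^-1 : R) <= 2^-1 by [].
set G := @gC R 2^-1 0; have G0 : 0 < G by exact: gC0_gt0.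
exists (4^-1 * G ^+ 2 * expR (- 1)) => [|s].
  by rewrite !mulr_gt0 ?expR_gt0 ?exprn_gt0.
(* The product bounds assume [s > 0], so [s = 0] is checked directly. *)
rewrite le_eqVlt => /predU1P[<-|s0].
  rewrite mulr0 oppr0 expR0 mulr1.
  apply: (@le_trans _ _ (G ^+ 2)); last by rewrite /gnorm lerDl sqr_ge0.
  have e1 : expR (- 1) <= 1 :> R by rewrite -expR0 ler_expR.
  have e0 := expR_ge0 (- 1 : R).
  have : 0 < G ^+ 2 by rewrite exprn_gt0.
  nra.
(* One [N] serves both purposes: [6 s^2 <= N] for the concentration, [s^2 <= N] for the product. *)
pose N := (Num.bound (6 * s ^+ 2)).+1.
have sN : 6 * s ^+ 2 <= N%:R.
  have h : 0 <= 6 * s ^+ 2 by rewrite mulr_ge0 ?sqr_ge0.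
  apply: le_trans (ltW (archi_boundP h)) _.
  by rewrite ler_nat.
have sN1 : s ^+ 2 <= N%:R by have := sqr_ge0 s; lra.
have hN : (2^-1 : R) <= 2^-1 + N%:R by rewrite lerDl.
have GN0 : (0 : R) < gC (2^-1 + N%:R) 0 ^+ 2 by exact: exprn_gt0 (gC0_gt0 hN).
have g0 : (0 : R) <= gnorm 2^-1 s by exact: addr_ge0 (sqr_ge0 _) (sqr_ge0 _).
have lo := gnorm_lower sN isT; rewrite [N%:R + _]addrC in lo.
have pr := gnorm_prod s N h2.
rewrite -[leLHS]mulrA -expRD (_ : - 1 - pi * s = - (1 + pi * s)); last by ring.
rewrite expRN ler_pdivrMr ?expR_gt0//.
exact: half_ge_arith g0 GN0 (prod_half_le s0 sN1) pr lo.
Qed.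

(** Here the trivial bound [gnorm_le] suffices at the far end, for every [n]. The finite products
    give only the rate [2 s atan ((n+1) / s)]; letting [n] tend to infinity yields [pi s]. *)
Lemma gnorm_one_le : exists2 C : R, 0 < C &
  forall s, 0 < s -> gnorm 1 s <= C * Num.sqrt (1 + s ^+ 2) * expR (- (pi * s)).
Proof.
have h2 : (2^-1 : R) <= 1 by lra.
set G := @gC R 1 0; have G0 : 0 < G by exact: gC0_gt0.
exists (2 * G ^+ 2 * expR 2) => [|s s0].
  by rewrite !mulr_gt0 ?expR_gt0 ?exprn_gt0.
have q0 : 0 < Num.sqrt (1 + s ^+ 2) by rewrite sqrtr_gt0 addr_gt0 ?exprn_gt0.
pose u n : R := 2 * G ^+ 2 * expR 2 * Num.sqrt (1 + s ^+ 2) * expR (- (2 * s * atan (n.+1%:R / s))).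
have hu n : gnorm 1 s <= u n.
  have hN : (2^-1 : R) <= 1 + n.+1%:R by rewrite (le_trans h2)// lerDl.
  have lo := prod_one_ge s0 n; have pr := gnorm_prod s n.+1 h2.
  have GN0 : (0 : R) < gC (1 + n.+1%:R) 0 ^+ 2 by exact: exprn_gt0 (gC0_gt0 hN).
  have g0 : (0 : R) <= gnorm 1 s by exact: addr_ge0 (sqr_ge0 _) (sqr_ge0 _).
  have up := gnorm_le s hN.
  rewrite /u expRN ler_pdivlMr ?expR_gt0// -[_ * expR 2 * _]mulrA.
  apply: one_le_arith g0 _ GN0 _ pr up.
    by apply: mulr_ge0; [exact: expR_ge0|exact: ltW].
  move: lo; rewrite expRD expRN ler_pdivrMr ?expR_gt0//.
  by rewrite [leRHS]mulrC mulrA.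
have cu : u n @[n --> \oo] --> 2 * G ^+ 2 * expR 2 * Num.sqrt (1 + s ^+ 2) * expR (- (2 * s * (pi / 2))).
  rewrite /u; apply: cvgMr.
  apply: continuous_cvg; first exact: continuous_expR.
  apply: cvgN; apply: cvgMr.
  apply: (@cvg_comp _ _ _ (fun n : nat => n.+1%:R / s) atan _ (pinfty_nbhs R)).
    apply/cvgryPge => A; have /cvgryPge/(_ (A * s)) := @hnat_oo R.
    by apply: filterS => n; rewrite ler_pdivlMr.
  exact: cvgy_atan.
have -> : pi * s = 2 * s * (pi / 2) by field.
apply: (cvgr_to_ge cu); exact: nearW hu.
Qed.

End GammaBounds.

(** * The Bessel equation *)

Section BesselIntegrals.
Context {R : realType}.
Local Notation mu := (@lebesgue_measure R).
Local Notation D := (`]0, +oo[%classic : set R).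
Implicit Types (x t r : R) (f g phi : R -> R) (n : nat).

(* With [t = e^w], [bch t = cosh w] and [bint n phi x] is the integral of
   [e^(- x cosh w) (cosh w)^n phi(e^w)] over the real line. *)
Definition bch t := (t + t^-1) / 2.
Definition bker x n t := expR (- (x * bch t)) * bch t ^+ n / t.
Definition bint n phi x := \int[mu]_(t in D) (bker x n t * phi t).

Lemma bch_gt0 t : 0 < t -> 0 < bch t.
Proof. by move=> t0; rewrite divr_gt0// addr_gt0 ?invr_gt0. Qed.

Lemma bchV t : bch t^-1 = bch t.
Proof. by rewrite /bch invrK addrC. Qed.

Lemma expR_ge_pow (y : R) n : 0 <= y -> y ^+ n <= n`!%:R * expR y.
Proof.
case: n => [|n] y0; first by rewrite mul1r expr0; have := expR_ge1Dx y; lra.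
have := expR_ge1Dxn n y0.
have f0 : 0 < n.+1`!%:R :> R by rewrite ltr0n fact_gt0.
move=> h; rewrite mulrC -ler_pdivrMr//; lra.
Qed.

Lemma bker_ge0 x n t : 0 < t -> 0 <= bker x n t.
Proof.
move=> t0; rewrite /bker !mulr_ge0 ?expR_ge0 ?exprn_ge0 ?invr_ge0 ?(ltW t0)//.
exact: ltW (bch_gt0 t0).
Qed.

(** Spending the exponential on one more power of [bch t] than the integrand contains leaves
    [1 / (t bch t)], that is [2 / (1 + t^2)]. The bound is uniform in [x >= y], as differentiation
    under the integral sign requires. *)
Lemma bker_le x y n t : 0 < y -> y <= x -> 0 < t ->
  bker x n t <= n.+1`!%:R / y ^+ n.+1 * 2 * (1 + t ^+ 2)^-1.
Proof.
move=> y0 yx t0; have b0 := bch_gt0 t0.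
have y1 : 0 < y ^+ n.+1 by rewrite exprn_gt0.
have E : (1 + t ^+ 2)^-1 * 2 = (bch t * t)^-1.
  by rewrite /bch; field; rewrite !gt_eqF// addr_gt0 ?mulr_gt0.
rewrite -mulrA [2 * _]mulrC E /bker.
rewrite invfM [leRHS]mulrA ler_pM2r ?invr_gt0// ler_pdivlMr// -[leLHS]mulrA -exprSr.
rewrite ler_pdivlMr// -[leLHS]mulrA -exprMn.
have h := @expR_ge_pow (bch t * y) n.+1 (ltW (mulr_gt0 b0 y0)).
rewrite -(ler_pM2l (expR_gt0 (x * bch t))) mulrA -expRD subrr expR0 mul1r.
apply: le_trans h _; rewrite mulrC ler_pM2r ?ltr0n ?fact_gt0//.
by rewrite ler_expR mulrC ler_pM2r.
Qed.

Lemma inv1sqr_integrable : mu.-integrable D (EFin \o (fun t => (1 + t ^+ 2)^-1)).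
Proof.
have p t : 0 < 1 + t ^+ 2 by rewrite ltr_wpDr ?sqr_ge0.
apply: (@ge0_has_der_integrable _ (@atan R) _ (pi)).
- by move=> t t0; derC; rewrite gt_eqF.
- by move=> t t0; rewrite invr_ge0 ltW.
- by move=> t t0; derE.
- move=> s t s0 st; have := atan_ltpi2 t; have := atan_gtNpi2 s; lra.
Qed.

Lemma bker_hcont x n : hcont (bker x n).
Proof. by move=> t t0; rewrite /bker /bch; derC; rewrite gt_eqF. Qed.

Lemma bker_integrable x n phi : 0 < x -> hcont phi ->
  (forall t, 0 < t -> `|phi t| <= 1) ->
  mu.-integrable D (EFin \o (fun t => bker x n t * phi t)).
Proof.
move=> x0 cf f1.
apply: (@hintegrable_le _ _ (fun t => n.+1`!%:R / x ^+ n.+1 * 2 * (1 + t ^+ 2)^-1)).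
- by apply: hcont_measurable => t t0; apply: continuousM; [exact: bker_hcont|exact: cf].
- move=> t t0; rewrite normrM ger0_norm ?bker_ge0//.
  rewrite -[leRHS]mulr1 ler_pM ?bker_ge0 ?f1//.
  exact: bker_le.
- rewrite (_ : _ \o _ = (fun t => (n.+1`!%:R / x ^+ n.+1 * 2)%:E * ((1 + t ^+ 2)^-1)%:E)%E)//.
  by apply: integrableZl => //; exact: inv1sqr_integrable.
Qed.

Lemma has_der_bint n phi x : 0 < x -> hcont phi ->
  (forall t, 0 < t -> `|phi t| <= 1) ->
  has_der (bint n phi) x (- bint n.+1 phi x).
Proof.
move=> x0 cf f1.
pose f y t := bker y n t * phi t.
have dfx y t : has_der (f ^~ t) y (- (bker y n.+1 t * phi t)).
  by rewrite /f /bker; derE; rewrite exprS; ring.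
pose G t := `|n.+2`!%:R / (x / 2) ^+ n.+2 * 2 * (1 + t ^+ 2)^-1|.
have Ix : `](x / 2), (2 * x)[%classic x by rewrite /= in_itv/=; apply/andP; split; lra.
have intf y : `](x / 2), (2 * x)[%classic y -> mu.-integrable D (EFin \o f y).
  rewrite /= in_itv/= => /andP[y0 _]; apply: bker_integrable => //; lra.
have df y t : `](x / 2), (2 * x)[%classic y -> D t -> derivable (f ^~ t) y 1.
  by move=> _ _; exact: has_der_derivable (dfx y t).
have G0 t : 0 <= G t by exact: normr_ge0.
have iG : mu.-integrable D (EFin \o G).
  suff /integrable_abse : mu.-integrable D
      (EFin \o (fun t => n.+2`!%:R / (x / 2) ^+ n.+2 * 2 * (1 + t ^+ 2)^-1)) by [].
  rewrite (_ : _ \o _ = (fun t => (n.+2`!%:R / (x / 2) ^+ n.+2 * 2)%:E * ((1 + t ^+ 2)^-1)%:E)%E)//.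
  by apply: integrableZl => //; exact: inv1sqr_integrable.
have Gub y t : `](x / 2), (2 * x)[%classic y -> D t -> `|partial1of2 f y t| <= G t.
  rewrite /= !in_itv/= andbT => /andP[y0 _] t0.
  rewrite /partial1of2 (has_der_derive1 (dfx y t)) normrN normrM ger0_norm ?bker_ge0//.
  apply: le_trans (ler_norm _); rewrite -[leRHS]mulr1 ler_pM ?bker_ge0 ?f1//.
  by apply: bker_le => //; lra.
have d1 := @derivable_under_integral R _ _ mu f D (measurable_itv _) x (x / 2) (2 * x) Ix intf df G G0 iG Gub.
have d2 := @differentiation_under_integral R _ _ mu f D (measurable_itv _) x (x / 2) (2 * x) Ix intf df G G0 iG Gub.
have E : derive1 (bint n phi) x = - bint n.+1 phi x.
  rewrite [LHS]d2 /bint -mulN1r -RintegralZl//; last exact: bker_integrable.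
  by apply: eq_Rintegral => t _; rewrite /partial1of2 (has_der_derive1 (dfx x t)) mulN1r.
by rewrite -E derive1E; apply: DeriveDef.
Qed.

End BesselIntegrals.

(** * The differential equation satisfied by the Bessel integrals *)

Section BesselODE.
Context {R : realType}.
Local Notation mu := (@lebesgue_measure R).
Local Notation D := (`]0, +oo[%classic : set R).
Implicit Types (x t r : R) (f g phi : R -> R) (n : nat).

Definition lcos r t := cos (r * ln t).
Definition lsin r t := sin (r * ln t).
(* [bP r = 2 K_(ir)] and [bTheta r x = x * (bP r)' x]. *)
Definition bP r x := bint 0 (lcos r) x.
Definition bTheta r x := - (x * bint 1 (lcos r) x).

Lemma lcos_hcont r : hcont (lcos r). Proof. by move=> t t0; rewrite /lcos; derC. Qed.
Lemma lsin_hcont r : hcont (lsin r). Proof. by move=> t t0; rewrite /lsin; derC. Qed.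
Lemma lcos_le1 r t : `|lcos r t| <= 1. Proof. exact: normr_cos_le1. Qed.
Lemma lsin_le1 r t : `|lsin r t| <= 1. Proof. exact: normr_sin_le1. Qed.
Lemma lcosV r t : 0 < t -> lcos r t^-1 = lcos r t.
Proof. by move=> t0; rewrite /lcos lnV ?posrE// mulrN cosN. Qed.
Lemma lsinV r t : 0 < t -> lsin r t^-1 = - lsin r t.
Proof. by move=> t0; rewrite /lsin lnV ?posrE// mulrN sinN. Qed.

Lemma hintegrableZ (c : R) f : mu.-integrable D (EFin \o f) ->
  mu.-integrable D (EFin \o (fun t => c * f t)).
Proof.
move=> i; rewrite (_ : _ \o _ = (fun t => c%:E * (f t)%:E)%E)//.
exact: integrableZl.
Qed.

Lemma hintegrableD f g : mu.-integrable D (EFin \o f) ->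
  mu.-integrable D (EFin \o g) -> mu.-integrable D (EFin \o (fun t => f t + g t)).
Proof.
move=> i j; rewrite (_ : _ \o _ = (fun t => (f t)%:E + (g t)%:E)%E)//.
exact: integrableD.
Qed.

Lemma eq_hintegrable f g : (forall t, 0 < t -> f t = g t) ->
  mu.-integrable D (EFin \o f) -> mu.-integrable D (EFin \o g).
Proof.
move=> E; apply: eq_integrable => // t; rewrite inE/= in_itv/= andbT => t0.
by rewrite E.
Qed.

Lemma eq_hintegral f g : (forall t, 0 < t -> f t = g t) ->
  \int[mu]_(t in D) f t = \int[mu]_(t in D) g t.
Proof.
by move=> E; apply: eq_Rintegral => t; rewrite inE/= in_itv/= andbT => t0; rewrite E.
Qed.

Lemma le_hintegral f g : mu.-integrable D (EFin \o f) ->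
  mu.-integrable D (EFin \o g) -> (forall t, 0 < t -> f t <= g t) ->
  \int[mu]_(t in D) f t <= \int[mu]_(t in D) g t.
Proof.
move=> i j fg; apply: le_Rintegral => // t; rewrite /= in_itv/= andbT.
exact: fg.
Qed.

Definition bexp x t := expR (- (x * bch t)).

Lemma bexp_le x t : 0 < x -> 0 < t ->
  bexp x t * (x * bch t + 1) * bch t <= 2 / x + 2 / x + x^-1.
Proof.
move=> x0 t0; have b0 := bch_gt0 t0; have xb := mulr_gt0 x0 b0.
have h2 := expR_ge_pow 2 (ltW xb); have h1 := expR_ge_pow 1 (ltW xb).
rewrite /bexp expRN -[leLHS]mulrA [leLHS]mulrC ler_pdivrMr ?expR_gt0//.
have e0 := expR_gt0 (x * bch t).
rewrite [leLHS](_ : _ = ((x * bch t) ^+ 2 + x * bch t) / x); last first.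
  by field; rewrite gt_eqF.
rewrite ler_pdivrMr// [leRHS](_ : _ = 5 * expR (x * bch t)); last first.
  by field; rewrite gt_eqF.
move: h1 h2; rewrite factS fact0 /= !factS fact0/= expr1; lra.
Qed.

Lemma bchV_le_sqrt t : 0 < t -> (bch t)^-1 <= 2 * Num.sqrt t.
Proof.
move=> t0; have v0 : 0 < Num.sqrt t by rewrite sqrtr_gt0.
rewrite -{1}(sqr_sqrtr (ltW t0)); set v := Num.sqrt t in v0 *.
rewrite invf_ple ?posrE ?bch_gt0 ?exprn_gt0 ?mulr_gt0// /bch.
rewrite invfM ler_pdivlMr// mulrC mulrA divff// mul1r.
have [v1|v1] := leP 1 v.
  apply: (@le_trans _ _ (v ^+ 2)); last by rewrite lerDl invr_ge0 sqr_ge0.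
  apply: (@le_trans _ _ 1); first by rewrite invf_le1.
  by rewrite exprn_ege1.
apply: (@le_trans _ _ (v ^+ 2)^-1); last by rewrite lerDr sqr_ge0.
by rewrite lef_pV2 ?posrE ?exprn_gt0// expr2 ler_piMl ?(ltW v0)// ltW.
Qed.

Lemma bchV_le_sqrtV t : 0 < t -> (bch t)^-1 <= 2 * (Num.sqrt t)^-1.
Proof.
move=> t0; rewrite -sqrtrV ?(ltW t0)// -bchV; apply: bchV_le_sqrt.
by rewrite invr_gt0.
Qed.

(** With [X = x cosh w], the quantity [e^(-X) (X + 1)] is at most a constant over [cosh w], and
    [1 / cosh w] is at most both [2 sqrt t] and [2 / sqrt t], as [has_der_hintegral0] demands. *)
Lemma has_der_bessel_hintegral0 (F f : R -> R) x (C : R) : 0 < x -> hcont f ->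
  mu.-integrable D (EFin \o f) ->
  (forall t, 0 < t -> has_der F t (f t)) -> 0 <= C ->
  (forall t, 0 < t -> `|F t| <= C * (bexp x t * (x * bch t + 1))) ->
  \int[mu]_(t in D) f t = 0.
Proof.
move=> x0 cf i dF C0 FC.
set K := 2 / x + 2 / x + x^-1.
have K0 : 0 <= K by rewrite !addr_ge0 ?divr_ge0 ?invr_ge0 ?(ltW x0).
have FK t : 0 < t -> `|F t| <= C * K * (bch t)^-1.
  move=> t0; apply: (le_trans (FC _ t0)); rewrite -mulrA ler_wpM2l//.
  by rewrite ler_pdivlMr ?bch_gt0// bexp_le.
apply: (has_der_hintegral0 (F := F) (C := C * K * 2)) => // t t0.
  apply: (le_trans (FK _ t0)); rewrite -[leRHS]mulrA ler_wpM2l ?mulr_ge0//.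
  exact: bchV_le_sqrt.
apply: (le_trans (FK _ t0)); rewrite -[leRHS]mulrA ler_wpM2l ?mulr_ge0//.
exact: bchV_le_sqrtV.
Qed.

Lemma bexp_ge0 x t : 0 <= bexp x t. Proof. exact: expR_ge0. Qed.

(** With [t = e^w], the integrand is the [w]-derivative of [e^(-x cosh w) (- x sinh w cos (r w) + r
    sin (r w))], which vanishes at both ends. *)
Lemma bint_ODE r x : 0 < x ->
  x ^+ 2 * bint 2 (lcos r) x - x * bint 1 (lcos r) x
    + (r ^+ 2 - x ^+ 2) * bint 0 (lcos r) x = 0.
Proof.
move=> x0.
have i n := @bker_integrable R x n (lcos r) x0 (@lcos_hcont r) (fun t _ => lcos_le1 r t).
pose sh t := (t - t^-1) / 2.
pose F t := bexp x t * (- x * sh t * lcos r t + r * lsin r t).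
pose f t := x ^+ 2 * (bker x 2 t * lcos r t) + (- x) * (bker x 1 t * lcos r t)
    + (r ^+ 2 - x ^+ 2) * (bker x 0 t * lcos r t).
have i12 : mu.-integrable D (EFin \o (fun t => x ^+ 2 * (bker x 2 t * lcos r t) + (- x) * (bker x 1 t * lcos r t))).
  by apply: hintegrableD; apply: hintegrableZ; exact: i.
have fi : mu.-integrable D (EFin \o f).
  by apply: hintegrableD => //; apply: hintegrableZ; exact: i.
have fE : \int[mu]_(t in D) f t = x ^+ 2 * bint 2 (lcos r) x - x * bint 1 (lcos r) x
    + (r ^+ 2 - x ^+ 2) * bint 0 (lcos r) x.
  rewrite /f RintegralD//; last by apply: hintegrableZ; exact: i.
  rewrite RintegralD//; [|by apply: hintegrableZ; exact: i..].
  by rewrite !RintegralZl//; [rewrite [- x * _]mulNr|exact: i..].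
rewrite -fE; apply: (has_der_bessel_hintegral0 x0 _ fi (F := F) (C := 1 + `|r|)).
- move=> t t0; rewrite /f.
  have c n : {for t, continuous (fun t => bker x n t * lcos r t)}.
    by apply: continuousM; [exact: bker_hcont|exact: lcos_hcont].
  by apply: continuousD; [apply: continuousD|]; (apply: continuousM; [exact: cst_continuous|exact: c]).
- move=> t t0; rewrite /F /f /bexp /bker /sh /bch /lcos /lsin; derE; rewrite ?gt_eqF//.
  set e := expR _; set co := cos _; set si := sin _.
  by field; rewrite gt_eqF.
- by rewrite addr_ge0.
- move=> t t0; have b0 := bch_gt0 t0; have xb := mulr_gt0 x0 b0.
  rewrite /F normrM ger0_norm ?bexp_ge0// [leRHS]mulrCA ler_wpM2l ?bexp_ge0//.
  apply: (le_trans (ler_normD _ _)).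
  have hs : `|sh t| <= bch t.
    have ti : 0 < t^-1 by rewrite invr_gt0.
    by rewrite /sh /bch ler_norml; apply/andP; split; lra.
  have h1 : `|- x * sh t * lcos r t| <= x * bch t.
    rewrite 2!normrM normrN (gtr0_norm x0) -[leRHS]mulr1.
    by apply: ler_pM => //; rewrite ?lcos_le1 ?mulr_ge0 ?(ltW x0)// ler_pM2l.
  have h2 : `|r * lsin r t| <= `|r|.
    by rewrite normrM ler_piMr// lsin_le1.
  have r0 := normr_ge0 r.
  have : 0 <= `|r| * (x * bch t) by rewrite mulr_ge0// ltW.
  lra.
Qed.

Lemma has_der_bP r x : 0 < x -> has_der (bP r) x (bTheta r x / x).
Proof.
move=> x0; have d := @has_der_bint R 0 _ x x0 (@lcos_hcont r) (fun t _ => lcos_le1 r t).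
rewrite /bP; apply: has_der_eq d _; rewrite /bTheta mulNr; congr (- _).
by rewrite mulrAC divff ?mul1r// gt_eqF.
Qed.

Lemma has_der_bTheta r x : 0 < x ->
  has_der (bTheta r) x ((x - r ^+ 2 / x) * bP r x).
Proof.
move=> x0; have d := @has_der_bint R 1 _ x x0 (@lcos_hcont r) (fun t _ => lcos_le1 r t).
have E := bint_ODE r x0.
rewrite /bTheta; derE; rewrite /bP.
rewrite (_ : x - r ^+ 2 / x = - (r ^+ 2 - x ^+ 2) / x); last by field; rewrite gt_eqF.
have E' : (r ^+ 2 - x ^+ 2) * bint 0 (lcos r) x =
    - (x ^+ 2 * bint 2 (lcos r) x - x * bint 1 (lcos r) x) by lra.
rewrite !mulNr mulrAC E'.
by field; rewrite gt_eqF.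
Qed.

(** The sine is odd under inversion of [t] while the kernel and [dt / t] are invariant; hence
    [K_(ir)] is real. *)
Lemma bint0_sin r x : 0 < x -> bint 0 (lsin r) x = 0.
Proof.
move=> x0.
have i := @bker_integrable R x 0 (lsin r) x0 (@lsin_hcont r) (fun t _ => lsin_le1 r t).
have E t : 0 < t -> bker x 0 t^-1 * lsin r t^-1 / t ^+ 2 = - 1 * (bker x 0 t * lsin r t).
  move=> t0; rewrite lsinV// /bker bchV invrK; field; rewrite gt_eqF//.
have i' := hintegrableZ (- 1) i.
have := @hintegral_inv R (fun t => bker x 0 t * lsin r t).
rewrite (eq_hintegral E) RintegralZl// -/(bint 0 (lsin r) x) => H.
suff : -1 * bint 0 (lsin r) x = bint 0 (lsin r) x by lra.
apply: H => //.
  by move=> t t0; apply: continuousM; [exact: bker_hcont|exact: lsin_hcont].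
by apply: eq_hintegrable i' => t t0; rewrite E.
Qed.

End BesselODE.

Section BesselBounds.
Context {R : realType}.
Local Notation mu := (@lebesgue_measure R).
Local Notation D := (`]0, +oo[%classic : set R).
Implicit Types (x t r : R) (f g phi : R -> R) (n : nat).

Lemma normr_hintegral_le f g : mu.-integrable D (EFin \o f) ->
  mu.-integrable D (EFin \o g) -> (forall t, 0 < t -> `|f t| <= g t) ->
  `|\int[mu]_(t in D) f t| <= \int[mu]_(t in D) g t.
Proof.
move=> i j fg; apply: le_trans (le_normr_Rintegral _ i) _ => //.
by apply: le_hintegral => //; exact: integrable_abse i.
Qed.

(** By [ln_sqr_le], [e^(-x cosh w)] is at most [e^(-x)] times a Gaussian in [k w] with
    [k^2 = x / 8]. The Gaussian is replaced by [1 / (1 + (k w)^2)], whose primitive is an arctangent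
    and whose mass is [pi / k]. *)
Lemma bint0_le : exists2 C : R, 0 < C & forall x phi, 0 < x -> hcont phi ->
  (forall t, 0 < t -> `|phi t| <= 1) ->
  `|bint 0 phi x| <= C * expR (- x) / Num.sqrt x.
Proof.
exists (pi * Num.sqrt 8) => [|x phi x0 cf f1]; first by rewrite mulr_gt0 ?pi_gt0 ?sqrtr_gt0.
pose k := Num.sqrt (x / 8).
have k0 : 0 < k by rewrite sqrtr_gt0 divr_gt0.
have kk : k ^+ 2 = x / 8 by rewrite sqr_sqrtr// divr_ge0 ?ltW.
pose g t := k / (t * (1 + (k * ln t) ^+ 2)).
have p t : 0 < 1 + (k * ln t) ^+ 2 by rewrite ltr_wpDr ?sqr_ge0.
have gd t : 0 < t -> has_der (fun t => atan (k * ln t)) t (g t).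
  by move=> t0; rewrite /g; derE => //; field; rewrite !gt_eqF// addrC.
have cg : hcont g.
  by move=> t t0; rewrite /g; derC => //; rewrite gt_eqF// mulr_gt0.
have g0 t : 0 < t -> 0 <= g t.
  by move=> t0; rewrite divr_ge0 ?(ltW k0)// ltW// mulr_gt0.
have gpi (s t : R) : 0 < s -> s <= t -> atan (k * ln t) - atan (k * ln s) <= pi.
  by move=> _ _; have := atan_ltpi2 (k * ln t); have := atan_gtNpi2 (k * ln s); lra.
have ig := ge0_has_der_integrable cg g0 gd gpi.
have Ig : \int[mu]_(t in D) g t <= pi.
  rewrite -lee_fin /Rintegral fineK; last exact: integrable_fin_num ig.
  exact: ge0_has_der_integral gpi.
have Eg t : 0 < t -> `|bker x 0 t * phi t| <= expR (- x) / k * g t.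
  move=> t0; rewrite normrM ger0_norm ?bker_ge0//.
  apply: (@le_trans _ _ (bker x 0 t)).
    by rewrite ler_piMr ?bker_ge0 ?f1.
  have -> : expR (- x) / k * g t = expR (- x) / (1 + (k * ln t) ^+ 2) / t.
    by rewrite /g; field; rewrite !gt_eqF.
  rewrite /bker expr0 mulr1 ler_pM2r ?invr_gt0//.
  rewrite ler_pdivlMr//.
  apply: (@le_trans _ _ (expR (- (x * bch t)) * expR ((k * ln t) ^+ 2))).
    by rewrite ler_pM2l ?expR_gt0// expR_ge1Dx.
  rewrite -expRD ler_expR exprMn kk.
  have l2 := ln_sqr_le t0.
  have E : (t - 1) ^+ 2 / t = 2 * bch t - 2 by rewrite /bch; field; rewrite gt_eqF.
  have : x / 8 * ln t ^+ 2 <= x / 8 * (4 * ((t - 1) ^+ 2 / t)).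
    by rewrite ler_pM2l// divr_gt0.
  rewrite E; lra.
apply: (@le_trans _ _ (expR (- x) / k * pi)).
  apply: le_trans (normr_hintegral_le _ (hintegrableZ (expR (- x) / k) ig) Eg) _.
    exact: bker_integrable.
  rewrite RintegralZl// ler_pM2l// divr_gt0 ?expR_gt0//.
rewrite /k sqrtrM ?(ltW x0)// sqrtrV// invfM invrK.
by rewrite le_eqVlt; apply/orP; left; apply/eqP; ring.
Qed.

(** The factor [x cosh w] is paid for with half of the exponential, hence the argument [x / 2] on
    the right. *)
Lemma bint1_le x phi : 0 < x -> hcont phi -> (forall t, 0 < t -> `|phi t| <= 1) ->
  `|x * bint 1 phi x| <= 2 * bint 0 (cst 1) (x / 2).
Proof.
move=> x0 cf f1; rewrite normrM gtr0_norm//.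
have x2 : 0 < x / 2 by rewrite divr_gt0.
have i1 : mu.-integrable D (EFin \o (fun t => bker (x / 2) 0 t * cst 1 t)).
  apply: bker_integrable => // [t _|t _]; first exact: cst_continuous.
  by rewrite normr1.
rewrite /bint -RintegralZl//.
rewrite -(@ler_pM2l _ x^-1) ?invr_gt0// mulrA mulVf ?gt_eqF// mul1r -RintegralZl//; last exact: hintegrableZ.
apply: normr_hintegral_le.
- exact: bker_integrable.
- by do 2! apply: hintegrableZ.
move=> t t0; rewrite normrM ger0_norm ?bker_ge0//.
apply: (@le_trans _ _ (bker x 1 t)).
  by rewrite ler_piMr ?bker_ge0 ?f1.
have b0 := bch_gt0 t0.
have h := @expR_ge_pow R (x / 2 * bch t) 1 (ltW (mulr_gt0 x2 b0)).
rewrite /bker; move: (bch t) b0 h => b b0 h.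
rewrite expr0 expr1 !mulr1 !mulrA ler_pM2r ?invr_gt0//.
rewrite -(ler_pM2l (expR_gt0 (x / 2 * b))).
rewrite [leRHS](_ : _ = x^-1 * 2 * (expR (x / 2 * b) * expR (- (x / 2 * b)))); last by ring.
rewrite [leLHS]mulrA -!expRD subrr expR0 mulr1 (_ : x / 2 * b - x * b = - (x / 2 * b)); last by field.
rewrite expRN [leLHS]mulrC ler_pdivrMr ?expR_gt0//.
move: h; rewrite factS fact0/= mul1n mul1r expr1 => h.
rewrite -(ler_pM2l x2); apply: (le_trans h).
by rewrite le_eqVlt; apply/orP; left; apply/eqP; field; rewrite gt_eqF.
Qed.

(** The measure is [dt], not [dt / t]. After scaling [t] by [x / 2] the kernel becomes
    [e^(- t - (x/2)^2 / t)], so that [x bU / 2] tends, up to a phase, to a part of [Gamma (1 + ir)]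
    as [x] tends to 0. *)
Definition bU phi x := \int[mu]_(t in D) (bexp x t * phi t).

Lemma bexp_hcont x : hcont (bexp x).
Proof. by move=> t t0; rewrite /bexp /bch; derC; rewrite gt_eqF. Qed.

Lemma bexp_integrable x phi : 0 < x -> hcont phi ->
  (forall t, 0 < t -> `|phi t| <= 1) ->
  mu.-integrable D (EFin \o (fun t => bexp x t * phi t)).
Proof.
move=> x0 cf f1.
apply: (@hintegrable_le _ _ (fun t => 2 * (bker x 1 t * cst 1 t))).
- by apply: hcont_measurable => t t0; apply: continuousM; [exact: bexp_hcont|exact: cf].
- move=> t t0; rewrite normrM ger0_norm ?bexp_ge0// mulr1.
  apply: (@le_trans _ _ (bexp x t)); first by rewrite ler_piMr ?bexp_ge0 ?f1.
  rewrite /bker expr1 -/(bexp x t) -mulrA mulrCA ler_peMr ?bexp_ge0//.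
  rewrite /bch (_ : 2 * _ = 1 + (t ^+ 2)^-1); last by field; rewrite gt_eqF.
  by rewrite lerDl invr_ge0 sqr_ge0.
- apply: hintegrableZ; apply: bker_integrable => // [t _|t _]; last by rewrite normr1.
  exact: cst_continuous.
Qed.

Lemma bexp_integrableV x phi : 0 < x -> hcont phi ->
  (forall t, 0 < t -> `|phi t| <= 1) ->
  mu.-integrable D (EFin \o (fun t => bexp x t * phi t / t ^+ 2)).
Proof.
move=> x0 cf f1.
have i1 := hintegrableZ 2 (bker_integrable 1 x0 cf f1).
have i2 := hintegrableZ (- 1) (bexp_integrable x0 cf f1).
apply: eq_hintegrable (hintegrableD i1 i2) => t t0.
by rewrite /bker expr1 -/(bexp x t) /bch; field; rewrite gt_eqF.
Qed.

Lemma bU_inv x phi (e : R) : 0 < x -> hcont phi ->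
  (forall t, 0 < t -> `|phi t| <= 1) ->
  (forall t, 0 < t -> phi t^-1 = e * phi t) ->
  e * \int[mu]_(t in D) (bexp x t * phi t / t ^+ 2) = bU phi x.
Proof.
move=> x0 cf f1 fe.
have E t : 0 < t -> bexp x t^-1 * phi t^-1 / t ^+ 2 = e * (bexp x t * phi t / t ^+ 2).
  by move=> t0; rewrite /bexp bchV fe//; ring.
have iV := bexp_integrableV x0 cf f1.
have := @hintegral_inv R (fun t => bexp x t * phi t).
rewrite (eq_hintegral E) RintegralZl//; apply.
- by move=> t t0; apply: continuousM; [exact: bexp_hcont|exact: cf].
- exact: bexp_integrable.
- by apply: eq_hintegrable (hintegrableZ e iV) => t t0; rewrite E.
Qed.

(** [cosh w] is the mean of [e^w] and [e^(-w)], which contribute equally because the cosine is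
    even. *)
Lemma bTheta_bU r x : 0 < x -> bTheta r x = - (x * bU (lcos r) x).
Proof.
move=> x0; rewrite /bTheta; congr (- (_ * _)).
have cf := @lcos_hcont R r; have f1 := fun t (_ : 0 < t) => lcos_le1 r t.
have i := bexp_integrable x0 cf f1; have iV := bexp_integrableV x0 cf f1.
have := @bU_inv x (lcos r) 1 x0 cf f1.
have fe t : 0 < t -> lcos r t^-1 = 1 * lcos r t by move=> t0; rewrite lcosV// mul1r.
move=> /(_ fe); rewrite mul1r => H.
have -> : bU (lcos r) x = 2^-1 * (bU (lcos r) x + bU (lcos r) x) by field.
rewrite -{2}H -RintegralD// -RintegralZl//; last exact: hintegrableD.
apply: eq_hintegral => t t0.
by rewrite /bker expr1 -/(bexp x t) /bch; field; rewrite gt_eqF.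
Qed.

(** Integrating the [w]-derivative of [e^(-x cosh w) sin (r w)] gives [x sinh w sin (r w)] in place
    of [r cos (r w)], and by oddness both halves of [sinh w] contribute equally. Thus [bTheta] and
    [r bP] come from the two parts of one complex integral. *)
Lemma bP_bU r x : 0 < x -> r * bP r x = x * bU (lsin r) x.
Proof.
move=> x0.
have cf := @lsin_hcont R r; have f1 := fun t (_ : 0 < t) => lsin_le1 r t.
have i := bexp_integrable x0 cf f1; have iV := bexp_integrableV x0 cf f1.
have i0 := bker_integrable 0 x0 (@lcos_hcont R r) (fun t _ => lcos_le1 r t).
have fe t : 0 < t -> lsin r t^-1 = - 1 * lsin r t.
  by move=> t0; rewrite lsinV// mulN1r.
have H := bU_inv x0 cf f1 fe.
pose f t := r * (bker x 0 t * lcos r t) + (- (x / 2) * (bexp x t * lsin r t)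
   + (x / 2) * (bexp x t * lsin r t / t ^+ 2)).
have fi2 : mu.-integrable D (EFin \o (fun t => - (x / 2) * (bexp x t * lsin r t)
   + (x / 2) * (bexp x t * lsin r t / t ^+ 2))).
  by apply: hintegrableD; exact: hintegrableZ.
have fi : mu.-integrable D (EFin \o f).
  by apply: hintegrableD => //; exact: hintegrableZ.
have fE : \int[mu]_(t in D) f t = r * bP r x + (- (x / 2) * bU (lsin r) x - (x / 2) * bU (lsin r) x).
  rewrite /f RintegralD//; last exact: hintegrableZ.
  rewrite RintegralD//; [|exact: hintegrableZ..].
  rewrite !RintegralZl// -H; congr (_ + (_ + _)); last by ring.
  by rewrite H.
have : \int[mu]_(t in D) f t = 0.
  apply: (has_der_bessel_hintegral0 x0 _ fi _ ler01 (F := fun t => bexp x t * lsin r t)).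
  - move=> t t0; rewrite /f /bker /lcos /lsin /bexp /bch.
    by derC; rewrite ?expf_neq0 ?gt_eqF.
  - move=> t t0; rewrite /f /bker /lcos /lsin /bexp /bch; derE; rewrite ?gt_eqF//.
    set e := expR _; set co := cos _; set si := sin _.
    by field; rewrite gt_eqF.
  - move=> t t0; rewrite mul1r normrM ger0_norm ?bexp_ge0// ler_wpM2l ?bexp_ge0//.
    rewrite (le_trans (lsin_le1 _ _))// lerDr mulr_ge0 ?(ltW x0)//.
    exact: ltW (bch_gt0 t0).
rewrite fE; lra.
Qed.

End BesselBounds.

(** * The Bessel function as [x] tends to 0 *)

Section BesselNearZero.
Context {R : realType}.
Local Notation mu := (@lebesgue_measure R).
Local Notation D := (`]0, +oo[%classic : set R).
Implicit Types (x t r q : R) (f g phi : R -> R).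

Definition eker q t := expR (- t - q / t).

Lemma eker_hcont q : hcont (eker q).
Proof. by move=> t t0; rewrite /eker; derC; rewrite gt_eqF. Qed.

Lemma gker1E t : gker 1 t = expR (- t).
Proof. by rewrite /gker subrr mul0r expR0 mulr1. Qed.

Lemma eker_le q t : 0 <= q -> 0 < t -> eker q t <= gker 1 t.
Proof.
by move=> q0 t0; rewrite gker1E ler_expR gerBl divr_ge0// ltW.
Qed.

Lemma eker_integrable q phi : 0 <= q -> hcont phi ->
  (forall t, 0 < t -> `|phi t| <= 1) ->
  mu.-integrable D (EFin \o (fun t => eker q t * phi t)).
Proof.
move=> q0 cf f1; have h2 : (2^-1 : R) <= 1 by lra.
apply: (@hintegrable_le _ _ (gker 1)).
- by apply: hcont_measurable => t t0; apply: continuousM; [exact: eker_hcont|exact: cf].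
- move=> t t0; rewrite normrM ger0_norm ?expR_ge0//.
  by rewrite -[leRHS]mulr1 ler_pM ?expR_ge0 ?eker_le ?f1.
- exact: gC0_integrable.
Qed.

(** With [y = c / sqrt t] one has [1 - e^(-y^2) <= y], so the error is at most [c] times the
    integral for [Gamma (1/2)]. *)
Lemma eker_close c phi : 0 < c -> hcont phi ->
  (forall t, 0 < t -> `|phi t| <= 1) ->
  `|\int[mu]_(t in D) (eker (c ^+ 2) t * phi t) -
    \int[mu]_(t in D) (gker 1 t * phi t)| <= c * gC 2^-1 0.
Proof.
move=> c0 cf f1; have h2 : (2^-1 : R) <= 1 by lra.
have i1 := eker_integrable (ltW (exprn_gt0 2 c0)) cf f1.
have i2 := gker_integrable h2 cf f1.
have i3 := @gC0_integrable R 2^-1 (lexx _).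
rewrite -RintegralB// gC0E -RintegralZl//.
apply: normr_hintegral_le.
- apply: eq_hintegrable (hintegrableD i1 (hintegrableZ (- 1) i2)) => t _.
  by rewrite mulN1r.
- exact: hintegrableZ.
move=> t t0; rewrite -mulrBl normrM -[leRHS]mulr1 ler_pM ?f1//.
rewrite distrC ger0_norm ?subr_ge0 ?eker_le ?(ltW (exprn_gt0 2 c0))//.
rewrite gker1E /eker /gker (_ : (2^-1 - 1) * ln t = - (2^-1 * ln t)); last by field.
rewrite [expR (- (2^-1 * _))]expRN -sqrt_expR// expRD.
have s0 : 0 < Num.sqrt t by rewrite sqrtr_gt0.
rewrite -[X in X - _]mulr1 -mulrBr mulrCA ler_pM2l ?expR_gt0//.
set y := c / Num.sqrt t.
have y0 : 0 < y by rewrite divr_gt0.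
rewrite (_ : c ^+ 2 / t = y ^+ 2); last first.
  by rewrite /y expr_div_n sqr_sqrtr// ltW.
have [y1|y1] := leP 1 y; first by have := expR_ge0 (- y ^+ 2); lra.
have := expR_ge1Dx (- y ^+ 2).
have : y ^+ 2 <= y by rewrite expr2 ler_piMl ?(ltW y0)// ltW.
lra.
Qed.

Lemma bU_scale r x (trig : R -> R) : 0 < x -> hcont (fun t => trig (r * ln t)) ->
  (forall y, `|trig y| <= 1) -> continuous trig ->
  x / 2 * bU (fun t => trig (r * ln t)) x =
  \int[mu]_(t in D) (eker ((x / 2) ^+ 2) t * trig (r * ln t - r * ln (x / 2))).
Proof.
move=> x0 cf f1 ct; have c0 : 0 < x / 2 by rewrite divr_gt0.
set c := x / 2 in c0 *.
have cf' : hcont (fun t => trig (r * ln t - r * ln c)).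
  move=> t t0; apply: (@continuous_comp _ _ _ (fun t => r * ln t - r * ln c) trig).
    by derC.
  exact: ct.
have f1' t : 0 < t -> `|trig (r * ln t - r * ln c)| <= 1 by [].
have i1 := eker_integrable (ltW (exprn_gt0 2 c0)) cf' f1'.
have i2 := bexp_integrable x0 cf (fun t _ => f1 _).
have E t : 0 < t -> eker (c ^+ 2) (c * t) * trig (r * ln (c * t) - r * ln c) * c =
   c * (bexp x t * trig (r * ln t)).
  move=> t0; rewrite lnM ?posrE// mulrDr (addrC (r * ln c)) addrK.
  rewrite /eker /bexp (_ : - (c * t) - _ = - (x * bch t)); first by ring.
  by rewrite /bch /c; field; rewrite !gt_eqF.
rewrite -RintegralZl// -(eq_hintegral E); apply: hintegral_scale => //.
  move=> t t0; apply: continuousM; [exact: eker_hcont|exact: cf'].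
by apply: eq_hintegrable (hintegrableZ c i2) => t t0; rewrite E.
Qed.

(** The left side equals [4 (A^2 + B^2)], since the phase [r ln (x / 2)] is a rotation. Replacing
    [A] and [B] by the parts of [Gamma (1 + ir)] through [a^2 <= 2 b^2 + 2 d^2] doubles the constant
    to 8. *)
Lemma bessel_near0 r x : 0 < x ->
  bTheta r x ^+ 2 + r ^+ 2 * bP r x ^+ 2 <=
  8 * gnorm 1 r + 4 * x ^+ 2 * gC 2^-1 0 ^+ 2.
Proof.
move=> x0; rewrite -exprMn bP_bU// bTheta_bU//.
set c := x / 2; have c0 : 0 < c by rewrite divr_gt0.
have q0 : 0 <= c ^+ 2 by rewrite sqr_ge0.
pose A := \int[mu]_(t in D) (eker (c ^+ 2) t * lcos r t).
pose B := \int[mu]_(t in D) (eker (c ^+ 2) t * lsin r t).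
have iA := eker_integrable q0 (@lcos_hcont R r) (fun t _ => lcos_le1 r t).
have iB := eker_integrable q0 (@lsin_hcont R r) (fun t _ => lsin_le1 r t).
pose rho := r * ln c.
have UC : c * bU (lcos r) x = cos rho * A + sin rho * B.
  rewrite /c (@bU_scale r x cos x0 (@lcos_hcont R r) (@normr_cos_le1 R) (@continuous_cos R)).
  rewrite -!RintegralZl// -RintegralD//; [|exact: hintegrableZ..].
  by apply: eq_hintegral => t t0; rewrite cosB /lcos /lsin; ring.
have US : c * bU (lsin r) x = cos rho * B - sin rho * A.
  rewrite /c (@bU_scale r x sin x0 (@lsin_hcont R r) (@normr_sin_le1 R) (@continuous_sin R)).
  rewrite -!RintegralZl// -RintegralB//; [|exact: hintegrableZ..].
  by apply: eq_hintegral => t t0; rewrite sinB /lcos /lsin; ring.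
have E : (- (x * bU (lcos r) x)) ^+ 2 + (x * bU (lsin r) x) ^+ 2 = 4 * (A ^+ 2 + B ^+ 2).
  have xE y : x * y = 2 * (c * y) by rewrite /c; field.
  rewrite sqrrN !xE UC US.
  transitivity (4 * ((cos rho ^+ 2 + sin rho ^+ 2) * (A ^+ 2 + B ^+ 2))); first by ring.
  by rewrite cos2Dsin2 mul1r.
rewrite E.
have hA := eker_close c0 (@lcos_hcont R r) (fun t _ => lcos_le1 r t).
have hB := eker_close c0 (@lsin_hcont R r) (fun t _ => lsin_le1 r t).
rewrite -/A -/(gC 1 r) in hA; rewrite -/B -/(gS 1 r) in hB.
have sq (a b d : R) : `|a - b| <= d -> a ^+ 2 <= 2 * b ^+ 2 + 2 * d ^+ 2.
  move=> h; have d0 : 0 <= d by apply: le_trans h.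
  have : `|a - b| ^+ 2 <= d ^+ 2 by rewrite lerXn2r ?nnegrE.
  rewrite real_normK ?num_real// => h2.
  by have := sqr_ge0 (a - 2 * b); lra.
have := sq _ _ _ hA; have := sq _ _ _ hB.
have -> : 4 * x ^+ 2 = 16 * c ^+ 2 by rewrite /c; field.
rewrite /gnorm; lra.
Qed.

End BesselNearZero.

(** * Uniform bounds for the Bessel function *)

Section TurningPoint.
Context {R : realType}.
Variables (m B : R) (P Theta : R -> R).
Local Notation r := (m ^+ 3).
Hypothesis m2 : 2 <= m.
Hypothesis B0 : 0 <= B.
Hypothesis dP : forall x, 0 < x -> has_der P x (Theta x / x).
Hypothesis dTheta : forall x, 0 < x -> has_der Theta x ((x - r ^+ 2 / x) * P x).
Hypothesis near0 : exists2 x1, 0 < x1 &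
  forall x, 0 < x -> x <= x1 -> Theta x ^+ 2 + r ^+ 2 * P x ^+ 2 <= B * r.
Hypothesis decay : forall e, 0 < e ->
  exists X, forall x, X <= x -> `|Theta x| <= e /\ `|x * P x| <= e.

Let m0 : 0 < m. Proof. by move: m2; lra. Qed.
Let r0 : 0 < r. Proof. by rewrite exprn_gt0. Qed.

(* For a solution of [(x d/dx)^2 P = (x^2 - r^2) P] and [Theta = x P'], [tp_W] is
   the WKB energy [tp_G] with a lower-order correction, which makes it monotone as
   long as [tp_h <= 1], i.e. up to [tp_xs], at distance about [r^(1/3)] from the
   turning point [x = r]; [tp_F] is monotone on the whole half-line. *)
Definition tp_q x := Num.sqrt (r ^+ 2 - x ^+ 2).
Definition tp_h x := x ^+ 2 / tp_q x ^+ 3.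
Definition tp_G x := Theta x ^+ 2 / tp_q x + tp_q x * P x ^+ 2.
Definition tp_W x := (tp_G x - tp_h x * (P x * Theta x)) * expR (- tp_h x).
Definition tp_xs := Num.sqrt (m ^+ 6 - m ^+ 4).
Definition tp_F x := Theta x ^+ 2 + (r ^+ 2 - x ^+ 2) * P x ^+ 2.
Let q := tp_q.
Let h := tp_h.
Let G := tp_G.
Let W := tp_W.
Let xs := tp_xs.
Let F := tp_F.
Let K := 6 * expR (1 : R).

Let xs_sqr : xs ^+ 2 = m ^+ 6 - m ^+ 4.
Proof.
rewrite /xs /tp_xs sqr_sqrtr//.
rewrite (_ : _ - _ = m ^+ 4 * (m ^+ 2 - 1)); last by ring.
rewrite mulr_ge0 ?exprn_ge0 ?(ltW m0)// subr_ge0 expr_ge1 ?(ltW m0)//.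
by move: m2; lra.
Qed.

Let m_sqr4 : 4 <= m ^+ 2.
Proof. by rewrite (_ : 4 = 2 ^+ 2); [rewrite lerXn2r ?nnegrE ?(ltW m0)|ring]. Qed.

Let xs0 : 0 < xs.
Proof.
rewrite /xs /tp_xs sqrtr_gt0 (_ : _ - _ = m ^+ 4 * (m ^+ 2 - 1)); last by ring.
by rewrite mulr_gt0 ?exprn_gt0//; move: m_sqr4; lra.
Qed.

Let xs_ge : r / 2 <= xs.
Proof.
rewrite -(@ler_pXn2r _ 2) ?nnegrE ?divr_ge0 ?(ltW r0) ?(ltW xs0)// xs_sqr.
rewrite (_ : (r / 2) ^+ 2 = m ^+ 4 * (m ^+ 2 / 4)); last by field.
rewrite (_ : m ^+ 6 - _ = m ^+ 4 * (m ^+ 2 - 1)); last by ring.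
by rewrite ler_pM2l ?exprn_gt0//; move: m_sqr4; lra.
Qed.

Let xs_lt : xs < r.
Proof.
rewrite -(@ltr_pXn2r _ 2) ?nnegrE ?(ltW r0) ?(ltW xs0)// xs_sqr.
have : 0 < m ^+ 4 by rewrite exprn_gt0.
rewrite -exprM; lra.
Qed.

Let q_sqr x : 0 < x -> x <= r -> q x ^+ 2 = r ^+ 2 - x ^+ 2.
Proof.
move=> x0 xr; rewrite /q /tp_q sqr_sqrtr// subr_ge0.
by rewrite lerXn2r ?nnegrE ?(ltW x0) ?(ltW r0).
Qed.

Let q_ge x : 0 < x -> x <= xs -> m ^+ 2 <= q x.
Proof.
move=> x0 xx; rewrite -(@ler_pXn2r _ 2) ?nnegrE ?sqr_ge0 ?sqrtr_ge0//.
rewrite q_sqr ?(le_trans xx (ltW xs_lt))// -!exprM/=.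
have : x ^+ 2 <= xs ^+ 2 by rewrite lerXn2r ?nnegrE ?(ltW x0) ?(ltW xs0).
by rewrite xs_sqr; lra.
Qed.

Let q_gt0 x : 0 < x -> x <= xs -> 0 < q x.
Proof. by move=> x0 xx; apply: lt_le_trans (q_ge x0 xx); rewrite exprn_gt0. Qed.

Let h_ge0 x : 0 <= h x.
Proof. by rewrite divr_ge0 ?sqr_ge0 ?exprn_ge0 ?sqrtr_ge0. Qed.

(** The point [xs] is chosen with [q xs = m^2 = r^(2/3)]; then [q^3 >= r^2 >= x^2] to its left. *)
Let h_le1 x : 0 < x -> x <= xs -> h x <= 1.
Proof.
move=> x0 xx; rewrite /h /tp_h ler_pdivrMr ?exprn_gt0 ?q_gt0// mul1r.
apply: (@le_trans _ _ ((m ^+ 2) ^+ 3)); last first.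
  by rewrite lerXn2r ?nnegrE ?sqr_ge0 ?sqrtr_ge0 ?q_ge.
rewrite -exprM mulnC exprM lerXn2r ?nnegrE ?(ltW x0) ?(ltW r0)//.
exact: le_trans xx (ltW xs_lt).
Qed.

Let G_ge x : 0 < x -> x <= xs -> 2 * `|P x * Theta x| <= G x.
Proof.
move=> x0 xx; have q0 := q_gt0 x0 xx; rewrite /G /tp_G -/(q x).
have -> : Theta x ^+ 2 / q x + q x * P x ^+ 2 = (Theta x ^+ 2 + (q x * P x) ^+ 2) / q x.
  by field; rewrite gt_eqF.
rewrite ler_pdivlMr// -[X in _ * X](gtr0_norm q0) -mulrA -normrM.
have h1 := sqr_ge0 (Theta x + q x * P x).
have h2 := sqr_ge0 (Theta x - q x * P x).
have : `|P x * Theta x * q x| <= 2^-1 * (Theta x ^+ 2 + (q x * P x) ^+ 2).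
  by rewrite ler_norml; apply/andP; split; lra.
lra.
Qed.

Let dh x := (2 * x * q x ^+ 2 + 3 * x ^+ 3) / q x ^+ 5.

(** The equation gives [G' = h (P Theta)'], so [G - h P Theta] has derivative [- h' P Theta], free
    of [P^2] and [Theta^2]. As [2 |P Theta| <= G] and [h' >= 0], the integrating factor [e^(-h)]
    absorbs this remainder. *)
Let has_der_W x : 0 < x -> x <= xs ->
  has_der W x (- dh x * expR (- h x) * (P x * Theta x + (G x - h x * (P x * Theta x)))).
Proof.
move=> x0 xx; have q0 := q_gt0 x0 xx; have := dP x0; have := dTheta x0.
have p0 : 0 < r ^+ 2 - x ^+ 2.
  by rewrite -q_sqr ?(le_trans xx (ltW xs_lt))// exprn_gt0.
move=> d1 d2.
rewrite /W /tp_W /G /tp_G /h /tp_h.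
have d3 : has_der tp_q x (- x / q x).
  by rewrite /tp_q; derE => //; rewrite -/(tp_q x) -/(q x); field; rewrite gt_eqF.
derE; rewrite -/(q x) ?expf_neq0 ?gt_eqF//.
rewrite /dh; set e := expR _.
rewrite (_ : x - r ^+ 2 / x = - q x ^+ 2 / x); last first.
  by rewrite q_sqr ?(le_trans xx (ltW xs_lt))//; field; rewrite gt_eqF.
rewrite /=; field; rewrite !gt_eqF//.
Qed.

Let W_le x y : 0 < x -> x <= y -> y <= xs -> W y <= W x.
Proof.
move=> x0 xy yx.
apply: (has_der_le0_le (df := fun x => - dh x * expR (- h x) * (P x * Theta x + (G x - h x * (P x * Theta x))))) => // z /andP[xz zy].
  by apply: has_der_W; [exact: lt_le_trans xz|exact: le_trans yx].
have z0 : 0 < z by exact: lt_le_trans xz.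
have zx : z <= xs by exact: le_trans yx.
have q0 := q_gt0 z0 zx.
rewrite !mulNr oppr_le0; apply: mulr_ge0; first apply: mulr_ge0; rewrite ?expR_ge0//.
  by rewrite /dh divr_ge0 ?exprn_ge0 ?(ltW q0)// addr_ge0 ?mulr_ge0 ?exprn_ge0 ?(ltW z0) ?(ltW q0).
have h1 := h_le1 z0 zx; have h0 := h_ge0 z; have g := G_ge z0 zx.
have a1 := ler_norm (- (P z * Theta z)); rewrite normrN in a1.
have a2 : h z * (P z * Theta z) <= `|P z * Theta z|.
  apply: (le_trans (ler_norm _)); rewrite normrM (ger0_norm h0).
  by rewrite ler_piMl.
lra.
Qed.

(** [W] is compared at [x] and at a point [z] near 0. There [r / 2 <= q z <= r], so [G z <= 2 B]. As
    [h <= 1], the correction keeps between 1/2 and 3/2 of [G], and [e^(-h)] costs at most [e]; hence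
    [K = 6 e]. *)
Let G_bound x : 0 < x -> x <= xs -> G x <= K * B.
Proof.
move=> x0 xx; have [x1 x10 hx1] := near0.
pose z := Num.min x (Num.min x1 (r / 2)).
have z0 : 0 < z by rewrite !lt_min x0 x10 divr_gt0.
have zx : z <= x by rewrite ge_min lexx.
have zx1 : z <= x1 by rewrite !ge_min lexx orbT.
have zr : z <= r / 2 by rewrite !ge_min lexx !orbT.
have zxs : z <= xs by exact: le_trans zx xx.
have w := W_le z0 zx xx.
have nb := hx1 z z0 zx1.
have qz0 := q_gt0 z0 zxs.
have qz : r / 2 <= q z.
  rewrite -(@ler_pXn2r _ 2) ?nnegrE ?(ltW qz0) ?divr_ge0 ?(ltW r0)//.
  rewrite q_sqr ?(le_trans zxs (ltW xs_lt))//.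
  have : z ^+ 2 <= (r / 2) ^+ 2 by rewrite lerXn2r ?nnegrE ?(ltW z0) ?divr_ge0 ?(ltW r0).
  have := sqr_ge0 r; lra.
have qzr : q z <= r.
  rewrite -(@ler_pXn2r _ 2) ?nnegrE ?(ltW qz0) ?(ltW r0)//.
  by rewrite q_sqr ?(le_trans zxs (ltW xs_lt))// gerBl sqr_ge0.
have Gz : G z <= 2 * B.
  apply: (@le_trans _ _ (2 / r * (Theta z ^+ 2 + r ^+ 2 * P z ^+ 2))); last first.
    apply: (@le_trans _ _ (2 / r * (B * r))).
      by rewrite ler_pM2l// divr_gt0.
    by rewrite le_eqVlt; apply/orP; left; apply/eqP; field; rewrite gt_eqF.
  rewrite /G /tp_G -/(q z) mulrDr; apply: lerD.
    rewrite [leRHS]mulrC ler_wpM2l ?sqr_ge0//.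
    by rewrite (_ : 2 / r = (r / 2)^-1) ?lef_pV2 ?posrE ?divr_gt0// invf_div.
  rewrite (_ : 2 / r * _ = (2 * r) * P z ^+ 2); last by field; rewrite gt_eqF.
  by rewrite ler_wpM2r ?sqr_ge0//; move: qzr r0; lra.
have Wz : W z <= 3 / 2 * G z.
  have g := G_ge z0 zxs; have h1 := h_le1 z0 zxs; have h0 := h_ge0 z.
  have a2 : - (h z * (P z * Theta z)) <= `|P z * Theta z|.
    apply: (le_trans (ler_norm _)); rewrite normrN normrM (ger0_norm h0).
    by rewrite ler_piMl.
  have n0 := normr_ge0 (P z * Theta z).
  have e1 : expR (- h z) <= 1 by rewrite -[leRHS](@expR0 R) ler_expR oppr_le0.
  apply: (@le_trans _ _ (G z - h z * (P z * Theta z))); last by lra.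
  rewrite /W /tp_W -[leRHS]mulr1 ler_wpM2l//.
  have a3 : h z * (P z * Theta z) <= `|P z * Theta z|.
    apply: (le_trans (ler_norm _)); rewrite normrM (ger0_norm h0).
    by rewrite ler_piMl.
  by rewrite -/(G z) -/(h z); lra.
have Wx : G x / 2 / expR 1 <= W x.
  have g := G_ge x0 xx; have h1 := h_le1 x0 xx; have h0 := h_ge0 x.
  have a2 : h x * (P x * Theta x) <= `|P x * Theta x|.
    apply: (le_trans (ler_norm _)); rewrite normrM (ger0_norm h0).
    by rewrite ler_piMl.
  have n0 := normr_ge0 (P x * Theta x).
  rewrite /W /tp_W -/(G x) -/(h x) -expRN ler_pM ?expR_ge0 ?ler_expR ?lerN2//; lra.
have e0 := expR_gt0 (1 : R).
have : G x / 2 / expR 1 <= 3 * B by lra.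
rewrite ler_pdivrMr// /K; lra.
Qed.

Let F_le x y : 0 < x -> x <= y -> F y <= F x.
Proof.
move=> x0 xy.
apply: (has_der_le0_le (df := fun x => - (2 * x * P x ^+ 2))) => // z /andP[xz zy].
  have z0 : 0 < z by exact: lt_le_trans xz.
  have := dP z0; have := dTheta z0 => d1 d2; rewrite /F /tp_F; derE.
  by rewrite /=; field; rewrite gt_eqF.
have z0 : 0 < z by exact: lt_le_trans xz.
by rewrite oppr_le0 mulr_ge0 ?sqr_ge0// mulr_ge0 ?(ltW z0).
Qed.

Let KB0 : 0 <= K * B.
Proof. by rewrite mulr_ge0// mulr_ge0// expR_ge0. Qed.

Let left_bounds x : 0 < x -> x <= xs ->
  q x * P x ^+ 2 <= K * B /\ Theta x ^+ 2 <= K * B * q x.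
Proof.
move=> x0 xx; have q0 := q_gt0 x0 xx; have := G_bound x0 xx.
rewrite /G /tp_G -/(q x) => g.
have h1 : 0 <= q x * P x ^+ 2 by rewrite mulr_ge0 ?sqr_ge0 ?(ltW q0).
have h2 : 0 <= Theta x ^+ 2 / q x by rewrite divr_ge0 ?sqr_ge0 ?(ltW q0).
split; first by lra.
by rewrite -ler_pdivrMr//; lra.
Qed.

Let q_xs : q xs = m ^+ 2.
Proof.
rewrite /q /tp_q xs_sqr -exprM (_ : _ - _ = (m ^+ 2) ^+ 2); last by ring.
by rewrite sqrtr_sqr ger0_norm ?sqr_ge0.
Qed.

Let F_xs : F xs <= 2 * (K * B) * m ^+ 2.
Proof.
have [h1 h2] := left_bounds xs0 (lexx _); rewrite q_xs in h1 h2.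
rewrite /F /tp_F -q_sqr ?(ltW xs_lt)// q_xs.
have : m ^+ 2 * (m ^+ 2 * P xs ^+ 2) <= m ^+ 2 * (K * B) by rewrite ler_pM2l ?exprn_gt0.
lra.
Qed.

(** The gap [r - xs] is at most [m], because [(r - xs) (r + xs) = m^4]. Monotonicity of [F] bounds
    [Theta] on it, and by the mean value theorem [P] moves by at most [sqrt (8 K B) / m]; then
    [18 = 2 + 2 * 8]. *)
Let mid_bounds x : xs <= x -> x <= r ->
  m ^+ 2 * P x ^+ 2 <= 18 * (K * B) /\ Theta x ^+ 2 <= 2 * (K * B) * m ^+ 2.
Proof.
move=> xx xr.
have T c : xs <= c -> c <= r -> Theta c ^+ 2 <= 2 * (K * B) * m ^+ 2.
  move=> xc cr; apply: le_trans F_xs; apply: le_trans (F_le xs0 xc).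
  have c0 : 0 < c by exact: lt_le_trans xc.
  by rewrite /F /tp_F lerDl mulr_ge0 ?sqr_ge0// -q_sqr// sqr_ge0.
split; last exact: T.
have [h1 _] := left_bounds xs0 (lexx _); rewrite q_xs in h1.
have [|c /andP[xc cx] E] := @has_der_MVT _ P (fun x => Theta x / x) _ _ xx.
  by move=> z /andP[xz _]; apply: dP; exact: lt_le_trans xz.
have c0 : 0 < c by exact: lt_le_trans xc.
have Tc := T c xc (le_trans cx xr).
have gap : x - xs <= m.
  have : (r - xs) * (r + xs) = m ^+ 4.
    by rewrite -subr_sqr xs_sqr; ring.
  have : (r - xs) * r <= (r - xs) * (r + xs).
    by rewrite ler_pM2l ?subr_gt0// lerDl ltW.
  move=> i1 i2; rewrite i2 in i1.
  have : (r - xs) * r <= m * r by rewrite (le_trans i1)// -exprS.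
  by rewrite ler_pM2r//; lra.
have D : m ^+ 2 * (P x - P xs) ^+ 2 <= 8 * (K * B).
  rewrite E exprMn expr_div_n.
  have c2 : r ^+ 2 / 4 <= c ^+ 2.
    rewrite (_ : r ^+ 2 / 4 = (r / 2) ^+ 2); last by field.
    by rewrite lerXn2r ?nnegrE ?divr_ge0 ?(ltW r0) ?(ltW c0)// (le_trans xs_ge).
  have g2 : (x - xs) ^+ 2 <= m ^+ 2.
    by rewrite lerXn2r ?nnegrE ?(ltW m0)// subr_ge0.
  have t2 : Theta c ^+ 2 / c ^+ 2 <= 2 * (K * B) * m ^+ 2 / (r ^+ 2 / 4).
    apply: ler_pM => //; rewrite ?sqr_ge0 ?invr_ge0 ?sqr_ge0//.
    by rewrite lef_pV2 ?posrE ?divr_gt0 ?exprn_gt0.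
  apply: (@le_trans _ _ (m ^+ 2 * (2 * (K * B) * m ^+ 2 / (r ^+ 2 / 4) * m ^+ 2))).
    rewrite ler_wpM2l ?sqr_ge0// ler_pM ?sqr_ge0//.
    by rewrite divr_ge0 ?sqr_ge0.
  by rewrite le_eqVlt; apply/orP; left; apply/eqP; field; rewrite gt_eqF.
have : m ^+ 2 * P x ^+ 2 <= m ^+ 2 * (2 * P xs ^+ 2 + 2 * (P x - P xs) ^+ 2).
  rewrite ler_pM2l ?exprn_gt0//; have := sqr_ge0 (P x - 2 * P xs); lra.
lra.
Qed.

(** The derivative of [P Theta] is a sum of nonnegative terms once [x >= r]. Since [P Theta]
    vanishes at infinity, it is nonpositive from [r] on, and so [P^2] decreases there. *)
Let PT_le x y : r <= x -> x <= y -> P x * Theta x <= P y * Theta y.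
Proof.
move=> rx xy.
apply: (has_der_ge0_le (f := fun x => P x * Theta x)
   (df := fun x => (Theta x ^+ 2 + (x ^+ 2 - r ^+ 2) * P x ^+ 2) / x)) => // z /andP[xz zy].
  have z0 : 0 < z by apply: lt_le_trans xz; exact: lt_le_trans rx.
  have := dP z0; have := dTheta z0 => d1 d2; derE.
  by field; rewrite gt_eqF.
have rz : r <= z by exact: le_trans xz.
have z0 : 0 < z by apply: lt_le_trans rz.
apply: divr_ge0; last exact: ltW.
apply: addr_ge0; rewrite ?sqr_ge0// mulr_ge0 ?sqr_ge0// subr_ge0.
by rewrite lerXn2r ?nnegrE ?(ltW z0) ?(ltW r0).
Qed.

Let r1 : 1 <= r. Proof. by rewrite expr_ge1 ?(ltW m0)//; move: m2; lra. Qed.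

Let far x e : 0 < e -> exists2 y, Num.max r x <= y & `|Theta y| <= e /\ `|y * P y| <= e.
Proof.
move=> e0; have [X HX] := decay e0; exists (Num.max X (Num.max r x)).
  by rewrite le_max lexx orbT.
by apply: HX; rewrite le_max lexx.
Qed.

Let PT_le0 x : r <= x -> P x * Theta x <= 0.
Proof.
move=> rx; apply/ler_addgt0Pr => e e0; rewrite add0r.
have e1 : 0 < Num.min e 1 by rewrite lt_min e0 ltr01.
have [y + [ty py]] := far x e1; rewrite ge_max => /andP[ry xy].
apply: (le_trans (PT_le rx xy)); apply: (le_trans (ler_norm _)).
have y1 : 1 <= y by exact: le_trans r1 ry.
have py1 : `|P y| <= 1.
  have : `|P y| <= `|y * P y| by rewrite normrM ger0_norm ?ler_peMl//; lra.
  move: py; rewrite le_min => /andP[_ ?]; lra.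
rewrite normrM -[leRHS]mul1r; apply: ler_pM => //.
by move: ty; rewrite le_min => /andP[].
Qed.

(** [F] decreases and is at least [- (y P y)^2] at [y], which tends to 0. *)
Let F_ge0 x : r <= x -> 0 <= F x.
Proof.
move=> rx; rewrite -oppr_le0; apply/ler_addgt0Pr => e e0; rewrite add0r.
have e1 : 0 < Num.min e 1 by rewrite lt_min e0 ltr01.
have [y + [ty py]] := far x e1; rewrite ge_max => /andP[ry xy].
have x0 : 0 < x by exact: lt_le_trans rx.
have := F_le x0 xy.
have py2 : (y * P y) ^+ 2 <= e.
  rewrite -real_normK ?num_real// expr2 -[leRHS]mulr1.
  by move: py; rewrite le_min => /andP[? ?]; apply: ler_pM.
have : - (y * P y) ^+ 2 <= F y.
  rewrite /F /tp_F exprMn; have := sqr_ge0 (Theta y); have := mulr_ge0 (sqr_ge0 r) (sqr_ge0 (P y)).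
  lra.
lra.
Qed.

Let P_sqr_le x : r <= x -> P x ^+ 2 <= P r ^+ 2.
Proof.
move=> rx.
apply: (has_der_le0_le (f := fun x => P x ^+ 2) (df := fun x => 2 * (P x * Theta x) / x)) => // z /andP[rz zx].
  have z0 : 0 < z by exact: lt_le_trans rz.
  by have := dP z0 => d1; derE; rewrite /=; ring.
have z0 : 0 < z by exact: lt_le_trans rz.
rewrite mulr_le0_ge0 ?invr_ge0 ?(ltW z0)//.
by rewrite pmulr_rle0// PT_le0.
Qed.

Lemma turning_point_bounds x : 0 < x ->
  m ^+ 2 * P x ^+ 2 <= 108 * expR 1 * B /\
  `|x ^+ 2 - r ^+ 2| * P x ^+ 4 <= (108 * expR 1 * B) ^+ 2.
Proof.
(* The constant is the 18 of [mid_bounds] times [K = 6 e]. *)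
move=> x0; rewrite (_ : 108 * expR 1 * B = 18 * (K * B)); last by rewrite /K; ring.
have pw : P x ^+ 4 = (P x ^+ 2) ^+ 2 by rewrite -exprM.
have KB18 : 0 <= 18 * (K * B) by move: KB0; lra.
have [xx|xx] := leP x xs.
  have [h1 _] := left_bounds x0 xx; have qg := q_ge x0 xx; have q0 := q_gt0 x0 xx.
  split.
    apply: (@le_trans _ _ (q x * P x ^+ 2)); first by rewrite ler_wpM2r ?sqr_ge0.
    by move: KB0; lra.
  rewrite distrC -q_sqr ?(le_trans xx (ltW xs_lt))// ger0_norm ?sqr_ge0// pw -exprMn.
  have qP0 : 0 <= q x * P x ^+ 2 by rewrite mulr_ge0 ?sqr_ge0 ?(ltW q0).
  by rewrite lerXn2r ?nnegrE//; move: KB0; lra.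
have [xr|rx] := leP x r.
  have [h1 _] := mid_bounds (ltW xx) xr; split => //.
  have p0 : 0 <= r ^+ 2 - x ^+ 2 by rewrite -q_sqr// sqr_ge0.
  rewrite distrC ger0_norm//.
  apply: (@le_trans _ _ ((m ^+ 2 * P x ^+ 2) ^+ 2)); last first.
    by rewrite lerXn2r ?nnegrE// mulr_ge0 ?sqr_ge0.
  rewrite [leRHS]exprMn pw ler_wpM2r ?sqr_ge0//.
  have : xs ^+ 2 <= x ^+ 2 by rewrite lerXn2r ?nnegrE ?(ltW x0) ?(ltW xs0)// ltW.
  by rewrite xs_sqr -!exprM; lra.
(* Beyond [r], [F >= 0] gives [(x^2 - r^2) P^2 <= Theta^2], so the second quantity is at most
   [(P Theta)^2], which is largest at [r], where [mid_bounds] applies. *)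
have [h1 h2] := mid_bounds (ltW xs_lt) (lexx _).
split; first by apply: le_trans h1; rewrite ler_pM2l ?exprn_gt0// P_sqr_le// ltW.
have p0 : 0 <= x ^+ 2 - r ^+ 2.
  by rewrite subr_ge0 lerXn2r ?nnegrE ?(ltW x0) ?(ltW r0)// ltW.
rewrite ger0_norm// pw.
have F0 := F_ge0 (ltW rx).
have h3 : (x ^+ 2 - r ^+ 2) * P x ^+ 2 <= Theta x ^+ 2 by move: F0; rewrite /F /tp_F; lra.
apply: (@le_trans _ _ ((P x * Theta x) ^+ 2)).
  rewrite [leRHS]exprMn [leLHS](_ : _ = (x ^+ 2 - r ^+ 2) * P x ^+ 2 * P x ^+ 2); last by ring.
  by rewrite [leRHS]mulrC ler_wpM2r ?sqr_ge0.
apply: (@le_trans _ _ ((P r * Theta r) ^+ 2)).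
  have a1 := PT_le (lexx r) (ltW rx); have a2 := PT_le0 (ltW rx).
  rewrite -[leLHS]sqrrN -[leRHS]sqrrN lerXn2r ?nnegrE; lra.
rewrite [leLHS]exprMn -(@ler_pM2l _ (m ^+ 2)) ?exprn_gt0//.
apply: (@le_trans _ _ (18 * (K * B) * (2 * (K * B) * m ^+ 2))).
  have := ler_pM (mulr_ge0 (sqr_ge0 m) (sqr_ge0 (P r))) (sqr_ge0 (Theta r)) h1 h2.
  lra.
have : 0 <= m ^+ 2 * (K * B * (K * B)) by rewrite mulr_ge0 ?sqr_ge0// mulr_ge0.
lra.
Qed.

End TurningPoint.

(** * Weighted Bessel bounds uniform in the parameters *)

Section BesselUniform.
Context {R : realType}.
Implicit Types (x r T A : R).

(* [nK r = 2 e^(pi r / 2) |K_(ir)|], the Bessel function normalised to be of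
   polynomial size; [wt A T x = (1 + x / T) ^ A]. *)
Definition nK r x := expR (pi * r / 2) * `|bP r x|.
Definition wt A T x := expR (A * ln (1 + x / T)).

Lemma nK_ge0 r x : 0 <= nK r x.
Proof. by rewrite mulr_ge0 ?expR_ge0. Qed.

Lemma nK_sqr r x : nK r x ^+ 2 = expR (pi * r) * bP r x ^+ 2.
Proof.
rewrite exprMn real_normK ?num_real// -expRM_natl; congr (expR _ * _).
by field.
Qed.

Lemma wt_gt0 A T x : 0 < wt A T x. Proof. exact: expR_gt0. Qed.

Lemma wt_sqr A T x : wt A T x ^+ 2 = expR (2 * A * ln (1 + x / T)).
Proof. by rewrite -expRM_natl mulrA. Qed.

Lemma wt_le A T x y : 0 <= A -> 0 < T -> 0 < x -> x <= y -> wt A T x <= wt A T y.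
Proof.
move=> A0 T0 x0 xy; have h z : 0 < z -> 0 < 1 + z / T.
  by move=> z0; rewrite addr_gt0// divr_gt0.
have y0 : 0 < y by exact: lt_le_trans xy.
rewrite ler_expR ler_wpM2l// ler_ln ?posrE ?h// lerD2l ler_pM2r ?invr_gt0//.
Qed.

Lemma bP_exp_le : exists2 C : R, 0 < C & forall r x, 0 < x ->
  x * bP r x ^+ 2 <= C * expR (- (2 * x)).
Proof.
have [C C0 HC] := @bint0_le R; exists (C ^+ 2); first by rewrite exprn_gt0.
move=> r x x0; have := HC x (lcos r) x0 (@lcos_hcont R r) (fun t _ => lcos_le1 r t).
rewrite -/(bP r x) => h.
have s0 : 0 < Num.sqrt x by rewrite sqrtr_gt0.
have : `|bP r x| ^+ 2 <= (C * expR (- x) / Num.sqrt x) ^+ 2.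
  by rewrite lerXn2r ?nnegrE ?divr_ge0 ?mulr_ge0 ?expR_ge0 ?(ltW C0) ?(ltW s0).
rewrite real_normK ?num_real// expr_div_n sqr_sqrtr ?(ltW x0)// ler_pdivlMr// mulrC => h2.
apply: (le_trans h2); rewrite exprMn -expRM_natl mulrN lexx//.
Qed.

(** Qualitative decay for fixed [r], serving as the boundary condition at infinity in the energy
    argument. *)
Lemma bP_decay r (e : R) : 0 < e ->
  exists X, forall x, X <= x -> `|bTheta r x| <= e /\ `|x * bP r x| <= e.
Proof.
move=> e0; have [C C0 HC] := @bint0_le R.
exists (Num.max 2 (4 * C / e)) => x; rewrite ge_max => /andP[x2 xe].
have x0 : 0 < x by lra.
have hx : 4 * C <= e * x by rewrite [leRHS]mulrC -ler_pdivrMr.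
split.
  rewrite /bTheta normrN.
  apply: (le_trans (bint1_le x0 (@lcos_hcont R r) (fun t _ => lcos_le1 r t))).
  have h0 : 0 < x / 2 by rewrite divr_gt0.
  have c1 : hcont (cst 1 : R -> R) by move=> t _; exact: cst_continuous.
  have := HC (x / 2) (cst 1) h0 c1.
  have n1 (t : R) : 0 < t -> `|cst 1 t| <= 1 :> R by rewrite normr1.
  move=> /(_ n1) /(le_trans (ler_norm _)) h.
  have s1 : 1 <= Num.sqrt (x / 2).
    by rewrite -[leLHS](@sqrtr1 R) ler_sqrt ?ltr01//; lra.
  have : C * expR (- (x / 2)) / Num.sqrt (x / 2) <= C * (2 / x).
    rewrite -mulrA ler_pM2l// ler_pdivrMr; last by lra.
    have ex := expR_ge_pow 1 (ltW h0); rewrite factS fact0/= mul1r expr1 in ex.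
    apply: (@le_trans _ _ (2 / x * 1)); last by rewrite ler_wpM2l// divr_ge0 ?ltW.
    rewrite mulr1 expRN invf_ple ?posrE ?divr_gt0 ?expR_gt0//.
    by rewrite invf_div.
  have : C * (2 / x) <= e / 2.
    by rewrite mulrA ler_pdivrMr//; lra.
  lra.
have := HC x (lcos r) x0 (@lcos_hcont R r) (fun t _ => lcos_le1 r t).
rewrite -/(bP r x) => h; rewrite normrM gtr0_norm//.
have s1 : 1 <= Num.sqrt x by rewrite -[leLHS](@sqrtr1 R) ler_sqrt ?ltr01//; lra.
have ex := expR_ge_pow 2 (ltW x0); rewrite factS factS fact0/= in ex.
have : x * (C * expR (- x) / Num.sqrt x) <= x * (C * expR (- x)).
  rewrite ler_pM2l// ler_pdivrMr; last by lra.
  by rewrite ler_peMr// mulr_ge0 ?expR_ge0// ltW.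
have : x * (C * expR (- x)) <= C * (2 / x).
  by rewrite mulrCA ler_pM2l// ler_pdivlMr// mulrAC -expr2 expRN ler_pdivrMr ?expR_gt0.
have : C * (2 / x) <= e by rewrite mulrA ler_pdivrMr//; lra.
have : x * `|bP r x| <= x * (C * expR (- x) / Num.sqrt x) by rewrite ler_pM2l.
lra.
Qed.

(** The condition [r >= 8] makes the cube root [m] at least 2. The two turning point bounds,
    [k^2 <= K] and [|d| k^4 <= K^2], combine to [k^4 (|d| + 1) <= 2 K^2], which yields the smooth
    majorant with [d^2 + 1] under the roots. *)
Lemma nK_large_r : exists2 C : R, 0 < C & forall r x, 8 <= r -> 0 < x ->
  nK r x ^+ 2 <= C /\
  nK r x ^+ 2 <= C / Num.sqrt (Num.sqrt ((x ^+ 2 - r ^+ 2) ^+ 2 + 1)).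
Proof.
have [C0 C00 HC0] := @gnorm_one_le R.
pose K : R := 108 * expR 1 * (17 * C0).
have K0 : 0 < K by rewrite !mulr_gt0 ?expR_gt0.
exists (2 * K) => [|r x r8 x0]; first by rewrite mulr_gt0.
have r0 : 0 < r by lra.
pose m := expR (3^-1 * ln r).
have mr : m ^+ 3 = r.
  by rewrite -expRM_natl mulrA divff ?mul1r ?lnK// pnatr_eq0.
have m0 : 0 < m by exact: expR_gt0.
have m2 : 2 <= m.
  rewrite -(@ler_pXn2r _ 3) ?nnegrE ?(ltW m0)// mr.
  by apply: le_trans r8; rewrite le_eqVlt; apply/orP; left; apply/eqP; ring.
pose E := expR (- (pi * r)).
have E0 : 0 < E by exact: expR_gt0.
(* In [bessel_near0] the Gamma term is at most [8 C0 (2 r) E], and for small [x] the error is at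
   most one further [C0 r E]. *)
pose B := 17 * C0 * E.
have B0 : 0 <= B by rewrite !mulr_ge0 ?(ltW C00) ?(ltW E0).
pose G := @gC R 2^-1 0.
have G0 : 0 < G by exact: gC0_gt0.
have near0 : exists2 x1, 0 < x1 & forall x, 0 < x -> x <= x1 ->
    bTheta r x ^+ 2 + (m ^+ 3) ^+ 2 * bP r x ^+ 2 <= B * m ^+ 3.
  (* Chosen so that the error [4 y^2 G^2] is at most [C0 r E] when [y^2 <= u]. This range is
     exponentially short in [r], but its length enters no bound. *)
  rewrite mr; pose u := C0 * r * E / (4 * G ^+ 2).
  have u0 : 0 < u by rewrite divr_gt0 ?mulr_gt0 ?exprn_gt0.
  exists (Num.sqrt u); first by rewrite sqrtr_gt0.
  move=> y y0 yu; apply: (le_trans (bessel_near0 r y0)).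
  have h1 := HC0 r r0.
  have h2 : Num.sqrt (1 + r ^+ 2) <= 2 * r.
    rewrite -(@ler_pXn2r _ 2) ?nnegrE ?sqrtr_ge0 ?mulr_ge0 ?(ltW r0)//.
    rewrite sqr_sqrtr ?addr_ge0 ?sqr_ge0//.
    have : 1 <= r ^+ 2 by rewrite expr_ge1 ?(ltW r0)//; lra.
    by lra.
  have h3 : C0 * Num.sqrt (1 + r ^+ 2) * E <= C0 * (2 * r) * E.
    by rewrite ler_pM2r// ler_pM2l.
  have h4 : y ^+ 2 <= u.
    have : y ^+ 2 <= Num.sqrt u ^+ 2 by rewrite lerXn2r ?nnegrE ?sqrtr_ge0 ?(ltW y0).
    by rewrite sqr_sqrtr// ltW.
  have h5 : 4 * y ^+ 2 * G ^+ 2 <= C0 * r * E.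
    move: h4; rewrite /u ler_pdivlMr ?mulr_gt0 ?exprn_gt0//; lra.
  rewrite -/E in h1; rewrite -/G /B; lra.
have dP y : 0 < y -> has_der (bP r) y (bTheta r y / y) by exact: has_der_bP.
have dT y : 0 < y -> has_der (bTheta r) y ((y - (m ^+ 3) ^+ 2 / y) * bP r y).
  by rewrite mr; exact: has_der_bTheta.
have [] := turning_point_bounds m2 B0 dP dT near0 (@bP_decay r) x0.
rewrite mr => b1 b2.
have BK : 108 * expR 1 * B = K * E by rewrite /B /K; ring.
rewrite BK in b1 b2.
have EE : expR (pi * r) * E = 1 by rewrite -expRD subrr expR0.
have k2 : nK r x ^+ 2 <= K.
  rewrite nK_sqr; apply: (@le_trans _ _ (expR (pi * r) * (K * E))); last first.
    by rewrite mulrCA EE mulr1.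
  rewrite ler_pM2l ?expR_gt0//; apply: le_trans b1.
  rewrite ler_peMl ?sqr_ge0// expr_ge1 ?(ltW m0)//; lra.
split; first by lra.
set d := x ^+ 2 - r ^+ 2 in b2 *.
have k4 : `|d| * (nK r x ^+ 2) ^+ 2 <= K ^+ 2.
  rewrite nK_sqr exprMn -exprM mulrCA.
  apply: (@le_trans _ _ (expR (pi * r) ^+ 2 * (K * E) ^+ 2)).
    by rewrite ler_pM2l ?exprn_gt0 ?expR_gt0.
  by rewrite -exprMn mulrCA EE mulr1.
have d1 : 0 < d ^+ 2 + 1 by rewrite ltr_wpDl ?sqr_ge0.
have s1 : 0 < Num.sqrt (d ^+ 2 + 1) by rewrite sqrtr_gt0.
have s2 : 0 < Num.sqrt (Num.sqrt (d ^+ 2 + 1)) by rewrite sqrtr_gt0.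
rewrite ler_pdivlMr//.
have k0 : 0 <= nK r x ^+ 2 by rewrite sqr_ge0.
have n1 := mulr_ge0 k0 (ltW s2).
have n2 : 0 <= 2 * K by lra.
rewrite -(@ler_pXn2r _ 2) ?nnegrE// [leLHS]exprMn sqr_sqrtr ?(ltW s1)//.
have hs : Num.sqrt (d ^+ 2 + 1) <= `|d| + 1.
  rewrite -(@ler_pXn2r _ 2) ?nnegrE ?(ltW s1) ?addr_ge0// sqr_sqrtr ?(ltW d1)//.
  rewrite [leRHS]sqrrD real_normK ?num_real//; have := normr_ge0 d; lra.
have k22 : (nK r x ^+ 2) ^+ 2 <= K ^+ 2 by rewrite lerXn2r ?nnegrE ?(ltW K0).
have : (nK r x ^+ 2) ^+ 2 * Num.sqrt (d ^+ 2 + 1) <= (nK r x ^+ 2) ^+ 2 * (`|d| + 1).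
  by rewrite ler_wpM2l ?sqr_ge0.
have := sqr_ge0 K; lra.
Qed.

(* The weight [wt A T] is at most exponential, so that the crude exponential
   decay of the Bessel function absorbs it beyond the turning point. *)
Lemma wt_sqr_le_expR A : 0 < A -> exists2 C : R, 0 < C & forall T x, 2 <= T -> 0 < x ->
  wt A T x ^+ 2 <= C * expR x /\ (x <= 6 * T -> wt A T x ^+ 2 <= C).
Proof.
move=> A0; pose C1 : R := expR (1 - 2 * A + 2 * A * ln (2 * A)).
pose C2 : R := expR (2 * A * ln 7).
exists (C1 * expR 1 + C2) => [|T x T2 x0].
  by rewrite addr_gt0 ?mulr_gt0 ?expR_gt0.
have T0 : 0 < T by lra.
have p : 0 < 1 + x / T by rewrite addr_gt0// divr_gt0.
have A2 : 0 < 2 * A by rewrite mulr_gt0.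
have c1 : 0 < C1 by exact: expR_gt0.
have c2 : 0 < C2 by exact: expR_gt0.
have e1 : 1 <= expR 1 :> R by have := expR_ge1Dx (1 : R); lra.
split.
  apply: (@le_trans _ _ (C1 * expR x)); last first.
    rewrite ler_pM2r ?expR_gt0//.
    have : C1 <= C1 * expR 1 by rewrite ler_peMr// ltW.
    lra.
  rewrite wt_sqr -expRD ler_expR.
  have := ln_le_subr1 (divr_gt0 p A2); rewrite ln_div ?posrE// => h.
  have : 2 * A * (ln (1 + x / T) - ln (2 * A)) <= 2 * A * ((1 + x / T) / (2 * A) - 1).
    by rewrite ler_pM2l.
  have -> : 2 * A * ((1 + x / T) / (2 * A) - 1) = 1 + x / T - 2 * A by field; rewrite !gt_eqF.
  have : x / T <= x by rewrite ler_pdivrMr// ler_peMr ?(ltW x0)//; lra.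
  lra.
move=> xT; have : wt A T x ^+ 2 <= C2.
  rewrite wt_sqr ler_expR ler_pM2l// ler_ln ?posrE//.
  have : x / T <= 6 by rewrite ler_pdivrMr.
  lra.
have := mulr_ge0 (ltW c1) (expR_ge0 (1 : R)); lra.
Qed.

(** These are the two hypotheses of the convolution estimate. For [r < 8] or [x >= 6 T] exponential
    decay gives [x k^2] times the squared weight bounded, whence the term [1 / x]; otherwise the
    squared weight is bounded and [nK_large_r] applies. *)
Lemma nK_bounds A : 0 < A -> exists2 C : R, 0 < C & forall r T x,
  0 <= r -> 2 <= T -> 2 * r <= 3 * T -> 0 < x ->
  (nK r x * wt A T x) ^+ 2 <=
    C * ((Num.sqrt (Num.sqrt ((x ^+ 2 - r ^+ 2) ^+ 2 + 1)))^-1 + x^-1) /\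
  x * (nK r x * wt A T x) ^+ 2 <= C * T.
Proof.
move=> A0; have [C1 C10 H1] := bP_exp_le; have [C2 C20 H2] := nK_large_r.
have [C3 C30 H3] := wt_sqr_le_expR A0.
pose C4 : R := C1 * expR (8 * 4) * C3.
have C40 : 0 < C4 by rewrite !mulr_gt0 ?expR_gt0.
pose C5 : R := C1 * C3.
have C50 : 0 < C5 by rewrite mulr_gt0.
pose C6 : R := 6 * C2 * C3.
have C60 : 0 < C6 by rewrite !mulr_gt0.
exists (C4 + C5 + C6) => [|r T x r0 T2 rT x0]; first by rewrite !addr_gt0.
have T0 : 0 < T by lra.
set s := Num.sqrt (Num.sqrt _).
have s0 : 0 < s by rewrite !sqrtr_gt0 ltr_wpDl ?sqr_ge0.
have [h3 h3'] := H3 T x T2 x0.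
have w0 : 0 <= wt A T x ^+ 2 by rewrite sqr_ge0.
have pi4 : pi < 4 :> R by have := @pihalf_lt2 R; lra.
have pi0 := @pi_gt0 R.
rewrite exprMn.
suff [h|[h1 h2]] : x * (nK r x ^+ 2 * wt A T x ^+ 2) <= C4 + C5 \/
    (nK r x ^+ 2 * wt A T x ^+ 2 <= C2 * C3 / s /\
     x * (nK r x ^+ 2 * wt A T x ^+ 2) <= C6 * T).
- split.
    apply: (@le_trans _ _ ((C4 + C5) / x)); first by rewrite ler_pdivlMr// mulrC.
    have xi : 0 < x^-1 by rewrite invr_gt0.
    have si : 0 < s^-1 by rewrite invr_gt0.
    have : 0 < (C4 + C5 + C6) * s^-1 by rewrite mulr_gt0// !addr_gt0.
    have : 0 < C6 * x^-1 by rewrite mulr_gt0.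
    lra.
  have : C4 + C5 <= (C4 + C5) * T by rewrite ler_peMr//; lra.
  have : 0 < C6 * T by rewrite mulr_gt0.
  lra.
- split.
    have xi : 0 < x^-1 by rewrite invr_gt0.
    have si : 0 < s^-1 by rewrite invr_gt0.
    have : 0 < (C4 + C5 + C6) * x^-1 by rewrite mulr_gt0// !addr_gt0.
    have : 0 < (C4 + C5 + 5 * C2 * C3) * s^-1 by rewrite mulr_gt0// !addr_gt0// !mulr_gt0.
    rewrite /C6; lra.
  have : 0 < (C4 + C5) * T by rewrite mulr_gt0// addr_gt0.
  lra.
have base : x * (nK r x ^+ 2 * wt A T x ^+ 2) <=
    expR (pi * r) * (C1 * expR (- (2 * x))) * (C3 * expR x).
  rewrite mulrA ler_pM// ?mulr_ge0 ?sqr_ge0 ?(ltW x0)//.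
  by rewrite nK_sqr mulrCA ler_pM2l ?expR_gt0// H1.
have [r8|r8] := ltP r 8.
  left; apply: (@le_trans _ _ C4); last by lra.
  apply: (le_trans base).
  have -> : expR (pi * r) * (C1 * expR (- (2 * x))) * (C3 * expR x) =
     C1 * C3 * (expR (pi * r) * (expR (- (2 * x)) * expR x)) by ring.
  rewrite /C4 -mulrA -[leRHS]mulrA ler_pM2l// [leRHS]mulrC ler_pM2l//.
  rewrite -!expRD ler_expR.
  have : pi * r <= 4 * 8 by rewrite ler_pM// ltW.
  lra.
(* In this range [pi r <= 4 r <= 6 T <= x], so [e^(pi r) e^(-2x) e^x <= 1]. *)
have [xT|xT] := leP (6 * T) x.
  left; apply: (@le_trans _ _ C5); last by lra.
  apply: (le_trans base).
  have -> : expR (pi * r) * (C1 * expR (- (2 * x))) * (C3 * expR x) =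
     C1 * C3 * (expR (pi * r) * (expR (- (2 * x)) * expR x)) by ring.
  rewrite /C5 -[leRHS]mulr1 ler_pM2l ?mulr_gt0// -!expRD -[leRHS](@expR0 R) ler_expR.
  have : pi * r <= 4 * r by rewrite ler_pM2r//; lra.
  lra.
right; have [k1 k2] := H2 r x r8 x0; rewrite -/s in k2.
have w3 := h3' (ltW xT).
split.
  rewrite (_ : C2 * C3 / s = C2 / s * C3); last by ring.
  by rewrite ler_pM ?sqr_ge0.
apply: (@le_trans _ _ (6 * T * (C2 * C3))).
  apply: ler_pM; [exact: ltW|by rewrite mulr_ge0 ?sqr_ge0|exact: ltW|].
  by apply: ler_pM; rewrite ?sqr_ge0.
by rewrite /C6 le_eqVlt; apply/orP; left; apply/eqP; ring.
Qed.

End BesselUniform.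

(** * The convolution integral *)

Section TransitionPrimitive.
Context {R : realType}.
Variables (v e : R).
Hypothesis v0 : 0 <= v.
Hypothesis e0 : 0 < e.
Implicit Types u : R.

(* [tr_G] is a bounded smooth primitive which, up to a multiple of [1 / u],
   dominates the regularised singularity [1 / sqrt (u |u - v|)]. *)
Definition tr_S u := Num.sqrt (Num.sqrt ((u - v) ^+ 2 + e)).
Definition tr_W u := Num.sqrt (u + v).
Definition tr_G u := (u - v) / (tr_S u * tr_W u).
Definition tr_dG u := (tr_S u * tr_W u)^-1 - (u - v) ^+ 2 / (2 * tr_S u ^+ 5 * tr_W u)
  - (u - v) / (2 * tr_S u * tr_W u ^+ 3).

Let y0 u : 0 < (u - v) ^+ 2 + e. Proof. by rewrite ltr_wpDl ?sqr_ge0. Qed.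
Let s0 u : 0 < Num.sqrt ((u - v) ^+ 2 + e). Proof. by rewrite sqrtr_gt0. Qed.
Let S0 u : 0 < tr_S u. Proof. by rewrite /tr_S sqrtr_gt0. Qed.
Let W0 u : 0 < u -> 0 < tr_W u.
Proof. by move=> u0; rewrite sqrtr_gt0 ltr_wpDr. Qed.
Let S2 u : tr_S u ^+ 2 = Num.sqrt ((u - v) ^+ 2 + e).
Proof. by rewrite sqr_sqrtr// ltW. Qed.
Let S4 u : tr_S u ^+ 4 = (u - v) ^+ 2 + e.
Proof. by rewrite (_ : 4 = 2 * 2)%N// exprM S2 sqr_sqrtr// ltW. Qed.
Let W2 u : 0 < u -> tr_W u ^+ 2 = u + v.
Proof. by move=> u0; rewrite sqr_sqrtr// addr_ge0// ltW. Qed.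
Let dist_le u : `|u - v| <= tr_S u ^+ 2.
Proof.
rewrite S2 -(@ler_pXn2r _ 2) ?nnegrE ?(ltW (s0 u))// sqr_sqrtr ?(ltW (y0 u))//.
by rewrite real_normK ?num_real// lerDl ltW.
Qed.

Lemma has_der_tr_G u : 0 < u -> has_der tr_G u (tr_dG u).
Proof.
move=> u0; have uv : 0 < u + v by rewrite ltr_wpDr.
have dS : has_der tr_S u ((u - v) / (2 * tr_S u ^+ 3)).
  rewrite /tr_S; derE => //; rewrite -/(tr_S u) -S2 /=.
  by field; rewrite gt_eqF.
have dW : has_der tr_W u ((2 * tr_W u)^-1).
  by rewrite /tr_W; derE => //; rewrite addr0 mulr1.
have S := S0 u; have W := W0 u0.
rewrite /tr_G; derE; first by rewrite gt_eqF// mulr_gt0.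
by rewrite /tr_dG; field; rewrite !gt_eqF.
Qed.

Lemma tr_dG_hcont : hcont tr_dG.
Proof.
move=> u u0; have uv : 0 < u + v by rewrite ltr_wpDr.
have S := S0 u; have W := W0 u0.
rewrite /tr_dG /tr_S /tr_W; derC; rewrite -/(tr_S u) -/(tr_W u) ?mulf_neq0 ?expf_neq0 ?gt_eqF//.
Qed.

Let drift_le u : 0 < u -> `|u - v| / tr_S u <= tr_W u.
Proof.
move=> u0; have S := S0 u; have W := W0 u0.
rewrite ler_pdivrMr// -(@ler_pXn2r _ 2) ?nnegrE ?mulr_ge0 ?(ltW S) ?(ltW W)//.
rewrite exprMn W2// expr2; apply: ler_pM => //.
by rewrite ler_norml; apply/andP; split; move: v0; lra.
Qed.

Lemma tr_G_le1 u : 0 < u -> `|tr_G u| <= 1.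
Proof.
move=> u0; have S := S0 u; have W := W0 u0.
rewrite /tr_G normrM normfV (gtr0_norm (mulr_gt0 S W)) invfM mulrA.
by rewrite ler_pdivrMr// mul1r drift_le.
Qed.

(** In [tr_dG], the derivative of [tr_S] costs at most half of the main term, since
    [(u - v)^2 <= tr_S^4], and the derivative of [tr_W] costs at most [1 / (2 u)]. *)
Lemma tr_dG_ge u : 0 < u -> (tr_S u * tr_W u)^-1 <= 2 * tr_dG u + u^-1.
Proof.
move=> u0; have S := S0 u; have W := W0 u0.
have h1 : (u - v) ^+ 2 / (2 * tr_S u ^+ 5 * tr_W u) <= (tr_S u * tr_W u)^-1 / 2.
  rewrite ler_pdivrMr ?mulr_gt0 ?exprn_gt0//.
  rewrite [leRHS](_ : _ = tr_S u ^+ 4); last by field; rewrite !gt_eqF.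
  by rewrite S4 lerDl ltW.
have h2 : (u - v) / (2 * tr_S u * tr_W u ^+ 3) <= u^-1 / 2.
  apply: (@le_trans _ _ ((tr_W u ^+ 2)^-1 / 2)); last first.
    by rewrite ler_pM2r ?invr_gt0// W2// lef_pV2 ?posrE ?lerDl// ltr_wpDr.
  rewrite [leLHS](_ : _ = (u - v) / tr_S u / (tr_W u ^+ 3) / 2); last by field; rewrite !gt_eqF.
  rewrite ler_pM2r ?invr_gt0// ler_pdivrMr ?exprn_gt0//.
  rewrite [leRHS](_ : _ = tr_W u); last by field; rewrite gt_eqF.
  apply: le_trans (drift_le u0); rewrite ler_pM2r ?invr_gt0//.
  exact: ler_norm.
rewrite /tr_dG; lra.
Qed.

(** If [v <= 2 u], then [tr_W] and [sqrt u] are comparable. Otherwise [|u - v| >= u], the left side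
    is at most [1 / u], and the right side is at least that because [2 tr_dG >= - 1 / u]. *)
Lemma tr_bound u : 0 < u -> (Num.sqrt u * tr_S u)^-1 <= 4 * tr_dG u + 3 / u.
Proof.
move=> u0; have S := S0 u; have W := W0 u0; have h := tr_dG_ge u0.
have su : 0 < Num.sqrt u by rewrite sqrtr_gt0.
have ui : 0 < u^-1 by rewrite invr_gt0.
have SWi : 0 < (tr_S u * tr_W u)^-1 by rewrite invr_gt0 mulr_gt0.
have [uv|uv] := leP v (2 * u).
  have : (Num.sqrt u * tr_S u)^-1 <= 2 * (tr_S u * tr_W u)^-1.
    have -> : 2 * (tr_S u * tr_W u)^-1 = (tr_W u / 2 * tr_S u)^-1 by field; rewrite !gt_eqF.
    rewrite lef_pV2 ?posrE ?mulr_gt0 ?divr_gt0// ler_pM2r//.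
    rewrite -(@ler_pXn2r _ 2) ?nnegrE ?divr_ge0 ?(ltW W) ?(ltW su)//.
    by rewrite exprMn W2// sqr_sqrtr ?(ltW u0)//; lra.
  lra.
have : (Num.sqrt u * tr_S u)^-1 <= u^-1.
  rewrite lef_pV2 ?posrE ?mulr_gt0//.
  rewrite -[leLHS](sqr_sqrtr (ltW u0)) expr2 ler_pM2l//.
  rewrite -(@ler_pXn2r _ 2) ?nnegrE ?(ltW S) ?(ltW su)// sqr_sqrtr ?(ltW u0)//.
  apply: le_trans (dist_le u); rewrite distrC; apply: le_trans (ler_norm _); lra.
lra.
Qed.

End TransitionPrimitive.

Section ConvolutionIntegral.
Context {R : realType}.
Local Notation mu := (@lebesgue_measure R).
Local Notation D := (`]0, +oo[%classic : set R).
Variables (F : R -> R) (r C T : R).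
Hypothesis F0 : forall x, 0 < x -> 0 <= F x.
Hypothesis cF : hcont F.
Hypothesis C0 : 0 < C.
Hypothesis T2 : 2 <= T.
Hypothesis F1 : forall x, 0 < x -> F x ^+ 2 <=
  C * ((Num.sqrt (Num.sqrt ((x ^+ 2 - r ^+ 2) ^+ 2 + 1)))^-1 + x^-1).
Hypothesis F2 : forall x, 0 < x -> x * F x ^+ 2 <= C * T.
Implicit Types (u a b x : R).

(* At [x = a sqrt (1 + u)] one has [x^2 - r^2 = a^2 (u - (r^2 / a^2 - 1))]. *)
Definition cv_v a := Num.max (r ^+ 2 / a ^+ 2 - 1) 0.
Definition cv_e a := (a ^+ 4)^-1.
Definition cv_d a u := 4 * tr_dG (cv_v a) (cv_e a) u + 4 / u.

Let v0 a : 0 <= cv_v a. Proof. by rewrite /cv_v le_max lexx orbT. Qed.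
Let e0 a : 0 < a -> 0 < cv_e a. Proof. by move=> a0; rewrite /cv_e invr_gt0 exprn_gt0. Qed.
Let T0 : 0 < T. Proof. by move: T2; lra. Qed.

Let xa a u := a * Num.sqrt (1 + u).

Let xa0 a u : 0 < a -> 0 < u -> 0 < xa a u.
Proof. by move=> a0 u0; rewrite mulr_gt0// sqrtr_gt0 addr_gt0. Qed.

Let xa_sqr a u : 0 < u -> xa a u ^+ 2 = a ^+ 2 * (1 + u).
Proof. by move=> u0; rewrite exprMn sqr_sqrtr// addr_ge0// ltW. Qed.

(** The factor [a] scales [tr_S] to the fourth root in [F1]. Truncating [cv_v] at 0 when [r < a]
    only decreases [|u - v|]. The term [1 / x] of [F1] accounts for one more [1 / u], hence 4
    instead of 3 in [cv_d]. *)
Let main_half a u : 0 < a -> 0 < u ->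
  a * Num.sqrt u * F (xa a u) ^+ 2 / u <= C * cv_d a u.
Proof.
move=> a0 u0; have x0 := xa0 a0 u0; have su : 0 < Num.sqrt u by rewrite sqrtr_gt0.
have su2 : Num.sqrt u ^+ 2 = u by rewrite sqr_sqrtr// ltW.
set S := tr_S (cv_v a) (cv_e a) u.
have S0 : 0 < S by rewrite /S /tr_S !sqrtr_gt0 ltr_wpDl ?sqr_ge0 ?e0.
have h1 : a * S <= Num.sqrt (Num.sqrt ((xa a u ^+ 2 - r ^+ 2) ^+ 2 + 1)).
  have p : 0 <= (xa a u ^+ 2 - r ^+ 2) ^+ 2 + 1 by rewrite addr_ge0 ?sqr_ge0.
  rewrite -(@ler_pXn2r _ 4) ?nnegrE ?mulr_ge0 ?(ltW a0) ?(ltW S0) ?sqrtr_ge0//.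
  have q (z : R) : 0 <= z -> Num.sqrt (Num.sqrt z) ^+ 4 = z.
    by move=> z0; rewrite (_ : 4 = 2 * 2)%N// exprM sqr_sqrtr ?sqrtr_ge0// sqr_sqrtr.
  rewrite exprMn /S /tr_S !q//; last by rewrite addr_ge0 ?sqr_ge0 ?(ltW (e0 a0)).
  rewrite mulrDr /cv_e mulfV ?expf_neq0 ?gt_eqF// lerD2r xa_sqr//.
  have -> : a ^+ 2 * (1 + u) - r ^+ 2 = a ^+ 2 * (u - (r ^+ 2 / a ^+ 2 - 1)).
    by field; rewrite gt_eqF.
  rewrite [leRHS]exprMn (_ : (a ^+ 2) ^+ 2 = a ^+ 4); last by rewrite -exprM.
  apply: ler_wpM2l; first by rewrite exprn_ge0 ?(ltW a0).
  rewrite /cv_v.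
  set u1 := _ - 1; have [h|h] := leP u1 0; last exact: lexx.
  by rewrite subr0 lerXn2r ?nnegrE ?(ltW u0)//; lra.
have h2 : (Num.sqrt (Num.sqrt ((xa a u ^+ 2 - r ^+ 2) ^+ 2 + 1)))^-1 <= (a * S)^-1.
  rewrite lef_pV2 ?posrE ?mulr_gt0//; apply: lt_le_trans h1.
  by rewrite mulr_gt0.
have h3 : (xa a u)^-1 <= (a * Num.sqrt u)^-1.
  rewrite lef_pV2 ?posrE ?(mulr_gt0 a0 su)// /xa ler_pM2l// ler_wsqrtr//.
  by rewrite lerDr.
have h4 : F (xa a u) ^+ 2 <= C * ((a * S)^-1 + (a * Num.sqrt u)^-1).
  by apply: (le_trans (F1 x0)); rewrite ler_pM2l// lerD.
have h5 := tr_bound (v0 a) (e0 a0) u0.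
have c0 : 0 < a * Num.sqrt u / u by rewrite !mulr_gt0 ?invr_gt0.
apply: (@le_trans _ _ (a * Num.sqrt u / u * (C * ((a * S)^-1 + (a * Num.sqrt u)^-1)))).
  by rewrite mulrAC ler_pM2l.
have -> : a * Num.sqrt u / u * (C * ((a * S)^-1 + (a * Num.sqrt u)^-1)) =
   C * ((Num.sqrt u * S)^-1 + u^-1).
  have -> : u^-1 = (Num.sqrt u ^+ 2)^-1 by rewrite su2.
  by field; rewrite !gt_eqF.
rewrite ler_pM2l// /cv_d; rewrite -/S in h5.
lra.
Qed.

Variables (a b : R).
Hypothesis a0 : 0 < a.
Hypothesis b0 : 0 < b.

Let Phi u := F (xa a u) * F (xa b u^-1) / u.
Let mn u := C / Num.sqrt (a * b) / 2 * (cv_d a u + cv_d b u^-1 / u ^+ 2).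
(** Equal to [1 / (u (u^(1/8) + u^(-1/8)))], with primitive [8 atan (u^(1/8))]. *)
Let rho u := (u * (expR (ln u / 8) + expR (- (ln u / 8))))^-1.
Let tl u := 2 * C / Num.sqrt (a * b) * rho u.

Let Phi_ge0 u : 0 < u -> 0 <= Phi u.
Proof.
move=> u0; have ui : 0 < u^-1 by rewrite invr_gt0.
by rewrite divr_ge0 ?mulr_ge0 ?F0 ?xa0 ?(ltW u0).
Qed.

Let sab : 0 < Num.sqrt (a * b). Proof. by rewrite sqrtr_gt0 mulr_gt0. Qed.

Let Phi_main u : 0 < u -> Phi u <= mn u.
Proof.
move=> u0; have ui : 0 < u^-1 by rewrite invr_gt0.
have h1 := main_half a0 u0; have h2 := main_half b0 ui.
have su : 0 < Num.sqrt u by rewrite sqrtr_gt0.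
rewrite /mn (_ : _ / 2 * _ = (C * cv_d a u + C * cv_d b u^-1 / u ^+ 2) / 2 / Num.sqrt (a * b)); last first.
  by field; rewrite !gt_eqF.
rewrite ler_pdivlMr//.
set X := F (xa a u) in h1 *; set Z := F (xa b u^-1) in h2 *.
have h2' : b / Num.sqrt u * Z ^+ 2 / u <= C * cv_d b u^-1 / u ^+ 2.
  rewrite ler_pdivlMr ?exprn_gt0//; apply: le_trans h2.
  rewrite sqrtrV ?(ltW u0)// le_eqVlt; apply/orP; left; apply/eqP.
  by field; rewrite !gt_eqF.
apply: (@le_trans _ _ ((a * Num.sqrt u * X ^+ 2 / u + b / Num.sqrt u * Z ^+ 2 / u) / 2)); last by lra.
(* AM-GM with weights [a sqrt u] and [b / sqrt u], whose product is [a b] *)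
rewrite /Phi -/X -/Z; set p := Num.sqrt (a * Num.sqrt u); set q := Num.sqrt (b / Num.sqrt u).
have pq : Num.sqrt (a * b) = p * q.
  rewrite /p /q -sqrtrM ?mulr_ge0 ?(ltW a0) ?(ltW su)//; congr Num.sqrt.
  by field; rewrite gt_eqF.
have p2 : a * Num.sqrt u = p ^+ 2 by rewrite sqr_sqrtr// mulr_ge0 ?(ltW a0) ?(ltW su).
have q2 : b / Num.sqrt u = q ^+ 2 by rewrite sqr_sqrtr// divr_ge0 ?(ltW b0) ?(ltW su).
rewrite pq p2 q2 -subr_ge0 (_ : _ - _ = (p * X - q * Z) ^+ 2 / u / 2); last by field; rewrite gt_eqF.
by rewrite !divr_ge0 ?sqr_ge0 ?(ltW u0).
Qed.

(** Multiplying [F2] at both points gives [X Z sqrt (ab) e^(y/4) <= C T] with [y = |ln u|], because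
    [(1 + u) (1 + 1/u) >= e^y]. Half of [e^(y/4)] beats [T] as soon as [y >= 8 ln T], and the other
    half leaves an integrable tail. *)
Let Phi_tail u : 0 < u -> 8 * ln T <= `|ln u| -> Phi u <= tl u.
Proof.
move=> u0 hu; have ui : 0 < u^-1 by rewrite invr_gt0.
have x0 := xa0 a0 u0; have z0 := xa0 b0 ui.
set X := F (xa a u); set Z := F (xa b u^-1).
have X0 : 0 <= X by exact: F0.
have Z0 : 0 <= Z by exact: F0.
set y := `|ln u| in hu *.
have e1 : expR y <= (1 + u) * (1 + u^-1).
  have -> : (1 + u) * (1 + u^-1) = 2 + u + u^-1 by field; rewrite gt_eqF.
  rewrite /y; have [h|h] := leP 0 (ln u).
    by rewrite ger0_norm// lnK ?posrE//; lra.
  by rewrite ltr0_norm// expRN lnK ?posrE//; lra.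
have e2 : expR (y / 4) ^+ 2 = expR (y / 2).
  by rewrite -expRM_natl; congr expR; field.
have e3 : expR (y / 2) <= Num.sqrt (1 + u) * Num.sqrt (1 + u^-1).
  rewrite -sqrtrM ?addr_ge0 ?(ltW u0)// -(@ler_pXn2r _ 2) ?nnegrE ?expR_ge0 ?sqrtr_ge0//.
  rewrite sqr_sqrtr ?mulr_ge0 ?addr_ge0 ?(ltW u0) ?(ltW ui)// -expRM_natl.
  by rewrite mulrC divfK// pnatr_eq0.
have prod : (X * Z * Num.sqrt (a * b) * expR (y / 4)) ^+ 2 <= (C * T) ^+ 2.
  rewrite (_ : _ ^+ 2 = X ^+ 2 * Z ^+ 2 * Num.sqrt (a * b) ^+ 2 * expR (y / 4) ^+ 2); last by ring.
  rewrite sqr_sqrtr ?mulr_ge0 ?(ltW a0) ?(ltW b0)// e2.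
  have f1 := F2 x0; have f2 := F2 z0; rewrite -/X in f1; rewrite -/Z in f2.
  have f12 := ler_pM (mulr_ge0 (ltW x0) (sqr_ge0 X)) (mulr_ge0 (ltW z0) (sqr_ge0 Z)) f1 f2.
  rewrite [leRHS]expr2; apply: le_trans f12.
  apply: (@le_trans _ _ (X ^+ 2 * Z ^+ 2 * (a * b) * (Num.sqrt (1 + u) * Num.sqrt (1 + u^-1)))).
    by rewrite ler_wpM2l// !mulr_ge0 ?sqr_ge0 ?(ltW a0) ?(ltW b0).
  by rewrite /xa le_eqVlt; apply/orP; left; apply/eqP; ring.
have prod1 : X * Z * Num.sqrt (a * b) * expR (y / 4) <= C * T.
  rewrite -(@ler_pXn2r _ 2) ?nnegrE ?mulr_ge0 ?expR_ge0 ?sqrtr_ge0 ?(ltW C0) ?(ltW T0)//.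
have eT : T <= expR (y / 8).
  by rewrite -[leLHS](lnK (x := T)) ?posrE// ler_expR; lra.
have e84 : expR (y / 4) = expR (y / 8) * expR (y / 8).
  by rewrite -expRD; congr expR; field.
have prod2 : X * Z * Num.sqrt (a * b) * expR (y / 8) <= C.
  rewrite -(ler_pM2r T0); apply: le_trans prod1.
  rewrite e84 [leRHS]mulrA ler_wpM2l// !mulr_ge0 ?expR_ge0 ?sqrtr_ge0//.
have es : expR (ln u / 8) + expR (- (ln u / 8)) <= 2 * expR (y / 8).
  have h1 : expR (ln u / 8) <= expR (y / 8).
    by rewrite ler_expR ler_pM2r// /y ler_norm.
  have h2 : expR (- (ln u / 8)) <= expR (y / 8).
    by rewrite ler_expR -mulNr ler_pM2r// /y -normrN ler_norm.
  lra.
have E0 : 0 < expR (ln u / 8) + expR (- (ln u / 8)) by rewrite addr_gt0 ?expR_gt0.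
rewrite /tl /rho /Phi -/X -/Z ler_pdivrMr//.
have -> : 2 * C / Num.sqrt (a * b) * (u * (expR (ln u / 8) + expR (- (ln u / 8))))^-1 * u =
  2 * C / (Num.sqrt (a * b) * (expR (ln u / 8) + expR (- (ln u / 8)))).
  by field; rewrite !gt_eqF.
rewrite ler_pdivlMr ?mulr_gt0// mulrA.
apply: (@le_trans _ _ (X * Z * Num.sqrt (a * b) * (2 * expR (y / 8)))).
  by rewrite ler_wpM2l// !mulr_ge0 ?sqrtr_ge0.
lra.
Qed.

Let Phi_hcont : hcont Phi.
Proof.
move=> u u0; have ui : 0 < u^-1 by rewrite invr_gt0.
have c1 : {for u, continuous (fun u => F (xa a u))}.
  apply: (@continuous_comp _ _ _ (xa a) F); last exact: cF (xa0 a0 u0).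
  by rewrite /xa; derC; rewrite ?addr_gt0.
have c2 : {for u, continuous (fun u => F (xa b u^-1))}.
  apply: (@continuous_comp _ _ _ (fun u => xa b u^-1) F); last exact: cF (xa0 b0 ui).
  by rewrite /xa; derC; rewrite ?addr_gt0 ?gt_eqF.
apply: continuousM; first exact: continuousM.
by derC; rewrite gt_eqF.
Qed.

Let rho_integral : (\int[mu]_(u in D) (rho u)%:E <= 16%:E)%E.
Proof.
have p u : 0 < expR (ln u / 8) + expR (- (ln u / 8)) by rewrite addr_gt0 ?expR_gt0.
apply: (@ge0_has_der_integral _ (fun u => 8 * atan (expR (ln u / 8)))).
- by move=> u u0; rewrite /rho; derC => //; rewrite gt_eqF// mulr_gt0.
- by move=> u u0; rewrite invr_ge0 mulr_ge0 ?(ltW u0) ?(ltW (p u)).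
- move=> u u0; derE => //; rewrite /rho expRN.
  have x0 := expR_gt0 (ln u / 8).
  by field; rewrite !gt_eqF// ?addr_gt0 ?mulr_gt0// ?exprn_gt0.
- move=> s t s0 st; have := atan_ltpi2 (expR (ln t / 8)).
  have : 0 <= atan (expR (ln s / 8)) by rewrite -(@atan0 R) le_atan ?expR_ge0.
  by have := @pihalf_lt2 R; lra.
Qed.

Let mn_hcont : hcont mn.
Proof.
have cd c : 0 < c -> hcont (cv_d c).
  move=> c0 u u0; rewrite /cv_d; apply: continuousD.
    apply: continuousM; first exact: cst_continuous.
    exact: tr_dG_hcont (v0 c) (e0 c0) _ u0.
  by derC; rewrite gt_eqF.
move=> u u0; have ui : 0 < u^-1 by rewrite invr_gt0.
rewrite /mn; apply: continuousM; first exact: cst_continuous.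
apply: continuousD; first exact: cd.
apply: continuousM; last by derC; rewrite ?expf_neq0 ?gt_eqF.
apply: (@continuous_comp _ _ _ (fun u => u^-1) (cv_d b)); last exact: cd.
by derC; rewrite gt_eqF.
Qed.

(** The bounded primitives [tr_G] contribute the constant 8. The two terms [4 / u], over a range of
    logarithmic length [16 ln T] and with the factor 1/2 from AM-GM, contribute [64 ln T]. *)
Let main_integral : (\int[mu]_(u in `[expR (- (8 * ln T)), expR (8 * ln T)]) (mn u)%:E <=
  (C / Num.sqrt (a * b) * (8 + 64 * ln T))%:E)%E.
Proof.
have lT : 0 < ln T by rewrite ln_gt0//; move: T2; lra.
pose G u := C / Num.sqrt (a * b) / 2 * (4 * tr_G (cv_v a) (cv_e a) u + 4 * ln u
   - (4 * tr_G (cv_v b) (cv_e b) u^-1 + 4 * ln u^-1)).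
have dg c (c0 : 0 < c) (u : R) (u0 : 0 < u) := has_der_tr_G (v0 c) (e0 c0) u0.
have dG u : 0 < u -> has_der G u (mn u).
  move=> u0; have ui : 0 < u^-1 by rewrite invr_gt0.
  have d1 := dg a a0 u u0.
  have di : has_der (fun u : R => u^-1) u (- u ^- 2).
    by derE; [rewrite gt_eqF|rewrite mulr1].
  have d2 : has_der (fun u => tr_G (cv_v b) (cv_e b) u^-1) u (tr_dG (cv_v b) (cv_e b) u^-1 * - u ^- 2).
    exact: (has_der_comp (dg b b0 _ ui) di).
  rewrite /G; derE; rewrite ?gt_eqF//.
  by rewrite /mn /cv_d; field; rewrite !gt_eqF.
have cm := mn_hcont.
have pos t : expR (- (8 * ln T)) <= t <= expR (8 * ln T) -> 0 < t.
  by move=> /andP[+ _]; apply: lt_le_trans; exact: expR_gt0.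
have lt1 : expR (- (8 * ln T)) < expR (8 * ln T) by rewrite ltr_expR; lra.
rewrite (has_der_FTC2 lt1 (fun t h => cm _ (pos t h)) (fun t h => dG _ (pos t h))).
rewrite lee_fin /G -mulrBr !expRN !invrK !expRK -!expRN !expRK.
have g c t (c0 : 0 < c) (t0 : 0 < t) := tr_G_le1 (v0 c) (e0 c0) t0.
have := g a _ a0 (expR_gt0 (8 * ln T)); have := g a _ a0 (expR_gt0 (- (8 * ln T))).
have := g b _ b0 (expR_gt0 (8 * ln T)); have := g b _ b0 (expR_gt0 (- (8 * ln T))).
rewrite !ler_norml => /andP[? ?] /andP[? ?] /andP[? ?] /andP[? ?].
rewrite -[leLHS]mulrA ler_pM2l ?divr_gt0//; lra.
Qed.

Let rho_ge0 u : 0 < u -> 0 <= rho u.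
Proof. by move=> u0; rewrite invr_ge0 mulr_ge0 ?addr_ge0 ?expR_ge0 ?(ltW u0). Qed.

Let rho_hcont : hcont rho.
Proof.
move=> u u0; rewrite /rho; derC => //.
by rewrite gt_eqF// mulr_gt0// addr_gt0 ?expR_gt0.
Qed.

Lemma convolution_integral :
  (\int[mu]_(u in D) (F (a * Num.sqrt (1 + u)) * F (b * Num.sqrt (1 + u^-1)) / u)%:E
    <= (C / Num.sqrt (a * b) * (144 * ln T))%:E)%E.
Proof.
change (\int[mu]_(u in D) (Phi u)%:E <= (C / Num.sqrt (a * b) * (144 * ln T))%:E)%E.
set I := `[expR (- (8 * ln T)), expR (8 * ln T)]%classic : set R.
have sI : I `<=` D by apply: hitvS; exact: expR_gt0.
have Dpos u : D u -> 0 < u by rewrite /= in_itv/= andbT.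
have mPhi : measurable_fun D (EFin \o Phi) by apply/measurable_EFinP; exact: hcont_measurable.
have mtl : measurable_fun D (EFin \o tl).
  apply/measurable_EFinP; apply: hcont_measurable => u u0.
  by apply: continuousM; [exact: cst_continuous|exact: rho_hcont].
have mmn : measurable_fun D (EFin \o mn) by apply/measurable_EFinP; exact: hcont_measurable.
have IP (u : R) : I u -> 0 < u by move=> /sI /Dpos.
have mI : measurable I by exact: measurable_itv.
have mDI : measurable (D `\` I) by apply: measurableD => //; exact: measurable_itv.
have k0 : 0 < 2 * C / Num.sqrt (a * b) by rewrite divr_gt0 ?mulr_gt0.
rewrite -{1}(setDUK sI) ge0_integral_setU//; last 3 first.
- by rewrite setDUK.
- by move=> u; rewrite setDUK// => /Dpos u0; rewrite lee_fin Phi_ge0.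
- by rewrite disj_set2E setDIK.
have h1 : (\int[mu]_(u in I) (Phi u)%:E <= (C / Num.sqrt (a * b) * (8 + 64 * ln T))%:E)%E.
  apply: le_trans main_integral; apply: ge0_le_integral => //.
  - by move=> u Iu; have u0 := IP u Iu; rewrite lee_fin Phi_ge0.
  - exact: measurable_funS mPhi.
  - exact: measurable_funS mmn.
  - by move=> u Iu; have u0 := IP u Iu; rewrite lee_fin Phi_main.
have h2 : (\int[mu]_(u in D `\` I) (Phi u)%:E <= (2 * C / Num.sqrt (a * b) * 16)%:E)%E.
  apply: (@le_trans _ _ (\int[mu]_(u in D `\` I) (tl u)%:E)%E).
    apply: ge0_le_integral => //.
    - by move=> u [/Dpos u0 _]; rewrite lee_fin Phi_ge0.
    - by apply: measurable_funS mPhi => //; exact: subDsetl.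
    - by apply: measurable_funS mtl => //; exact: subDsetl.
    - move=> u [/Dpos u0 uI]; rewrite lee_fin Phi_tail//.
      rewrite leNgt; apply/negP; rewrite ltr_norml => /andP[l1 l2]; apply: uI.
      rewrite /I/= in_itv/= -[u]lnK ?posrE// !ler_expR.
      by rewrite !ltW.
  apply: (@le_trans _ _ (\int[mu]_(u in D) (tl u)%:E)%E).
    apply: ge0_subset_integral => // u /Dpos u0.
    by rewrite lee_fin mulr_ge0 ?rho_ge0 ?(ltW k0).
  under eq_integral do rewrite /tl EFinM.
  rewrite ge0_integralZl//; last 3 first.
  - by apply/measurable_EFinP; exact: hcont_measurable.
  - by move=> u /Dpos u0; rewrite lee_fin rho_ge0.
  - by rewrite lee_fin ltW.
  by rewrite [leRHS]EFinM lee_pmul2l// lte_fin.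
apply: (le_trans (leeD h1 h2)); rewrite -EFinD lee_fin.
(* This absorbs the constants [8 + 32] into [80 ln T], and [144 = 64 + 80]. *)
have lT : 2^-1 <= ln T.
  rewrite -[leLHS](@expRK R) ler_ln ?posrE ?expR_gt0//.
  have := expR_ge1Dx (- 2^-1 : R); rewrite expRN => h.
  have x0 := expR_gt0 (2^-1 : R).
  have : expR (2^-1) <= 2 :> R by rewrite -[leRHS]invrK -[leLHS]invrK lef_pV2 ?posrE ?invr_gt0//; lra.
  by move: T2; lra.
rewrite (_ : 2 * C / _ * 16 = C / Num.sqrt (a * b) * 32); last by ring.
by rewrite -mulrDr ler_pM2l ?divr_gt0//; lra.
Qed.

End ConvolutionIntegral.

(** * The Whittaker function *)

Local Open Scope complex_scope.

Section ComplexLayer.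
Context {R : realType}.
Local Notation mu := (@lebesgue_measure R).
Local Notation D := (`]0, +oo[%classic : set R).
Implicit Types (x y t s r : R).

Lemma cabsM (z w : R[i]) : cabs (z * w) = cabs z * cabs w.
Proof. exact: ComplexField.Normc.normcM. Qed.

Lemma cabs_real x : cabs x%:C = `|x|.
Proof. by rewrite /cabs /= expr0n/= addr0 sqrtr_sqr. Qed.

Lemma cabs_imag t : cabs (0 +i* t) = `|t|.
Proof. by rewrite /cabs /= expr0n/= add0r sqrtr_sqr. Qed.

Lemma cabs_le (x y : R) : cabs (x +i* y) <= `|x| + `|y|.
Proof.
rewrite /cabs/= -(@ler_pXn2r _ 2) ?nnegrE ?sqrtr_ge0 ?addr_ge0//.
rewrite sqr_sqrtr ?addr_ge0 ?sqr_ge0// sqrrD !real_normK ?num_real//.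
by have := mulr_ge0 (normr_ge0 x) (normr_ge0 y); lra.
Qed.

Lemma cscale_imag x t : x%:C * (0 +i* t) = 0 +i* (x * t).
Proof. by apply/eqP; rewrite eq_complex/= !mulr0 !mul0r subr0 addr0 !eqxx. Qed.

Lemma cpow_imag x t : cpow x (0 +i* t) = cos (t * ln x) +i* sin (t * ln x).
Proof. by rewrite /cpow/= mul0r expR0 mul1r. Qed.

Lemma cabs_cpow_imag x t : cabs (cpow x (0 +i* t)) = 1.
Proof. by rewrite cpow_imag /cabs/= cos2Dsin2 sqrtr1. Qed.

Lemma complex_nat (n : nat) : n%:R = (n%:R : R)%:C :> R[i].
Proof. by rewrite rmorph_nat. Qed.

Lemma complex_frac (m n : nat) : m%:R / n%:R = (m%:R / n%:R : R)%:C :> R[i].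
Proof. by rewrite rmorphM fmorphV !rmorph_nat. Qed.

Lemma besselK_imag r x : 0 < x -> besselK (0 +i* r) x = (bP r x / 2)%:C.
Proof.
move=> x0; rewrite /besselK /Cintegral.
set I1 := Rintegral _ _ _; set I2 := Rintegral _ _ _.
have Ex t : - (x / 2) * (t + t^-1) = - (x * bch t) by rewrite /bch; ring.
have -> : I1 = bP r x.
  apply: eq_hintegral => t t0; rewrite cpow_imag Ex /bker /lcos/=.
  by field; rewrite gt_eqF.
have -> : I2 = bint 0 (lsin r) x.
  apply: eq_hintegral => t t0; rewrite cpow_imag Ex /bker /lsin/=.
  by field; rewrite gt_eqF.
rewrite bint0_sin//.
rewrite complex_nat -fmorphV.
apply/eqP; rewrite eq_complex/=; apply/andP; split; apply/eqP; ring.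
Qed.

Lemma Gamma_half s : Gamma (1 / 2 + (0 +i* s)) = gC 2^-1 s +i* gS 2^-1 s.
Proof.
rewrite /Gamma /Cintegral.
have E : 1 / 2 + (0 +i* s) - 1 = (- 2^-1) +i* s :> R[i].
  rewrite (_ : 1 / 2 = (1 / 2)%:C); last by rewrite (complex_frac 1 2).
  by apply/eqP; rewrite eq_complex/=; apply/andP; split; apply/eqP; field.
rewrite E.
have G t : expR (- t) * expR (- 2^-1 * ln t) = gker 2^-1 t.
  have -> : - 2^-1 = 2^-1 - 1 :> R by field.
  by [].
congr (_ +i* _); apply: eq_hintegral => t t0; rewrite /cpow /= -G; ring.
Qed.

Lemma hintegral_bound (f h : R -> R) M : hcont f -> hcont h ->
  (forall t, 0 < t -> `|f t| <= h t) ->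
  (\int[mu]_(t in D) (h t)%:E <= M%:E)%E ->
  `|\int[mu]_(t in D) f t| <= M.
Proof.
move=> cf ch fh hM.
have mh : measurable_fun D (EFin \o h) by apply/measurable_EFinP; exact: hcont_measurable.
have h0 t : 0 < t -> 0 <= h t by move=> t0; exact: le_trans (fh _ t0).
have ih : mu.-integrable D (EFin \o h).
  apply/integrableP; split => //; apply: le_lt_trans (ltry M); apply: le_trans hM.
  rewrite le_eqVlt; apply/orP; left; apply/eqP; apply: eq_integral => t.
  by rewrite inE/= in_itv/= andbT => t0; rewrite ger0_norm// h0.
have if_ : mu.-integrable D (EFin \o f).
  by apply: hintegrable_le ih => //; exact: hcont_measurable.
apply: (le_trans (normr_hintegral_le if_ ih fh)).
by rewrite -lee_fin /Rintegral fineK//; exact: integrable_fin_num ih.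
Qed.

Lemma bP_hcont r : hcont (bP r).
Proof. by move=> x x0; exact: has_der_continuous (has_der_bP r x0). Qed.

End ComplexLayer.

Lemma hcont_comp {R : realType} (F k : R -> R) : hcont F -> hcont k ->
  (forall u, 0 < u -> 0 < k u) -> hcont (fun u => F (k u)).
Proof.
move=> cF ck k0 u u0; apply: (@continuous_comp _ _ _ k F); first exact: ck.
exact: cF (k0 u u0).
Qed.

Lemma hcont_norm {R : realType} (F : R -> R) : hcont F -> hcont (fun u => `|F u|).
Proof.
move=> cF u u0; apply: (@continuous_comp _ _ _ F (fun x : R => `|x|)); first exact: cF.
exact: norm_continuous.
Qed.

Section WhittakerBound.
Context {R : realType}.
Local Notation mu := (@lebesgue_measure R).
Local Notation D := (`]0, +oo[%classic : set R).

(** Both powers with imaginary exponent have modulus 1. Each [besselK] is half of a [bP], so the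
    real and the imaginary part of the integral are at most [M / 4] each. *)
Lemma cabs_Wtilde_le (t1 t2 y1 y2 M : R) : 0 < y1 -> 0 < y2 ->
  let r := 3 / 2 * (t1 + t2) in
  (\int[mu]_(u in D) (`|bP r (2 * pi * y1 * Num.sqrt (1 + u))| *
     `|bP r (2 * pi * y2 * Num.sqrt (1 + u^-1))| / u)%:E <= M%:E)%E ->
  cabs (Wtilde (0 +i* t1) (0 +i* t2) y1 y2) <=
  4 * pi `^ (3 / 2) *
   ((Num.sqrt (gnorm 2^-1 r))^-1 * ((Num.sqrt (gnorm 2^-1 (3 / 2 * t1)))^-1 *
    (Num.sqrt (gnorm 2^-1 (3 / 2 * t2)))^-1)) * y1 * y2 * M.
Proof.
move=> y10 y20 r HM.
have pi0 := @pi_gt0 R.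
rewrite /Wtilde.
have -> : 0 +i* t1 + 0 +i* t2 = 0 +i* (t1 + t2) :> R[i].
  by apply/eqP; rewrite eq_complex/= addr0 !eqxx.
have -> : 0 +i* t1 - 0 +i* t2 = 0 +i* (t1 - t2) :> R[i].
  by apply/eqP; rewrite eq_complex/= subr0 !eqxx.
have GE (t : R) : cabs (Gamma (1 / 2 + 3 / 2 * (0 +i* t))) = Num.sqrt (gnorm 2^-1 (3 / 2 * t)).
  by rewrite (complex_frac 3 2) cscale_imag Gamma_half.
have PE (n0 n1 n2 : R[i]) (f : R[i] -> R) :
    \prod_(nu <- [:: n0; n1; n2]) f nu = f n0 * (f n1 * f n2).
  by rewrite !big_cons big_nil mulr1.
rewrite PE (GE (t1 + t2)) (GE t1) (GE t2).
rewrite 2!cabsM (_ : (0 +i* (t1 - t2)) / 2 = 0 +i* ((t1 - t2) / 2)); last first.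
  rewrite mulrC -[2^-1]mul1r (complex_frac 1 2) cscale_imag.
  by congr (_ +i* _); field.
rewrite cabs_cpow_imag mulr1 cabs_real.
set P := 4 * _ * _ * _ * _.
have P0 : 0 <= P.
  by rewrite /P !mulr_ge0 ?powR_ge0 ?invr_ge0 ?sqrtr_ge0 ?(ltW y10) ?(ltW y20).
rewrite ger0_norm//.
rewrite (complex_frac 3 2) (complex_frac 3 4) !cscale_imag -/r.
set eta := 3 / 4 * (t1 - t2).
pose h u := `|bP r (2 * pi * y1 * Num.sqrt (1 + u))| * `|bP r (2 * pi * y2 * Num.sqrt (1 + u^-1))| / u.
pose g u := bP r (2 * pi * y1 * Num.sqrt (1 + u)) * bP r (2 * pi * y2 * Num.sqrt (1 + u^-1)) / u / 4.
have xp (y u : R) : 0 < y -> 0 < u -> 0 < 2 * pi * y * Num.sqrt (1 + u).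
  move=> y0 u0; apply: mulr_gt0; last by rewrite sqrtr_gt0 addr_gt0.
  by apply: mulr_gt0 => //; apply: mulr_gt0.
have c1 : hcont (fun u => bP r (2 * pi * y1 * Num.sqrt (1 + u))).
  apply: hcont_comp; [exact: bP_hcont| |by move=> u; exact: xp].
  by move=> u u0; derC; rewrite addr_gt0.
have c2 : hcont (fun u => bP r (2 * pi * y2 * Num.sqrt (1 + u^-1))).
  apply: hcont_comp; [exact: bP_hcont| |].
    by move=> u u0; derC; rewrite ?addr_gt0 ?invr_gt0 ?gt_eqF.
  by move=> u u0; apply: xp; rewrite ?invr_gt0.
have ci : hcont (fun u : R => u^-1) by move=> u u0; derC; rewrite gt_eqF.
have ch : hcont h.
  move=> u u0; apply: continuousM; last exact: ci.
  by apply: continuousM; [exact: hcont_norm c1 _ u0|exact: hcont_norm c2 _ u0].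
have cg : hcont g.
  move=> u u0; apply: continuousM; last exact: cst_continuous.
  by apply: continuousM; [apply: continuousM; [exact: c1|exact: c2]|exact: ci].
have gh (u : R) : 0 < u -> `|g u| <= h u / 4.
  move=> u0; rewrite /g /h !normrM !normfV (gtr0_norm u0) (ger0_norm (_ : 0 <= 4)) ?lexx//.
have half (trig : R -> R) : hcont (fun u => trig (eta * ln u)) -> (forall y, `|trig y| <= 1) ->
    `|\int[mu]_(u in D) (g u * trig (eta * ln u))| <= M / 4.
  move=> ct t1'; apply: (@hintegral_bound _ _ (fun u => 4^-1 * h u)).
  - by move=> u u0; apply: continuousM; [exact: cg|exact: ct].
  - by move=> u u0; apply: continuousM; [exact: cst_continuous|exact: ch].
  - move=> u u0; rewrite normrM; apply: (@le_trans _ _ `|g u|); first by rewrite ler_piMr.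
    by rewrite mulrC gh.
  - under eq_integral do rewrite EFinM.
    rewrite ge0_integralZl//; last 2 first.
    + by apply/measurable_EFinP; exact: hcont_measurable.
    + move=> u; rewrite /= in_itv/= andbT => u0.
      by rewrite lee_fin /h divr_ge0 ?mulr_ge0 ?(ltW u0).
    by rewrite [leRHS](_ : _ = (4^-1)%:E * M%:E)%E ?lee_pmul2l// -EFinM mulrC.
have intE (u : R) : 0 < u ->
    besselK (0 +i* r) (2 * pi * y1 * Num.sqrt (1 + u)) *
    besselK (0 +i* r) (2 * pi * y2 * Num.sqrt (1 + u^-1)) *
    cpow u (0 +i* eta) / u%:C = (g u * cos (eta * ln u)) +i* (g u * sin (eta * ln u)).
  move=> u0; have ui : 0 < u^-1 by rewrite invr_gt0.
  rewrite (besselK_imag r (xp y1 u y10 u0)) (besselK_imag r (xp y2 u^-1 y20 ui)) cpow_imag -fmorphV /g.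
  move: (bP r _) (bP r _) (cos _) (sin _) => p q co si.
  by apply/eqP; rewrite eq_complex/=; apply/andP; split; apply/eqP; field; rewrite gt_eqF.
set I := Cintegral _ _.
have IE : I = (\int[mu]_(u in D) (g u * cos (eta * ln u))) +i*
              (\int[mu]_(u in D) (g u * sin (eta * ln u))).
  by rewrite /I /Cintegral; congr (_ +i* _); apply: eq_hintegral => u u0; rewrite intE.
rewrite ler_wpM2l// IE; apply: (le_trans (cabs_le _ _)).
have hc : hcont (fun u : R => cos (eta * ln u)) by move=> u u0; derC.
have hs : hcont (fun u : R => sin (eta * ln u)) by move=> u u0; derC.
have := half cos hc (@normr_cos_le1 R); have := half sin hs (@normr_sin_le1 R).
have M0 : 0 <= M.
  rewrite -lee_fin; apply: le_trans HM; apply: integral_ge0 => u.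
  rewrite /= in_itv/= andbT => u0.
  by rewrite lee_fin divr_ge0 ?mulr_ge0 ?(ltW u0).
lra.
Qed.

End WhittakerBound.

Section NormalisedIntegral.
Context {R : realType}.
Local Notation mu := (@lebesgue_measure R).
Local Notation D := (`]0, +oo[%classic : set R).

Lemma gnorm_half_invsqrt (c s : R) : 0 < c ->
  c * expR (- (pi * s)) <= gnorm 2^-1 s ->
  (Num.sqrt (gnorm 2^-1 s))^-1 <= (Num.sqrt c)^-1 * expR (pi * s / 2).
Proof.
move=> c0 h; have e0 := expR_gt0 (- (pi * s)).
have g0 : 0 < gnorm 2^-1 s by apply: lt_le_trans h; rewrite mulr_gt0.
have sc : 0 < Num.sqrt c by rewrite sqrtr_gt0.
have -> : (Num.sqrt c)^-1 * expR (pi * s / 2) = (Num.sqrt c * expR (- (pi * s / 2)))^-1.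
  by rewrite expRN invfM invrK.
rewrite lef_pV2 ?posrE ?sqrtr_gt0 ?mulr_gt0 ?expR_gt0//.
rewrite -(@ler_pXn2r _ 2) ?nnegrE ?sqrtr_ge0 ?mulr_ge0 ?expR_ge0 ?(ltW sc)//.
rewrite sqr_sqrtr ?(ltW g0)// exprMn sqr_sqrtr ?(ltW c0)// -expRM_natl.
by rewrite (_ : 2 * - (pi * s / 2) = - (pi * s))//; field.
Qed.

Lemma nK_wt_hcont (r A T : R) : 0 < T -> hcont (fun x => nK r x * wt A T x).
Proof.
move=> T0 x x0; apply: continuousM.
  by apply: continuousM; [exact: cst_continuous|exact: hcont_norm (@bP_hcont R r) _ x0].
by rewrite /wt; derC; rewrite addr_gt0 ?divr_gt0.
Qed.

(** Since [a sqrt (1 + u) >= a], and likewise for [b], the weights inside the integral dominate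
    those at [a] and [b], which can be pulled out. The factor [e^(- pi r)] undoes the normalisation
    of two [nK]. *)
Lemma bessel_product_integral (A C r T a b : R) : 0 < A -> 0 < C -> 2 <= T ->
  (forall x, 0 < x -> (nK r x * wt A T x) ^+ 2 <=
    C * ((Num.sqrt (Num.sqrt ((x ^+ 2 - r ^+ 2) ^+ 2 + 1)))^-1 + x^-1)) ->
  (forall x, 0 < x -> x * (nK r x * wt A T x) ^+ 2 <= C * T) ->
  0 < a -> 0 < b ->
  (\int[mu]_(u in D) (`|bP r (a * Num.sqrt (1 + u))| *
     `|bP r (b * Num.sqrt (1 + u^-1))| / u)%:E <=
   (expR (- (pi * r)) / (wt A T a * wt A T b) *
     (C / Num.sqrt (a * b) * (144 * ln T)))%:E)%E.
Proof.
move=> A0 C0 T2 F1 F2 a0 b0; have T0 : 0 < T by lra.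
pose F x := nK r x * wt A T x.
have F0 x : 0 < x -> 0 <= F x.
  by move=> _; rewrite mulr_ge0 ?nK_ge0 ?(ltW (wt_gt0 _ _ _)).
have cF : hcont F by exact: nK_wt_hcont.
have I := convolution_integral F0 cF C0 T2 F1 F2 a0 b0.
set k := expR _ / _.
have k0 : 0 < k by rewrite divr_gt0 ?expR_gt0 ?mulr_gt0 ?wt_gt0.
pose Phi u := F (a * Num.sqrt (1 + u)) * F (b * Num.sqrt (1 + u^-1)) / u.
pose h u := `|bP r (a * Num.sqrt (1 + u))| * `|bP r (b * Num.sqrt (1 + u^-1))| / u.
have xp (y u : R) : 0 < y -> 0 < u -> 0 < y * Num.sqrt (1 + u).
  by move=> y0 u0; rewrite mulr_gt0// sqrtr_gt0 addr_gt0.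
have c1 (f : R -> R) : hcont f -> hcont (fun u => f (a * Num.sqrt (1 + u))).
  move=> cf; apply: hcont_comp; [exact: cf| |by move=> u; exact: xp].
  by move=> u u0; derC; rewrite addr_gt0.
have c2 (f : R -> R) : hcont f -> hcont (fun u => f (b * Num.sqrt (1 + u^-1))).
  move=> cf; apply: hcont_comp; [exact: cf| |].
    by move=> u u0; derC; rewrite ?addr_gt0 ?invr_gt0 ?gt_eqF.
  by move=> u u0; apply: xp; rewrite ?invr_gt0.
have ci : hcont (fun u : R => u^-1) by move=> u u0; derC; rewrite gt_eqF.
have cPhi : hcont Phi.
  by move=> u u0; apply: continuousM; [apply: continuousM; [exact: c1|exact: c2]|exact: ci].
have cn := hcont_norm (@bP_hcont R r).
have ch : hcont h.
  by move=> u u0; apply: continuousM; [apply: continuousM; [exact: c1 cn _ u0|exact: c2 cn _ u0]|exact: ci].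
have hPhi (u : R) : 0 < u -> h u <= k * Phi u.
  move=> u0; have ui : 0 < u^-1 by rewrite invr_gt0.
  rewrite /h /Phi [leRHS]mulrA ler_pM2r//.
  set x := a * _; set z := b * _.
  have ax : wt A T a <= wt A T x.
    apply: wt_le; rewrite ?(ltW A0)// /x ler_peMr ?(ltW a0)//.
    by rewrite -[leLHS]sqrtr1 ler_wsqrtr// lerDl ltW.
  have bz : wt A T b <= wt A T z.
    apply: wt_le; rewrite ?(ltW A0)// /z ler_peMr ?(ltW b0)//.
    by rewrite -[leLHS]sqrtr1 ler_wsqrtr// lerDl ltW.
  have wab : 0 < wt A T a * wt A T b by rewrite mulr_gt0 ?wt_gt0.
  have ww : wt A T a * wt A T b <= wt A T x * wt A T z.
    by apply: ler_pM; rewrite ?(ltW (wt_gt0 _ _ _)).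
  have E : expR (- (pi * r)) * (expR (pi * r / 2) * expR (pi * r / 2)) = 1.
    by rewrite -!expRD -splitr addNr expR0.
  rewrite /k /F /nK mulrAC ler_pdivlMr//.
  clearbody x z; set B1 := `|bP r x|; set B2 := `|bP r z|.
  rewrite [leRHS](_ : _ = (expR (- (pi * r)) * (expR (pi * r / 2) * expR (pi * r / 2))) * (B1 * B2) * (wt A T x * wt A T z)); last by ring.
  by rewrite E mul1r ler_wpM2l// mulr_ge0 ?normr_ge0.
have Dpos (u : R) : D u -> 0 < u by rewrite /= in_itv/= andbT.
have h0 (u : R) : 0 < u -> 0 <= h u by move=> u0; rewrite divr_ge0 ?mulr_ge0 ?(ltW u0).
have P0 (u : R) : 0 < u -> 0 <= Phi u.
  move=> u0; rewrite divr_ge0 ?(ltW u0)// mulr_ge0// F0// xp ?invr_gt0//.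
apply: (@le_trans _ _ (\int[mu]_(u in D) (k%:E * (Phi u)%:E))%E).
  apply: ge0_le_integral => //.
  - by move=> u Du; rewrite lee_fin h0// Dpos.
  - by apply/measurable_EFinP; exact: hcont_measurable.
  - by apply/measurable_funeM/measurable_EFinP; exact: hcont_measurable.
  - by move=> u Du; rewrite -EFinM lee_fin hPhi// Dpos.
rewrite ge0_integralZl//; last 3 first.
- by apply/measurable_EFinP; exact: hcont_measurable.
- by move=> u Du; rewrite lee_fin P0// Dpos.
- by rewrite lee_fin ltW.
by rewrite [leRHS]EFinM lee_pmul2l// lte_fin.
Qed.

End NormalisedIntegral.

Local Close Scope complex_scope.

Theorem lemma2 (R : realType) (A : R) (hA : 0 < A) :
  exists2 C : R, 0 < C &
    forall nu0 nu1 nu2 : R[i],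
      iRge0 nu0 -> iRge0 nu1 -> iRge0 nu2 -> nu0 = nu1 + nu2 ->
      let T0 := Num.max 2 (Num.max (cabs nu0) (Num.max (cabs nu1) (cabs nu2))) in
      T0 = Num.max 2 (cabs nu0) /\
      forall y1 y2 : R, 0 < y1 -> 0 < y2 ->
        cabs (Wtilde nu1 nu2 y1 y2) <=
        C * ln T0 * Num.sqrt (y1 * y2)
          * (1 + y1 / T0) `^ (- A) * (1 + y2 / T0) `^ (- A).
Proof.
have [c c0 Hc] := @gnorm_half_ge R; have [C1 C10 HC] := nK_bounds hA.
have pi0 := @pi_gt0 R; have pi2 := @pi_ge2 R.
have sc : 0 < Num.sqrt c by rewrite sqrtr_gt0.
(* [P] collects the prefactor and the three Gamma bounds; [C1 * 144] comes from the convolution, and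
   [1 / (2 pi)] from the arguments [2 pi y_j] under [sqrt (ab)]. *)
pose P : R := 4 * pi `^ (3 / 2) * (Num.sqrt c) ^- 3.
have P0 : 0 < P by rewrite !mulr_gt0 ?powR_gt0 ?invr_gt0 ?exprn_gt0.
exists (P * (C1 * 144 / (2 * pi))) => [|nu0 nu1 nu2].
  by apply: mulr_gt0 => //; apply: divr_gt0; apply: mulr_gt0.
move=> [t0 t00 ->] [t1 t10 ->] [t2 t20 ->] E T0.
have {}E : t0 = t1 + t2.
  by move/eqP: E; rewrite eq_complex/= => /andP[_ /eqP].
(* All three parameters are nonnegative, so the sum [t0] dominates [t1] and [t2]. *)
have TE : T0 = Num.max 2 (cabs (Complex 0 t0)).
  rewrite /T0 !cabs_imag !ger0_norm//; congr Num.max; apply/max_idPl.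
  by rewrite ge_max E lerDl lerDr t20.
split => // y1 y2 y10 y20.
have T2 : 2 <= T0 by rewrite TE le_max lexx.
have Tt : t0 <= T0 by rewrite TE cabs_imag ger0_norm// le_max lexx orbT.
have TT0 : 0 < T0 by lra.
move: (T0) TE T2 Tt TT0 => T _ T2 Tt TT0.
pose r := 3 / 2 * (t1 + t2).
have r0 : 0 <= r by rewrite mulr_ge0// -E.
have rT : 2 * r <= 3 * T by rewrite /r -E; lra.
have a0 : 0 < 2 * pi * y1 by rewrite !mulr_gt0.
have b0 : 0 < 2 * pi * y2 by rewrite !mulr_gt0.
have I := bessel_product_integral hA C10 T2
  (fun x x0 => (HC r T x r0 T2 rT x0).1) (fun x x0 => (HC r T x r0 T2 rT x0).2) a0 b0.
apply: (le_trans (cabs_Wtilde_le y10 y20 I)).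
have pw y : 0 < y -> (1 + y / T) `^ (- A) = (wt A T y)^-1.
  move=> y0; have p : 0 < 1 + y / T by rewrite addr_gt0 ?divr_gt0.
  by rewrite /powR gt_eqF// mulNr expRN.
rewrite !pw//.
have G s : 0 <= s -> (Num.sqrt (gnorm 2^-1 s))^-1 <= (Num.sqrt c)^-1 * expR (pi * s / 2).
  by move=> s0; apply: gnorm_half_invsqrt => //; exact: Hc.
have h32 : 0 <= 3 / 2 :> R by lra.
have g1 := G _ r0.
have g2 := G _ (mulr_ge0 h32 t10).
have g3 := G _ (mulr_ge0 h32 t20).
move: g1 g2 g3; set s0 := (Num.sqrt (gnorm 2^-1 r))^-1.
set s1 := (Num.sqrt (gnorm 2^-1 (3 / 2 * t1)))^-1.
set s2 := (Num.sqrt (gnorm 2^-1 (3 / 2 * t2)))^-1.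
set d := (Num.sqrt c)^-1 => g1 g2 g3.
have sq (z : R) : 0 <= (Num.sqrt z)^-1 by rewrite invr_ge0 sqrtr_ge0.
have S012 : s0 * (s1 * s2) <= d ^+ 3 * expR (pi * r).
  have -> : d ^+ 3 * expR (pi * r) = (d * expR (pi * r / 2)) *
     ((d * expR (pi * (3 / 2 * t1) / 2)) * (d * expR (pi * (3 / 2 * t2) / 2))).
    have -> : expR (pi * r) = expR (pi * r / 2) * (expR (pi * (3 / 2 * t1) / 2) * expR (pi * (3 / 2 * t2) / 2)).
      by rewrite -!expRD; congr expR; rewrite /r; field.
    ring.
  by apply: ler_pM; rewrite ?mulr_ge0 ?sq//; apply: ler_pM; rewrite ?sq.
have lT : 0 < ln T by rewrite ln_gt0//; lra.
have sab : Num.sqrt (2 * pi * y1 * (2 * pi * y2)) = 2 * pi * Num.sqrt (y1 * y2).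
  rewrite (_ : 2 * pi * y1 * (2 * pi * y2) = (2 * pi) ^+ 2 * (y1 * y2)); last by ring.
  by rewrite sqrtrM ?sqr_ge0// sqrtr_sqr ger0_norm// mulr_ge0// ltW.
(* As [2 pi >= 1], the weight at [2 pi y1] is at least the weight at [y1]. *)
have wt1 : (wt A T (2 * pi * y1))^-1 <= (wt A T y1)^-1.
  rewrite lef_pV2 ?posrE ?wt_gt0//; apply: wt_le; rewrite ?(ltW hA)//.
  by rewrite ler_peMl ?(ltW y10)//; lra.
have wt2 : (wt A T (2 * pi * y2))^-1 <= (wt A T y2)^-1.
  rewrite lef_pV2 ?posrE ?wt_gt0//; apply: wt_le; rewrite ?(ltW hA)//.
  by rewrite ler_peMl ?(ltW y20)//; lra.
have wi (y : R) : 0 < (wt A T y)^-1 by rewrite invr_gt0 wt_gt0.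
have ww : (wt A T (2 * pi * y1))^-1 * (wt A T (2 * pi * y2))^-1 <= (wt A T y1)^-1 * (wt A T y2)^-1.
  by apply: ler_pM; rewrite ?(ltW (wi _)).
have sy : 0 < Num.sqrt (y1 * y2) by rewrite sqrtr_gt0 mulr_gt0.
have sy2 : y1 * y2 = Num.sqrt (y1 * y2) * Num.sqrt (y1 * y2).
  by rewrite -expr2 sqr_sqrtr// mulr_ge0 ?ltW.
have EE : expR (pi * r) * expR (- (pi * r)) = 1 by rewrite -expRD subrr expR0.
rewrite sab; set S := Num.sqrt (y1 * y2) in sy sy2 *.
set w1 := (wt A T y1)^-1 in ww *; set w2 := (wt A T y2)^-1 in ww *.
set v := (wt A T (2 * pi * y1))^-1 * _ in ww.
have v0 : 0 <= v by rewrite mulr_ge0// ltW.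
pose Q := 4 * pi `^ (3 / 2) * (C1 * 144 / (2 * pi)) * ln T * S.
have Q0 : 0 <= Q.
  have p1 : 0 <= 4 * pi `^ (3 / 2) :> R by rewrite mulr_ge0 ?powR_ge0.
  have p2 : 0 <= C1 * 144 / (2 * pi) by rewrite divr_ge0 ?mulr_ge0 ?(ltW C10) ?(ltW pi0).
  by rewrite /Q mulr_ge0 ?(ltW sy)// mulr_ge0 ?(ltW lT)// mulr_ge0.
rewrite [leLHS](_ : _ = Q * (s0 * (s1 * s2) * expR (- (pi * r)) * v)); last first.
  rewrite /Q /v !invfM -[4 * _ * _ * y1 * y2]mulrA sy2.
  move: (expR _) => e; move: (@pi R) pi0 => p p0.
  by field; rewrite !gt_eqF//; exact: wt_gt0.
rewrite [leRHS](_ : _ = Q * (d ^+ 3 * (w1 * w2))); last first.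
  by rewrite /Q /P /d; move: (@pi R) pi0 => p p0; field; rewrite !gt_eqF.
apply: ler_wpM2l => //; apply: ler_pM => //.
  by rewrite mulr_ge0 ?expR_ge0// mulr_ge0 ?sq// mulr_ge0 ?sq.
apply: (@le_trans _ _ (d ^+ 3 * expR (pi * r) * expR (- (pi * r)))).
  by rewrite ler_wpM2r ?expR_ge0.
by rewrite -mulrA EE mulr1.
Qed.
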